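(* Suppose that $B(\alpha_0,\lambda_0+i0)=0$ and $\det\big(D^2F_1(\alpha_0,\lambda_0)\big)<0$ for some $\alpha_0\in\mathbb{R}$ and $\lambda_0\ge0$, where $D^2F_1$ is the Hessian of $F_1$ with respect to $(\alpha,\lambda)$. Then there exist open intervals $J$ around $\lambda_0$ and $I$ around $\alpha_0$ and two distinct smooth functions $\lambda_j:I\to J$, $j=1,2$, such that $\lambda_j(\alpha_0)=\lambda_0$ and $F_1(\alpha,\lambda_j(\alpha))=0$ for all $\alpha\in I$, with $$\lambda_j'(\alpha_0)=\frac{\|\phi_1\|^2+\|\phi_2\|^2+(-1)^{j+1}d}{2\alpha_0^2\big(\|\phi_1\|^2\|\phi_2\|^2-|\langle\phi_1,\phi_2\rangle|^2\big)},$$ where $d=\sqrt{-\det(D^2F_1(\alpha_0,\lambda_0))}$ and $\phi_j=\Phi_{u_j,\lambda_0}$ for $j=1,2$. If $\lambda_0>0$, the interval $J$ can be chosen to be contained in $(0,\infty)$.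
   Context: Inner products are linear in the first argument. On $\mathbb{R}^3$, $\widehat f(\xi)=(2\pi)^{-3/2}\int f(x)e^{-i\xi\cdot x}\,dx$. For $v\in L^2(\mathbb{R}^3)$, $\lambda\ge 0$, let $v_\lambda\in L^2(S^2)$, $v_\lambda(\omega)=2^{-1/2}\lambda^{1/4}\widehat v(\sqrt\lambda\,\omega)$; $v\mapsto(v_\lambda)_\lambda$ is unitary onto $L^2([0,\infty);L^2(S^2))$. $\mathcal{E}$ is the set of $v\in L^2(\mathbb{R}^3)$ such that $\lambda\mapsto v_\lambda$ is strongly smooth on $[0,\infty)$ and decays rapidly as $\lambda\to0$ and $\lambda\to\infty$ (for all $k,N\ge0$ the $k$-th strong derivative $v^{(k)}_\lambda$ satisfies $\lambda^{-N}\|v^{(k)}_\lambda\|\to0$ as $\lambda\to0$ and $\lambda^{N}\|v^{(k)}_\lambda\|\to0$ as $\lambda\to\infty$). For $v,w\in\mathcal{E}$, $\eta_{v,w}(\lambda)=\langle v_\lambda,w_\lambda\rangle$ for $\lambda\ge0$ and $0$ for $\lambda<0$. For $f\in\mathcal{S}(\mathbb{R})$, $\gamma(f,\lambda)=\lim_{\epsilon\to0^+}\int_{\mathbb{R}\setminus(\lambda-\epsilon,\lambda+\epsilon)}\frac{f(x)}{x-\lambda}\,dx$. For $v\in\mathcal{E}$ with $v_a=0$ ($a\ge0$), $\Phi_{v,a}\in L^2(\mathbb{R}^3)$ is given by $(\Phi_{v,a})_\lambda=v_\lambda/(\lambda-a)$ for $\lambda\ne a$ and $(\Phi_{v,a})_a=v'_a$.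 Fix $u_1,u_2\in\mathcal{E}$ with $u_1\perp u_2$, and put $\eta_{jk}=\eta_{u_j,u_k}$. For real $\alpha,\lambda$, $B(\alpha,\lambda+i0)=C(\alpha,\lambda)+iD(\alpha,\lambda)$ is the $2\times2$ matrix with $C,D$ Hermitian, $c_{jk}(\alpha,\lambda)=\delta_{jk}+\alpha\gamma(\eta_{kj},\lambda)$, $d_{jk}(\alpha,\lambda)=\alpha\pi\eta_{kj}(\lambda)$. Put $F(\alpha,\lambda)=\det B(\alpha,\lambda+i0)=F_1+iF_2$ with $F_1,F_2$ real; explicitly $F_1=(1+\alpha\gamma(\eta_{11},\lambda))(1+\alpha\gamma(\eta_{22},\lambda))-\alpha^2|\gamma(\eta_{12},\lambda)|^2-\alpha^2\pi^2(\eta_{11}(\lambda)\eta_{22}(\lambda)-|\eta_{12}(\lambda)|^2)$. If $B(\alpha_0,\lambda_0+i0)=0$ then $\alpha_0\neq0$ and $(u_1)_{\lambda_0}=(u_2)_{\lambda_0}=0$, so $\phi_1,\phi_2$ are defined. *)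

(* Defs.v *)
From HB Require Import structures.
From mathcomp Require Export all_boot all_order all_algebra.
From mathcomp Require Export complex.
From mathcomp Require Export all_classical all_reals all_analysis.
From mathcomp Require Export measurable_realfun.

Set Implicit Arguments.
Unset Strict Implicit.
Unset Printing Implicit Defensive.

Import Order.TTheory GRing.Theory Num.Theory.
Import numFieldNormedType.Exports.
Export numFieldNormedType.Exports.

#[global] Open Scope classical_set_scope.
#[global] Open Scope ring_scope.
#[global] Open Scope complex_scope.

(* measurableTypeR R is R with its Borel sigma-algebra, convertible to R. *)
Notation R3 R :=
  (measurableTypeR R * measurableTypeR R * measurableTypeR R)%type.

Section Euclidean3.
Context {R : realType}.
Implicit Types (x y : R3 R) (t : R).

Definition leb : {measure set (measurableTypeR R) -> \bar R} :=
  @lebesgue_measure R.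

Definition leb3 : {measure set (R3 R) -> \bar R} :=
  ((leb \x leb) \x leb)%E.

Definition dot3 x y : R := x.1.1 * y.1.1 + x.1.2 * y.1.2 + x.2 * y.2.
Definition norm3 x : R := Num.sqrt (dot3 x x).
Definition scale3 t x : R3 R := (t * x.1.1, t * x.1.2, t * x.2).

(* The surface measure of the unit sphere, as a Borel measure on R^3 carried
   by the sphere: sigma(A) = 3 |{r w : 0 < r <= 1, w \in A, |w| = 1}|, i.e. the
   normalization dx = r^2 dr dsigma(w), of total mass 4 pi.  Elements of
   L^2(S^2) are represented by functions on R^3, up to sigma-null sets. *)
Definition cone (A : set (R3 R)) : set (R3 R) :=
  [set x | 0 < norm3 x <= 1 /\ A (scale3 (norm3 x)^-1 x)].

Definition surface (A : set (R3 R)) : \bar R := (3%:E * leb3 (cone A))%E.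

Let measurable_norm3 : measurable_fun setT (norm3 : R3 R -> R).
Proof.
have m1 : measurable_fun setT (fun x : R3 R => x.1.1 : R).
  exact: (measurableT_comp measurable_fst measurable_fst).
have m2 : measurable_fun setT (fun x : R3 R => x.1.2 : R).
  exact: (measurableT_comp measurable_snd measurable_fst).
have m3 : measurable_fun setT (fun x : R3 R => x.2 : R) by exact: measurable_snd.
have ms : measurable_fun setT (@Num.sqrt R).
  exact: (continuous_measurable_fun (@sqrt_continuous R)).
apply: (measurableT_comp ms).
by apply: measurable_funD;
  [apply: measurable_funD|];
  apply: measurable_funM.
Qed.

Let measurable_cone A : measurable A -> measurable (cone A).
Proof.
move=> mA.
have mV : measurable_fun setT (fun x : R3 R => (norm3 x)^-1 : R).
  rewrite (_ : (fun x => _) = (fun x => norm3 x `^ (-1))).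
    exact: (measurableT_comp (measurable_powR _)).
  by apply/funext => x; rewrite powR_inv1// sqrtr_ge0.
have m : measurable_fun setT (fun x : R3 R => scale3 (norm3 x)^-1 x).
  apply: measurable_fun_pair; first apply: measurable_fun_pair.
  - apply: measurable_funM => //.
    exact: (measurableT_comp measurable_fst measurable_fst).
  - apply: measurable_funM => //.
    exact: (measurableT_comp measurable_snd measurable_fst).
  - by apply: measurable_funM => //; exact: measurable_snd.
have -> : cone A = (norm3 @^-1` `]0, 1]) `&`
    ((fun x => scale3 (norm3 x)^-1 x) @^-1` A).
  by apply/seteqP; split=> x /=; rewrite in_itv.
apply: measurableI.
  by rewrite -[X in measurable X]setTI; apply: measurable_norm3.
by rewrite -[X in measurable X]setTI; apply: m.
Qed.

Let surface0 : surface set0 = 0%E.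
Proof.
by rewrite /surface (_ : cone set0 = set0) ?measure0 ?mule0// -subset0 => x [].
Qed.

Let surface_ge0 A : (0 <= surface A)%E.
Proof. by rewrite /surface mule_ge0. Qed.

Let surface_sigma_additive : semi_sigma_additive surface.
Proof.
move=> F mF tF mUF; rewrite /surface.
have -> : cone (\bigcup_n F n) = \bigcup_n cone (F n).
  apply/seteqP; split=> x; first by case=> x01 [n _ Fx]; exists n.
  by case=> n _ [x01 Fx]; split => //; exists n.
rewrite (_ : (fun n => _) =
    (fun n => 3%:E * \sum_(0 <= i < n) leb3 (cone (F i)))%E); last first.
  by apply/funext => n; rewrite ge0_sume_distrr.
apply: cvgeZl => //; apply: measure_semi_sigma_additive.
- by move=> n; exact: measurable_cone.
- apply/trivIsetP => i j _ _ ij; apply/seteqP; split=> // x [[_ Fi] [_ Fj]].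
  move/trivIsetP : tF => /(_ i j Logic.I Logic.I ij) Fij.
  suff: set0 (scale3 (norm3 x)^-1 x) by [].
  by rewrite -Fij; split.
- by apply: bigcup_measurable => n _; exact: measurable_cone.
Qed.

HB.instance Definition _ := isMeasure.Build _ _ _ surface
  surface0 surface_ge0 surface_sigma_additive.

End Euclidean3.

Section L2.
Context d {T : measurableType d} {R : realType}.
Variable mu : {measure set T -> \bar R}.
Implicit Types f g : T -> R[i].

Definition cintegral f : R[i] :=
  (\int[mu]_x complex.Re (f x)) +i* (\int[mu]_x complex.Im (f x)).

Definition L2enorm f : \bar R :=
  Lnorm mu 2%:E (fun x => (ComplexField.Normc.normc (f x))%:E).

Definition inL2 f := [/\ measurable_fun setT (fun x => complex.Re (f x)),
  measurable_fun setT (fun x => complex.Im (f x)) & (L2enorm f < +oo)%E].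

Definition L2norm f : R := fine (L2enorm f).

Definition L2dot f g : R[i] := cintegral (fun x => f x * conjc (g x)).

End L2.

Section Fourier.
Context {R : realType}.
Implicit Types v g : R3 R -> R[i].

Definition expmi (t : R) : R[i] := cos t -i* sin t.

Definition fourier_integral v (xi : R3 R) : R[i] :=
  ((2 * pi) `^ (- (3 / 2)))%:C *
  cintegral leb3 (fun x : R3 R => v x * expmi (dot3 xi x)).

Definition continuous_compact_support v :=
  [/\ continuous (fun x : R * R * R => complex.Re (v x)),
      continuous (fun x : R * R * R => complex.Im (v x)) &
      exists r : R, forall x, r < norm3 x -> v x = 0].

(* g is the Fourier-Plancherel transform of v in L^2(R^3): the transform is
   extended by L^2-continuity from C_c(R^3), dense in L^2(R^3), on which it is
   given by the absolutely convergent integral. *)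
Definition is_fourier v g := [/\ inL2 leb3 v, inL2 leb3 g &
  exists w : nat -> R3 R -> R[i],
    [/\ forall n, continuous_compact_support (w n),
        L2enorm leb3 (fun x : R3 R => w n x - v x) @[n --> \oo] --> 0%E &
        L2enorm leb3 (fun xi : R3 R => fourier_integral (w n) xi - g xi)
          @[n --> \oo] --> 0%E]].

(* V l = v_l in L^2(S^2) for almost every l > 0. *)
Definition is_trace v (V : R -> R3 R -> R[i]) :=
  exists2 g, is_fourier v g &
    {ae leb, forall l : R, 0 < l -> {ae surface, forall w,
      V l w = (2 `^ (- (1 / 2)) * l `^ (1 / 4))%:C
              * g (scale3 (Num.sqrt l) w)}}.

(* V 0 is a strongly smooth representative of l |-> v_l on [0, +oo[, with
   strong derivatives V k, all of them rapidly decaying at 0 and at +oo. *)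
Definition smooth_trace v (V : nat -> R -> R3 R -> R[i]) :=
  [/\ forall k (l : R), 0 <= l -> inL2 surface (V k l),
      is_trace v (V 0%N),
      forall k (l : R), 0 <= l ->
        L2enorm surface
          (fun w : R3 R => (h^-1)%:C * (V k (l + h) w - V k l w) - V k.+1 l w)
          @[h --> within [set h : R | 0 <= l + h] 0^'] --> 0%E,
      forall k N, (l ^- N * L2norm surface (V k l)) @[l --> 0^'+] --> (0 : R) &
      forall k N, (l ^+ N * L2norm surface (V k l)) @[l --> +oo] --> (0 : R)].

Definition calE v := inL2 leb3 v /\ exists V, smooth_trace v V.

(* dtrace v k l is the k-th strong derivative of l |-> v_l; for v in calE and
   0 <= l it is unique up to sigma-null sets. *)
Definition dtrace v : nat -> R -> R3 R -> R[i] :=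
  xget (fun _ _ _ => 0) [set V | smooth_trace v V].

Definition trace v : R -> R3 R -> R[i] := dtrace v 0.

Definition eta v w (l : R) : R[i] :=
  if 0 <= l then L2dot surface (trace v l) (trace w l) else 0.

(* phi is Phi_{v,a}; its class in L^2(R^3) is determined by this. *)
Definition is_Phi v (a : R) phi := inL2 leb3 phi /\
  is_trace phi (fun l w =>
    if l == a then dtrace v 1 a w else ((l - a)^-1)%:C * trace v l w).

End Fourier.

Section Determinant.
Context {R : realType}.

Definition principal_value (f : R -> R) (l : R) : R :=
  lim ((\int[leb]_(x in ~` `]l - e, l + e[) (f x / (x - l))) @[e --> 0^'+]).

Definition gamma (f : R -> R[i]) (l : R) : R[i] :=
  principal_value (fun x => complex.Re (f x)) l
  +i* principal_value (fun x => complex.Im (f x)) l.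

(* The vectors u_1, u_2 are u 0, u 1; likewise for all other indices. *)
Variable u : 'I_2 -> R3 R -> R[i].

Definition Cmx (alpha l : R) : 'M[R[i]]_2 :=
  \matrix_(j, k) ((j == k)%:R + alpha%:C * gamma (eta (u k) (u j)) l).

Definition Dmx (alpha l : R) : 'M[R[i]]_2 :=
  \matrix_(j, k) ((alpha * pi)%:C * eta (u k) (u j) l).

Definition Bmx (alpha l : R) : 'M[R[i]]_2 := Cmx alpha l + 'i%C *: Dmx alpha l.

Definition F1 (p : R * R) : R := complex.Re (\det (Bmx p.1 p.2)).

Definition hessian (f : R * R -> R) (p : R * R) : 'M[R]_2 :=
  let e (i : 'I_2) : R * R := if i == ord0 then (1, 0) else (0, 1) in
  \matrix_(i, j) 'D_(e i) ('D_(e j) f) p.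

Definition smooth_on (I : set R) (f : R -> R) :=
  forall n x, I x -> derivable (derive1n n f) x 1.

End Determinant.

(* Main.v *)
Require Import Defs.
From HB Require Import structures.
From mathcomp Require Import ring lra.

(** Write e0, e1 for the squared norms of the traces of u_1, u_2 on the sphere
    of energy l, extended by 0 to l < 0, and p + i r for their inner product.
    The flatness imposed at 0 and the decay imposed at infinity make these four
    functions Schwartz on the line ([Schwartz_ext_dot]).  The principal value of
    such an f is pv f l = int_0^oo (f(l+t) - f(l-t))/t dt, which is smooth in l
    and commutes with differentiation ([principal_value_pv], [is_derive_pv]).
    As the entries of B are affine in alpha, F_1 is the polynomial
    1 + alpha T(l) + alpha^2 Q(l) with T = pv e0 + pv e1 and
    Q = pv e0 pv e1 - (pv p)^2 - (pv r)^2 - pi^2 (e0 e1 - p^2 - r^2) ([F1E]).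

    In the unknown b = 1/alpha the equation F_1 = 0 reads b^2 + T b + Q = 0.
    Its discriminant is
      (pv e0 - pv e1)^2 + 4 ((pv p)^2 + (pv r)^2) + 4 pi^2 (e0 e1 - p^2 - r^2),
    and B(alpha_0, lambda_0) = 0 says that each factor in it vanishes at
    lambda_0; by Hadamard's lemma it equals (l - lambda_0)^2 e(l) with e smooth.
    A direct computation gives e(lambda_0) = - det D^2 F_1 = d^2 > 0, so that
    the roots b = (- T +- (l - lambda_0) sqrt(e))/2 are smooth near lambda_0.
    Inverting l |-> 1/b(l) yields the two branches ([quadratic_branches]).

    The derivatives at lambda_0 come from the identity
    (pv f)'(lambda_0) = int f(x)/(x - lambda_0)^2 dx, valid when f has a double
    zero at lambda_0 ([derive1_pv_double_zero]): e0 and e1 have a minimum there,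
    and so have the nonnegative quadratic forms e1 - 2 (s p + t r)
    + (s^2 + t^2) e0.  Applied to e0, e1, p and r, the integral gives
    |phi_1|^2, |phi_2|^2 and the two parts of <phi_1, phi_2>.  The denominator
    is the Gram determinant of phi_1, phi_2; were it zero, one of the quadratic
    forms above would vanish identically, p and r would be multiples of e0,
    orthogonality of u_1 and u_2 would make these multiples zero, and then
    e1 = 0, contradicting 1 + alpha_0 pv e1 = 0 ([gram_neq0]).

    Transferring norms from the energy spheres to R^3 requires that
    v |-> (v_l)_l preserve norms ([trace_norm]) and, by polarization, inner
    products ([trace_sdot]).  This combines Plancherel's formula for continuous
    functions of compact support ([plancherel_ccs]), obtained from the Poisson
    kernel, its extension to L^2 by continuity ([is_fourier_norm]), and
    integration in polar coordinates ([polar_coordinates]). *)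

Set Implicit Arguments.
Unset Strict Implicit.
Unset Printing Implicit Defensive.

Import Order.TTheory GRing.Theory Num.Theory.

(** * Functions of class C^k on a subset of the line *)

Section Ck.
Context {R : realType}.
Implicit Types (U V : set R) (f g : R -> R) (n : nat).

(** Derivatives are supplied as witnesses, so that the closure properties below
    are inductions on [n] without any rewriting of iterated derivatives. *)
Fixpoint Ck U n f : Prop :=
  if n is m.+1 then
    exists2 g, (forall x, U x -> is_derive x 1 f (g x)) & Ck U m g
  else forall x, U x -> {for x, continuous f}.

Lemma is_derive_continuous (x l : R) f : is_derive x 1 f l -> {for x, continuous f}.
Proof. by move=> ?; apply/differentiable_continuous/derivable1_diffP. Qed.

Lemma derive1_val (x l : R) f : is_derive x 1 f l -> derive1 f x = l.
Proof. by move=> ?; rewrite derive1E; exact: derive_val. Qed.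

Lemma Ck_continuous U n f x : Ck U n f -> U x -> {for x, continuous f}.
Proof.
case: n => [|n]; first exact.
by case=> g fg _ /fg; exact: is_derive_continuous.
Qed.

Lemma CkW U n f : Ck U n.+1 f -> Ck U n f.
Proof.
elim: n f => [|n IH] f; first by move=> h x; exact: Ck_continuous h.
by case=> g fg /IH; exists g.
Qed.

Lemma CkS U V n f : V `<=` U -> Ck U n f -> Ck V n f.
Proof.
move=> VU; elim: n f => [|n IH] f /=; first by move=> h x /VU; exact: h.
by case=> g fg /IH h; exists g => // x /VU; exact: fg.
Qed.

Lemma eq_Ck U n f g : open U -> (forall x, U x -> f x = g x) ->
  Ck U n f -> Ck U n g.
Proof.
move=> oU fg.
have nfg x : U x -> \near x, f x = g x.
  by move=> Ux; apply: filterS (open_nbhs_nbhs (conj oU Ux)).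
case: n => [|n] /=.
  move=> h x Ux; have : f y @[y --> x] --> f x by exact: h.
  rewrite (fg x Ux); apply: cvg_trans; apply: near_eq_cvg.
  by apply: filterS (nfg _ Ux) => y ->.
case=> h fh Ch; exists h => // x Ux.
exact: (near_eq_is_derive (nfg x Ux) (fh x Ux)).
Qed.

Lemma Ck_cst U n (c : R) : Ck U n (fun=> c).
Proof.
elim: n c => [|n IH] c /=; first by move=> x _; exact: cst_continuous.
by exists (fun=> 0) => // x _; exact: is_derive_cst.
Qed.

Lemma Ck_id U n : Ck U n (fun x => x).
Proof.
case: n => [|n] /=; first by move=> x _; exact: cvg_id.
exists (fun=> 1); last exact: Ck_cst.
by move=> x _; exact: is_derive_id.
Qed.

Lemma CkD U n f g : Ck U n f -> Ck U n g -> Ck U n (fun x => f x + g x).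
Proof.
elim: n f g => [|n IH] f g /=.
  by move=> hf hg x Ux; apply: cvgD; [exact: hf|exact: hg].
case=> f' ff' Cf' [g' gg' Cg']; exists (fun x => f' x + g' x); last exact: IH.
move=> x Ux; have := ff' x Ux; have := gg' x Ux => ? ?.
exact: is_deriveD.
Qed.

Lemma CkM U n f g : Ck U n f -> Ck U n g -> Ck U n (fun x => f x * g x).
Proof.
elim: n f g => [|n IH] f g.
  by move=> /= hf hg x Ux; apply: cvgM; [exact: hf|exact: hg].
move=> Cf Cg; case: (Cf) => f' ff' Cf'; case: (Cg) => g' gg' Cg'.
exists (fun x => f x * g' x + g x * f' x).
  move=> x Ux; have := ff' x Ux; have := gg' x Ux => ? ?.
  exact: is_deriveM.
by apply: CkD; apply: IH => //; exact: CkW.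
Qed.

Lemma CkZ U n c f : Ck U n f -> Ck U n (fun x => c * f x).
Proof. by move=> Cf; apply: CkM => //; exact: Ck_cst. Qed.

Lemma CkB U n f g : Ck U n f -> Ck U n g -> Ck U n (fun x => f x - g x).
Proof.
move=> Cf Cg; rewrite (_ : (fun x => _) = (fun x => f x + -1 * g x)).
  by apply: CkD => //; exact: CkZ.
by apply/funext => x; rewrite mulN1r.
Qed.

Lemma Ck_comp U V n f g : (forall x, V x -> U (g x)) ->
  Ck U n f -> Ck V n g -> Ck V n (fun x => f (g x)).
Proof.
move=> VU; elim: n f => [|n IH] f.
  move=> /= hf hg x Vx.
  by apply: (@continuous_comp _ _ _ g f) => //; [exact: hg|exact/hf/VU].
move=> [f' ff' Cf'] Cg; case: (Cg) => g' gg' Cg'.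
exists (fun x => f' (g x) * g' x); last first.
  by apply: CkM => //; apply: IH => //; exact: CkW.
move=> x Vx; have ? := ff' _ (VU _ Vx); have ? := gg' x Vx.
exact: is_derive1_comp.
Qed.

(** The derivative of the inverse is minus its square, which is a product of two
    functions of the class already known: hence the induction. *)
Lemma Ck_inv n : Ck [set x | x != 0] n (fun x => x^-1).
Proof.
elim: n => [|n IH] /=; first by move=> x x0; exact: inv_continuous.
exists (fun x => -1 * (x^-1 * x^-1)); last by apply: CkZ; exact: CkM.
move=> x x0.
apply: DeriveDef; first exact: derivableV.
by rewrite deriveV// derive_id /GRing.scale/= mulr1 mulN1r -exprVn expr2.
Qed.

Lemma Ck_sqrt n : Ck [set x : R | 0 < x] n Num.sqrt.
Proof.
elim: n => [|n IH] /=; first by move=> x _; exact: sqrt_continuous.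
exists (fun x => (2 * Num.sqrt x)^-1); first by move=> x x0; exact: is_derive1_sqrt.
apply: (@Ck_comp [set x | x != 0] _ n (fun x => x^-1)).
- by move=> x /= x0; rewrite gt_eqF// mulr_gt0// sqrtr_gt0.
- exact: Ck_inv.
- exact: CkZ.
Qed.

Definition Cinf U f := forall n, Ck U n f.

Lemma Cinf_is_derive U f : Cinf U f ->
  forall x, U x -> is_derive x 1 f (derive1 f x).
Proof.
move=> Cf x Ux; have [g fg _] := Cf 1%N.
by rewrite (derive1_val (fg _ Ux)); exact: fg.
Qed.

Lemma Cinf_derive1 U f : open U -> Cinf U f -> Cinf U (derive1 f).
Proof.
move=> oU Cf n; have [g fg Cg] := Cf n.+1.
apply: eq_Ck Cg => // x Ux.
by rewrite (derive1_val (fg _ Ux)).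
Qed.

Lemma Cinf_smooth_on U f : open U -> Cinf U f -> smooth_on U f.
Proof.
move=> oU Cf n x Ux.
suff h : Cinf U (derive1n n f).
  by have := Cinf_is_derive h Ux.
elim: n => [|n IH]; first by [].
by rewrite derive1nS; exact: Cinf_derive1.
Qed.

End Ck.

(** * The inverse function theorem on the line *)

Section inverse.
Context {R : realType}.
Implicit Types (U V : set R) (f g : R -> R) (n : nat).

(** The derivative keeps its sign near [x0], so [f] is injective on a ball and the
    inverse is continuous there.  Smoothness is bootstrapped from
    g' = 1/(f' o g): if [g] is C^n then so is g'. *)
Lemma local_inverse U f x0 : open U -> U x0 -> Cinf U f -> derive1 f x0 != 0 ->
  exists2 e : R, 0 < e & exists g,
    [/\ Cinf (ball (f x0) e) g, g (f x0) = x0,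
        forall y, ball (f x0) e y -> U (g y) /\ f (g y) = y &
        is_derive (f x0) 1 g (derive1 f x0)^-1].
Proof.
move=> oU Ux0 Cf f'x0.
have Cf' := Cinf_derive1 oU Cf.
have f'0 : \near x0, derive1 f x0 != 0.
  have : {for x0, continuous (derive1 f)} by exact: Ck_continuous (Cf' 0%N) Ux0.
  move=> /cvgr_neq0; exact.
have : \near x0, U x0 /\ derive1 f x0 != 0.
  by near=> x; split; near: x => //; exact: open_nbhs_nbhs.
move=> [d /= d0 dU].
have Bd x : ball x0 d x -> U x /\ derive1 f x != 0 by move=> /dU.
have ballitv x : ball x0 d x = (x \in `]x0 - d, x0 + d[) :> Prop.
  by rewrite ball_itv.
have Bdn x : ball x0 d x -> \near x, ball x0 d x.
  by move=> ?; apply: open_nbhs_nbhs; split => //; exact: ball_open.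
have inj x y : ball x0 d x -> ball x0 d y -> f x = f y -> x = y.
  wlog xy : x y / x < y.
    move=> H Bx By fxy; have [xy|xy|//] := ltgtP x y; first exact: H.
    by apply/esym; apply: H.
  move=> Bx By fxy.
  have sub z : z \in `[x, y] -> ball x0 d z.
    rewrite !ballitv !in_itv/= in Bx By *; lra.
  have [||c cxy] := @MVT _ f (derive1 f) _ _ xy.
  - move=> z zxy; apply: (Cinf_is_derive Cf).
    by have [] := Bd z (sub _ (subset_itv_oo_cc zxy)).
  - apply: derivable_within_continuous => z zxy.
    by have := Cinf_is_derive Cf (Bd z (sub _ zxy)).1.
  rewrite fxy subrr => /esym/eqP; rewrite mulf_eq0 => /orP[|].
    by rewrite (negPf (Bd c (sub _ (subset_itv_oo_cc cxy))).2).
  by rewrite subr_eq0 gt_eqF.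
pose g y := xget x0 [set x | ball x0 d x /\ f x = y].
have gf x : ball x0 d x -> g (f x) = x.
  move=> Bx; rewrite /g; case: xgetP => [z _ [Bz fz]|/(_ x)]; first exact: inj.
  by case.
have Bx0 : ball x0 d x0 by exact: ballxx.
have canf x : ball x0 d x -> {near x, cancel f g}.
  by move=> /Bdn; apply: filterS => z Bz; exact: gf.
have ctsf x : ball x0 d x -> {near x, continuous f}.
  move=> /Bdn; apply: filterS => z /Bd[Uz _].
  exact: Ck_continuous (Cf 0%N) Uz.
have [ctsg cang] := near_can_continuousAcan_sym (canf _ Bx0) (ctsf _ Bx0).
have : \forall y \near f x0, ball x0 d (g y) /\ f (g y) = y.
  near=> y; split; last by near: y.
  near: y; have := nbhs_singleton ctsg.
  apply; rewrite gf//; exact: nbhsx_ballx.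
move=> [e /= e0 eg].
have Be y : ball (f x0) e y -> ball x0 d (g y) /\ f (g y) = y by move=> /eg.
have dg y : ball (f x0) e y -> is_derive y 1 g (derive1 f (g y))^-1.
  move=> /Be[Bgy fgy]; rewrite -{1}fgy.
  apply: is_derive_inverse; [exact: canf|exact: ctsf| |exact: (Bd _ Bgy).2].
  exact: (Cinf_is_derive Cf (Bd _ Bgy).1).
exists e => //; exists g; split.
- elim=> [|n IH]; first by move=> y /dg; exact: is_derive_continuous.
  exists (fun y => (derive1 f (g y))^-1) => //.
  apply: (@Ck_comp _ [set x | x != 0] _ n (fun x => x^-1)).
  + by move=> y /Be[/Bd[]].
  + exact: Ck_inv.
  + by apply: (@Ck_comp _ U) => [y /Be[/Bd[]]||] //; exact: Cf'.
- exact: gf.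
- by move=> y /Be[/Bd[]].
- by have := dg _ (ballxx _ e0); rewrite gf.
Unshelve. all: end_near. Qed.

End inverse.

(** * Changes of variables *)

Section real_integrable.
Context d (T : measurableType d) {R : realType} (mu : {measure set T -> \bar R}).
Variables (D : set T) (mD : measurable D).
Implicit Types f g : T -> R.

Lemma integrableRD f g : mu.-integrable D (fun x => (f x)%:E) ->
  mu.-integrable D (fun x => (g x)%:E) ->
  mu.-integrable D (fun x => (f x + g x)%:E).
Proof. by move=> fi gi; exact: (integrableD mD fi gi). Qed.

Lemma integrableRZ c f : mu.-integrable D (fun x => (f x)%:E) ->
  mu.-integrable D (fun x => (c * f x)%:E).
Proof. by move=> fi; exact: (integrableZl mD c fi). Qed.

Lemma integrableRB f g : mu.-integrable D (fun x => (f x)%:E) ->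
  mu.-integrable D (fun x => (g x)%:E) ->
  mu.-integrable D (fun x => (f x - g x)%:E).
Proof. by move=> fi gi; exact: (integrableB mD fi gi). Qed.

End real_integrable.

Section change_of_variables.
Context d (T : measurableType d) {R : realType} (mu : {measure set T -> \bar R}).
Variables (phi : T -> T) (c : R).
Hypothesis mphi : measurable_fun setT phi.
Hypothesis phiE : forall f : T -> \bar R, measurable_fun setT f ->
  (forall x, 0 <= f x)%E -> (\int[mu]_x f (phi x) = c%:E * \int[mu]_x f x)%E.

(** The hypothesis on [phi] says that the image of [mu] under [phi] is [c] times
    [mu]; stated for nonnegative functions, it passes to products of measures
    without any reference to densities. *)
Lemma integrable_transport (f : T -> R) : mu.-integrable setT (EFin \o f) ->
  mu.-integrable setT (fun x => (f (phi x))%:E).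
Proof.
move=> /integrableP[mf fi]; apply/integrableP; split.
  exact: (measurableT_comp mf).
rewrite (phiE (f := fun x => `|(f x)%:E|%E))//; last first.
  exact: (measurableT_comp _ mf).
have : (0 <= \int[mu]_x `|(f x)%:E|)%E by exact: integral_ge0.
move: fi => /=; case: (\int[mu]_x _)%E => // r _ _.
by rewrite -EFinM ltry.
Qed.

Lemma Rintegral_transport (f : T -> R) : mu.-integrable setT (EFin \o f) ->
  \int[mu]_x f (phi x) = c * \int[mu]_x f x.
Proof.
move=> fi; have fi' := integrable_transport fi.
have /integrableP[mf _] := fi.
have fp : (\int[mu]_x ((fun x => (f (phi x))%:E)^\+ x) = c%:E * \int[mu]_x (EFin \o f)^\+ x)%E.
  rewrite -phiE//; first by apply: eq_integral => x _; rewrite ?funeposE ?funenegE.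
  exact: measurable_funepos.
have fn : (\int[mu]_x ((fun x => (f (phi x))%:E)^\- x) = c%:E * \int[mu]_x (EFin \o f)^\- x)%E.
  rewrite -phiE//; first by apply: eq_integral => x _; rewrite ?funeposE ?funenegE.
  exact: measurable_funeneg.
rewrite /Rintegral integralE [in RHS]integralE fp fn.
have := integral_funepos_lt_pinfty measurableT fi.
have := integral_funeneg_lt_pinfty measurableT fi.
have : (0 <= \int[mu]_x (EFin \o f)^\+ x)%E by exact: integral_ge0.
have : (0 <= \int[mu]_x (EFin \o f)^\- x)%E by exact: integral_ge0.
case: (\int[mu]_x _)%E => // r _; case: (\int[mu]_x _)%E => // s _ _ _ /=.
by ring.
Qed.

End change_of_variables.

Section line.
Context {R : realType}.
Local Notation mu := (@lebesgue_measure R).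

Lemma measurable_affine (a b : R) :
  measurable_fun setT (fun x : measurableTypeR R => b + a * x : measurableTypeR R).
Proof. by apply: measurable_funD => //; exact: measurable_funM. Qed.

Lemma ge0_integral_affine (a b : R) (f : R -> \bar R) : 0 < a ->
  measurable_fun setT f -> (forall x, 0 <= f x)%E ->
  (\int[mu]_x f (b + a * x)%R = a^-1%:E * \int[mu]_x f x)%E.
Proof.
move=> a0 mf f0.
pose phi (x : measurableTypeR R) : measurableTypeR R := b + a * x.
have mphi : measurable_fun setT phi by exact: measurable_affine.
pose k : {nonneg R} := NngNum (ltW a0).
pose nu' : {measure set (measurableTypeR R) -> \bar R} :=
  mscale k (pushforward mu phi).
pose nu := nu' mphi.
have E : forall A, measurable A -> mu A = nu A.
  apply: lebesgue_measure_unique => _ [[x y] _ <-] /=.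
  rewrite /mscale/= /pushforward/=.
  rewrite (_ : phi @^-1` _ = `](x - b) / a, (y - b) / a]%classic).
    rewrite !lebesgue_measure_itv/= !lte_fin ltr_pM2r ?invr_gt0// ltrD2r.
    case: ifPn => _; last by rewrite mule0.
    rewrite -!EFinB -EFinM; congr EFin; field; exact: lt0r_neq0.
  apply/seteqP; split => z /=; rewrite !in_itv/= /phi.
    by rewrite ltr_pdivrMr// ler_pdivlMr// => /andP[? ?]; apply/andP; split; lra.
  by rewrite ltr_pdivrMr// ler_pdivlMr// => /andP[? ?]; apply/andP; split; lra.
have -> : (\int[mu]_x f x = \int[nu]_x f x)%E.
  by apply: eq_measure_integral => A mA _; exact: E.
rewrite ge0_integral_mscale//= ge0_integral_pushforward//.
by rewrite muleA -EFinM mulVf ?lt0r_neq0// mul1e preimage_setT.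
Qed.

Lemma ge0_integral_opp (f : R -> \bar R) :
  measurable_fun setT f -> (forall x, 0 <= f x)%E ->
  (\int[mu]_x f (- x)%R = 1%:E * \int[mu]_x f x)%E.
Proof.
move=> mf f0; rewrite mul1e.
have -> : (\int[mu]_x f x = \int[pushforward mu (-%R : _ -> measurableTypeR R)]_x f x)%E.
  by apply: eq_measure_integral => A mA _; apply/esym/lebesgue_measureN.
by rewrite ge0_integral_pushforward.
Qed.

(** Folding the line at the origin: this is what turns principal values into
    absolutely convergent integrals. *)
Lemma Rintegral_half (f : R -> R) : mu.-integrable setT (EFin \o f) ->
  \int[mu]_x f x = \int[mu]_(x in `]0, +oo[) (f x + f (- x)).
Proof.
move=> fi.
have mopp : measurable_fun setT (-%R : measurableTypeR R -> measurableTypeR R).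
  exact: measurable_funN.
have fi' : mu.-integrable setT (fun x => (f (- x))%:E).
  exact: (@integrable_transport _ (measurableTypeR R) R mu -%R 1 mopp
    ge0_integral_opp).
have m0 : measurable (`[0, +oo[%classic : set R) by [].
rewrite Rintegral_itv_obnd_cbnd; last first.
  by apply: integrableRD => //; [exact: integrableS fi|exact: integrableS fi'].
rewrite RintegralD//; [|exact: integrableS fi|exact: integrableS fi'].
have -> : \int[mu]_(x in `[0, +oo[) f (- x) = \int[mu]_(x in `]-oo, 0]) f x.
  rewrite [LHS]Rintegral_mkcond [RHS]Rintegral_mkcond.
  rewrite -[RHS]mul1r -(@Rintegral_transport _ (measurableTypeR R) R mu -%R 1
    mopp ge0_integral_opp)//.
    apply: eq_Rintegral => x _; rewrite !patchE !mem_setE !in_itv/=.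
    by rewrite andbT oppr_le0.
  rewrite -restrict_EFin; apply/(integrable_mkcond _ _).1 => //.
  exact: integrableS fi.
rewrite -Rintegral_itv_obnd_cbnd//; last first.
  exact: integrableS fi.
rewrite addrC -Rintegral_setU//.
- congr Rintegral; apply/seteqP; split => // x _ /=; rewrite !in_itv/= andbT.
  by case: (leP x 0) => _; [left|right].
- by apply: integrableS fi => //; exact: measurableU.
- apply/disj_setPS => x /= []; rewrite !in_itv/= andbT => x0 /(le_lt_trans x0).
  by rewrite ltxx.
Qed.

End line.

(** * Schwartz functions and their principal values *)

Section pv.
Context {R : realType}.
Local Notation mu := (@lebesgue_measure R).
Implicit Types (f g : R -> R) (l t x : R).

Lemma measurable_inv (D : set R) : measurable D ->
  measurable_fun D (fun x : R => x^-1).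
Proof.
move=> mD; apply: measurable_funS (@subsetT _ _) _ => //.
have o0 : open [set x : R | x != 0] by exact: open_neq.
have -> : [set: R] = [set x | x != 0] `|` [set 0].
  by apply/seteqP; split => // x _ /=; case: (eqVneq x 0); [right|left].
apply/measurable_funU => //; first exact: open_measurable.
split.
  apply: open_continuous_measurable_fun => // x; rewrite inE/= => x0.
  exact: inv_continuous.
exact: measurable_fun_set1.
Qed.

Lemma integral_oneDsqr :
  (\int[mu]_x ((1 + x ^+ 2)^-1)%:E = pi%:E)%E.
Proof.
rewrite ge0_symfun_integralT.
- have -> : [set x : R | 0 <= x] = `[0, +oo[%classic.
    by apply/seteqP; split => x; rewrite /= in_itv/= andbT.
  by rewrite integral0y_oneDsqr -EFinM mulrCA divff ?mulr1.
- by move=> x; rewrite invr_ge0 addr_ge0 ?sqr_ge0.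
- exact: continuous_oneDsqrV.
- by move=> x /=; rewrite sqrrN.
Qed.

Lemma integrable_oneDsqr (D : set R) (C : R) : measurable D ->
  mu.-integrable D (fun x => (C * (1 + x ^+ 2)^-1)%:E).
Proof.
move=> mD; apply: (@integrableS _ _ _ _ setT) => //.
under eq_fun do rewrite EFinM.
apply: integrableZl => //.
apply/integrableP; split.
  apply/measurable_EFinP; apply: continuous_measurable_fun.
  exact: continuous_oneDsqrV.
under eq_integral => x _ do rewrite gee0_abs ?lee_fin ?invr_ge0 ?addr_ge0 ?sqr_ge0//.
by rewrite integral_oneDsqr ltry.
Qed.

(** First order decay, together with the same decay of the derivative, is all that
    convergence of principal values requires. *)
Definition decaying f := exists C, forall x, (1 + `|x|) * `|f x| <= C.

(** Only n derivatives are controlled: one is spent by each differentiation of a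
    principal value. *)
Fixpoint Sch n f : Prop := decaying f /\
  if n is m.+1 then
    exists2 g, (forall x, is_derive x 1 f (g x)) & Sch m g
  else continuous f.

Lemma Sch_decaying n f : Sch n f -> decaying f.
Proof. by case: n => [|n] []. Qed.

Lemma Sch_continuous n f : Sch n f -> continuous f.
Proof.
by case: n => [|n] [_] // [g fg _] x; exact: is_derive_continuous (fg x).
Qed.

Lemma SchW n f : Sch n.+1 f -> Sch n f.
Proof.
elim: n f => [|n IH] f /=.
  by move=> [df [g fg Sg]]; split => // x; exact: is_derive_continuous (fg x).
by move=> [df [g fg /IH Sg]]; split => //; exists g.
Qed.

Lemma Sch_Ck n f : Sch n f -> Ck setT n f.
Proof.
elim: n f => [|n IH] f; first by move=> Sf x _; exact: (Sch_continuous Sf).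
by move=> [_ [g fg /IH Sg]]; exists g.
Qed.

Lemma decayingD f g : decaying f -> decaying g -> decaying (fun x => f x + g x).
Proof.
move=> [C fC] [D gD]; exists (C + D) => x.
apply: le_trans (lerD (fC x) (gD x)); rewrite -mulrDr.
by rewrite ler_wpM2l ?addr_ge0// ler_normD.
Qed.

Lemma decayingZ f c : decaying f -> decaying (fun x => c * f x).
Proof.
move=> [C fC]; exists (`|c| * C) => x.
by rewrite normrM mulrCA ler_wpM2l.
Qed.

Lemma SchD n f g : Sch n f -> Sch n g -> Sch n (fun x => f x + g x).
Proof.
elim: n f g => [|n IH] f g /= [df Hf] [dg Hg]; split; try exact: decayingD.
  by move=> x; apply: cvgD; [exact: Hf|exact: Hg].
move: Hf Hg => [f' ff' Sf] [g' gg' Sg]; exists (fun x => f' x + g' x).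
  by move=> x; have := ff' x; have := gg' x => ? ?; exact: is_deriveD.
exact: IH.
Qed.

Lemma SchZ n f c : Sch n f -> Sch n (fun x => c * f x).
Proof.
elim: n f => [|n IH] f /= [df Hf]; split; try exact: decayingZ.
  by move=> x; apply: cvgM; [exact: cvg_cst|exact: Hf].
move: Hf => [f' ff' Sf]; exists (fun x => c * f' x); last exact: IH.
by move=> x; have := ff' x => ?; exact: is_deriveZ.
Qed.

(** The symmetric difference quotient has a removable singularity at [t = 0]. *)
Definition dquot f l t := (f (l + t) - f (l - t)) / t.

Definition pv f l := \int[mu]_(t in `]0, +oo[) dquot f l t.

Lemma is_derive_affine f (s c : R) x (d : R) : is_derive (c + s * x) 1 f d ->
  is_derive x 1 (fun x => f (c + s * x)) (s * d).
Proof.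
move=> fd.
have h : is_derive x 1 (fun x => c + s * x) s.
  have h0 : is_derive x 1 (cst c + s *: id) (0 + s *: (1 : R)).
    by apply: is_deriveD; exact: is_deriveZ.
  by apply: is_derive_eq h0 _; rewrite add0r /GRing.scale/= mulr1.
by rewrite mulrC; exact: (@is_derive1_comp _ f (fun x => c + s * x)).
Qed.

(** For [t <= 1] the mean value theorem bounds the quotient by the derivative; for
    [t > 1] the decay of [f] gives a bound by 1/t^2.  The bound is uniform for [l]
    in a bounded set, as dominated differentiation under the integral requires. *)
Lemma dquot_bound f (K : R) : Sch 1 f -> 0 <= K -> exists C, forall l, `|l| <= K ->
  forall t, 0 < t -> `|dquot f l t| <= C * (1 + t ^+ 2)^-1.
Proof.
move=> [[D fD] [g fg [[M gM] _]]] K0.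
have D0 : 0 <= D by apply: le_trans (fD 0); rewrite mulr_ge0 ?addr_ge0.
have M0 : 0 <= M by apply: le_trans (gM 0); rewrite mulr_ge0 ?addr_ge0.
have gM' x : `|g x| <= M.
  by apply: le_trans (gM x); rewrite ler_peMl// lerDl.
(* the two summands come from [t <= 1] and from [1 < t] *)
exists (4 * M + 4 * D * (1 + K)) => l lK t t0.
have t20 : 0 < 1 + t ^+ 2 by rewrite addr_gt0// exprn_gt0.
rewrite ler_pdivlMr// /dquot normrM normrV ?unitfE ?gt_eqF// (gtr0_norm t0).
have [t1|t1] := leP t 1.
  have [||c _ ->] := @MVT_segment _ f g (l - t) (l + t).
  - lra.
  - by apply: continuous_subspaceT => x; exact: is_derive_continuous (fg x).
  rewrite (_ : l + t - (l - t) = 2 * t); last by ring.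
  rewrite normrM (gtr0_norm (_ : 0 < 2 * t)) ?mulr_gt0//.
  rewrite mulrA mulfK ?gt_eqF//.
  have h := gM' c; have h2 : t ^+ 2 <= 1 by rewrite expr_le1// ltW.
  have : `|g c| * 2 * (1 + t ^+ 2) <= M * 2 * 2.
    by apply: ler_pM; rewrite ?mulr_ge0 ?ler_wpM2r ?(ltW t20)//; lra.
  have : 0 <= 4 * D * (1 + K) by rewrite !mulr_ge0// addr_ge0.
  lra.
have H y : `|y - l| = t -> `|f y| * t <= D * (1 + K).
  move=> yl; have h : t <= (1 + K) * (1 + `|y|).
    have := ler_normB y l; rewrite yl => h.
    have := normr_ge0 y; nra.
  apply: le_trans (_ : `|f y| * ((1 + K) * (1 + `|y|)) <= _).
    by rewrite ler_wpM2l.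
  rewrite [leLHS](_ : _ = (1 + `|y|) * `|f y| * (1 + K)); last by ring.
  by rewrite ler_wpM2r ?addr_ge0.
have h1 : `|f (l + t)| * t <= D * (1 + K).
  by apply: H; rewrite addrAC subrr add0r gtr0_norm.
have h2 : `|f (l - t)| * t <= D * (1 + K).
  by apply: H; rewrite addrAC subrr add0r normrN gtr0_norm.
have h3 := ler_normB (f (l + t)) (f (l - t)).
set A := `|f (l + t) - f (l - t)| in h3 *.
have A0 : 0 <= A by exact: normr_ge0.
have h4 : A * t <= 2 * D * (1 + K).
  by apply: le_trans (ler_wpM2r (ltW t0) h3) _; rewrite mulrDl; lra.
have h5 : A * t^-1 <= A * t^-1 * 1 by rewrite mulr1.
have ti : t^-1 <= t by rewrite invf_ple ?posrE//; rewrite (le_trans _ (ltW t1))// invf_le1// ltW.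
have : A / t * (1 + t ^+ 2) <= 2 * (A * t).
  rewrite mulrDr mulr1 (_ : A / t * t ^+ 2 = A * t); last by field; rewrite gt_eqF.
  by rewrite mulr_natl mulr2n lerD2r ler_wpM2l.
have : 0 <= 4 * M by rewrite mulr_ge0.
lra.
Qed.

End pv.

Section pv2.
Context {R : realType}.
Local Notation mu := (@lebesgue_measure R).
Implicit Types (f g : R -> R) (l t x : R).

Lemma measurable_dquot f l (D : set R) : continuous f -> measurable D ->
  measurable_fun D (dquot f l).
Proof.
move=> cf mD; have mf := continuous_measurable_fun cf.
apply: measurable_funM; last exact: measurable_inv.
have ma := measurable_affine 1 l.
have mb := measurable_affine (-1) l.
apply: measurable_funTS; apply: measurable_funB.
  rewrite (_ : (fun x => _) = f \o (fun x => l + 1 * x)).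
    exact: measurableT_comp mf ma.
  by apply/funext => x; rewrite /= mul1r.
rewrite (_ : (fun x => _) = f \o (fun x => l + -1 * x)).
  exact: measurableT_comp mf mb.
by apply/funext => x; rewrite /= mulN1r.
Qed.

Lemma integrable_dquot f l : Sch 1 f ->
  mu.-integrable `]0, +oo[ (fun t => (dquot f l t)%:E).
Proof.
move=> Sf; have [C fC] := dquot_bound Sf (normr_ge0 l).
apply: le_integrable (integrable_oneDsqr C _) => //.
  apply/measurable_EFinP; apply: measurable_dquot => //.
  exact: Sch_continuous Sf.
move=> t /=; rewrite in_itv/= andbT lee_fin => t0.
by apply: le_trans (fC _ (lexx _) _ t0) (ler_norm _).
Qed.

Lemma dquotN f l t : dquot (fun x => -1 * f x) l t = -1 * dquot f l t.
Proof. by rewrite /dquot; ring. Qed.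

Lemma pvN f l : Sch 1 f -> pv (fun x => -1 * f x) l = - pv f l.
Proof.
move=> Sf; rewrite /pv; under eq_Rintegral do rewrite dquotN.
by rewrite RintegralZl ?mulN1r//; exact: integrable_dquot.
Qed.

Lemma is_derive_dquot f g l t : (forall x, is_derive x 1 f (g x)) ->
  is_derive l 1 (fun l => dquot f l t) (dquot g l t).
Proof.
move=> fg.
have H c : is_derive l 1 (fun l => f (l + c)) (g (l + c)).
  rewrite (_ : (fun l => _) = (fun l => f (c + 1 * l))); last first.
    by apply/funext => x; rewrite mul1r addrC.
  apply: is_derive_eq (is_derive_affine (fg _)) _.
  by rewrite !mul1r addrC.
have h : is_derive l 1 (fun l => f (l + t) - f (l - t)) (g (l + t) - g (l - t)).
  exact: is_deriveB.
rewrite (_ : (fun l => _) = (t^-1 *: (fun l => f (l + t) - f (l - t)))).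
  by rewrite /dquot mulrC; exact: is_deriveZ.
by apply/funext => x; rewrite /dquot mulrC.
Qed.

(** Differentiation under the integral, dominated by means of [dquot_bound]. *)
Lemma is_derive_pv f g l : (forall x, is_derive x 1 f (g x)) ->
  Sch 1 f -> Sch 1 g -> is_derive l 1 (pv f) (pv g l).
Proof.
move=> fg Sf Sg.
have K0 : 0 <= `|l| + 1 by rewrite addr_ge0.
have [C gC] := dquot_bound Sg K0.
have lI : `]l - 1, l + 1[%classic l by rewrite /= in_itv/=; lra.
have E x t : partial1of2 (dquot f) x t = dquot g x t.
  exact: derive1_val (is_derive_dquot _ _ fg).
have C0 : 0 <= C.
  have := gC l _ 1 ltr01; rewrite lerDl ler01 => /(_ isT).
  rewrite ler_pdivlMr//; apply: le_trans; exact: mulr_ge0.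
have mD : measurable (`]0, +oo[%classic : set (measurableTypeR R)) by [].
have h1 : forall x, `]l - 1, l + 1[%classic x ->
    mu.-integrable `]0, +oo[ (EFin \o dquot f x).
  by move=> x _; exact: integrable_dquot.
have h2 : forall x t, `]l - 1, l + 1[%classic x -> `]0, +oo[%classic t ->
    derivable (dquot f ^~ t) x 1.
  by move=> x t _ _; have := is_derive_dquot x t fg.
have h3 : forall x t, `]l - 1, l + 1[%classic x -> `]0, +oo[%classic t ->
    `|partial1of2 (dquot f) x t| <= C * (1 + t ^+ 2)^-1.
  move=> x t /=; rewrite !in_itv/= andbT E => /andP[x1 x2] t0.
  apply: gC => //; have := ler_norm l; have := ler_norm (- l).
  rewrite normrN; have [x0|x0] := leP 0 x; rewrite ?(ger0_norm x0) ?(ltr0_norm x0); lra.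
have h4 t : 0 <= C * (1 + t ^+ 2)^-1.
  by rewrite mulr_ge0// invr_ge0 addr_ge0 ?sqr_ge0.
have h5 := integrable_oneDsqr C mD.
apply: DeriveDef.
  exact: (derivable_under_integral mD lI h1 h2 h4 h5 h3).
rewrite -derive1E (differentiation_under_integral mD lI h1 h2 h4 h5 h3).
by apply: eq_Rintegral => t _; rewrite E.
Qed.

Lemma Sch_le m n f : (m <= n)%N -> Sch n f -> Sch m f.
Proof.
by move=> /subnK <-; elim: (n - m)%N => [//|k IH]; rewrite addSn => /SchW.
Qed.

Lemma pv_Ck n f : Sch n.+2 f -> Ck setT n (pv f).
Proof.
elim: n f => [|n IH] f Sf; case: (Sf) => _ [g fg Sg].
  move=> x _; apply: is_derive_continuous (is_derive_pv x fg _ _); last by [].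
  exact: SchW.
exists (pv g); [move=> x _; apply: is_derive_pv => //|exact: IH].
  exact: Sch_le Sf.
exact: (@Sch_le 1 n.+2).
Qed.

(** Off a symmetric interval the integral of f(x)/(x - l) folds to the integral of
    the difference quotient over t >= e, and the latter converges absolutely. *)
Lemma principal_value_pv f l : Sch 1 f -> principal_value f l = pv f l.
Proof.
move=> Sf; have cf := Sch_continuous Sf.
have [D fD] := Sch_decaying Sf.
have D0 : 0 <= D by apply: le_trans (fD 0); rewrite mulr_ge0 ?addr_ge0.
have mf := continuous_measurable_fun cf.
pose G e := (fun x => f x / (x - l)) \_ (~` `]l - e, l + e[%classic).
have mC (e : R) : measurable (~` `]l - e, l + e[%classic).
  exact: measurableC.
have mq (e : R) : measurable_fun (~` `]l - e, l + e[%classic) (fun x => f x / (x - l)).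
  apply: measurable_funTS; apply: measurable_funM => //.
  apply: (measurableT_comp (measurable_inv measurableT)).
  exact: measurable_funB.
have iq (e : R) : 0 < e ->
    mu.-integrable (~` `]l - e, l + e[%classic) (fun x => (f x / (x - l))%:E).
  move=> e0.
  apply: le_integrable (integrable_oneDsqr (D * ((1 + `|l|) / e + 1)) (mC e)).
  - exact: (mC e).
  - by apply/measurable_EFinP; exact: (mq e).
  move=> x /= /negP; rewrite in_itv/= => xe; rewrite lee_fin.
  have {}xe : e <= `|x - l|.
    rewrite leNgt ltr_distl; apply: contra xe => /andP[? ?]; apply/andP; split; lra.
  have xl0 : 0 < `|x - l| by exact: lt_le_trans xe.
  have h0 : 0 <= (1 + `|l|) / e by rewrite divr_ge0 ?addr_ge0// ltW.
  apply: le_trans (ler_norm _); rewrite normf_div.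
  rewrite ler_pdivrMr// mulrAC ler_pdivlMr ?ltr_pwDl ?sqr_ge0//.
  have h1 : 1 + `|x| <= ((1 + `|l|) / e + 1) * `|x - l|.
    have h2 : 1 + `|l| <= (1 + `|l|) / e * `|x - l|.
      by rewrite mulrAC ler_pdivlMr// ler_wpM2l// addr_ge0.
    have := ler_distD 0 x l; rewrite !subr0 sub0r normrN.
    have := ler_normB (x - l) (- l); rewrite opprK subrK normrN; lra.
  have h3 : 1 + x ^+ 2 <= (1 + `|x|) ^+ 2.
    by rewrite -[x ^+ 2]real_normK ?num_real//; have := normr_ge0 x; nra.
  apply: le_trans (_ : `|f x| * (1 + `|x|) ^+ 2 <= _); first by rewrite ler_wpM2l.
  rewrite expr2 mulrA [`|f x| * _]mulrC -mulrA.
  by rewrite mulrA -[D * _ * _]mulrA ler_pM// ?mulr_ge0 ?addr_ge0.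
have iG e : 0 < e -> mu.-integrable setT (EFin \o G e).
  move=> e0; rewrite /G -restrict_EFin; apply/(integrable_mkcond _ _).1; [exact: mC|exact: iq].
have key e : 0 < e -> \int[mu]_(x in ~` `]l - e, l + e[) (f x / (x - l)) =
    \int[mu]_(t in `]0, +oo[) ((dquot f l) \_ `[e, +oo[%classic) t.
  move=> e0.
  have T := @ge0_integral_affine R 1 l.
  have mphi := measurable_affine 1 l.
  have T' : forall f : R -> \bar R, measurable_fun setT f -> (forall x, 0 <= f x)%E ->
     (\int[mu]_x f (l + 1 * x)%R = 1%:E * \int[mu]_x f x)%E.
    by move=> h mh h0; rewrite T// invr1.
  rewrite [LHS]Rintegral_mkcond -[LHS]mul1r.
  rewrite -(@Rintegral_transport _ (measurableTypeR R) R mu _ 1 mphi T' _ (iG _ e0)).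
  rewrite (Rintegral_half (f := fun x => G e (l + 1 * x))); last first.
    exact: (@integrable_transport _ (measurableTypeR R) R mu _ 1 mphi T' _ (iG _ e0)).
  apply: eq_Rintegral => t; rewrite inE/= in_itv/= andbT => t0.
  rewrite /G !patchE !in_setC !mem_setE !in_itv/= andbT mul1r mulrN mul1r.
  have -> : (l - e < l + t < l + e) = (t < e).
    by rewrite (ltrD2l l t e); have -> : l - e < l + t by lra.
  have -> : (l - e < l - t < l + e) = (t < e).
    have h : l - t < l + e by lra.
    by rewrite (ltrD2l l (- e) (- t)) ltrN2 h andbT.
  rewrite -leNgt; case: ifPn => _; last by rewrite (_ : point = 0 :> R)// addr0.
  have -> : l + t - l = t by ring.
  have -> : l - t - l = - t by ring.
  by rewrite invrN mulrN -mulrBl.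
apply: cvg_lim => //; apply/cvg_at_rightP => e [e0 ecvg].
under eq_fun do rewrite key//.
apply: fine_cvg; rewrite fineK; last first.
  by apply: integrable_fin_num => //; exact: integrable_dquot.
have mD : measurable (`]0, +oo[%classic : set (measurableTypeR R)) by [].
have md : measurable_fun (`]0, +oo[%classic : set (measurableTypeR R)) (dquot f l) by exact: measurable_dquot.
have [] := @dominated_convergence _ (measurableTypeR R) R mu `]0, +oo[ mD
  (fun n t => ((dquot f l \_ `[e n, +oo[) t)%:E) (fun t => (dquot f l t)%:E)
  (fun t => `|(dquot f l t)%:E|%E) => //.
- move=> n; apply/measurable_EFinP.
  have mDn : measurable (`[e n, +oo[%classic : set (measurableTypeR R)) by [].
  apply: measurable_funTS; apply: (measurable_restrictT (dquot f l) mDn).1.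
  exact: measurable_dquot.
- exact/measurable_EFinP.
- apply: aeW => t; rewrite /= in_itv/= andbT => t0.
  apply: cvg_near_cst; near=> n.
  rewrite patchE ifT// inE/= in_itv/= andbT ltW//; near: n.
  exact: (cvgr_lt _ ecvg).
- exact: integrable_abse (integrable_dquot _ _).
- apply: aeW => t n _; rewrite patchE; case: ifPn => _ //.
  by rewrite (_ : point = 0 :> R)// abse0.
Unshelve. all: end_near. Qed.

End pv2.

(** * Hadamard's lemma *)

Section hadamard.
Context {R : realType}.
Local Notation mu := (@lebesgue_measure R).
Implicit Types (f g : R -> R) (l t x a b : R).

Lemma continuous_integrable f a b : continuous f ->
  mu.-integrable `[a, b] (EFin \o f).
Proof.
move=> cf; apply: continuous_compact_integrable; first exact: segment_compact.
exact: continuous_subspaceT.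
Qed.

Lemma Rintegral_FTC2 f g a b : a < b -> (forall x, is_derive x 1 f (g x)) ->
  continuous g -> \int[mu]_(x in `[a, b]) g x = f b - f a.
Proof.
move=> ab fg cg; have cf x := is_derive_continuous (fg x).
rewrite /Rintegral (continuous_FTC2 ab (F := f)).
- by rewrite -EFinB.
- exact: continuous_subspaceT.
- split; first by move=> x _; have := fg x.
  + exact/cvg_at_right_filter/cf.
  + exact/cvg_at_left_filter/cf.
- by move=> x _; exact: derive1_val (fg x).
Qed.

(** Lets improper integrals over the half line be evaluated by primitives. *)
Lemma cvg_Rintegral_halfline f : mu.-integrable `]0, +oo[ (EFin \o f) ->
  \int[mu]_(x in `[0, n%:R]) f x @[n --> \oo] --> \int[mu]_(x in `]0, +oo[) f x.
Proof.
move=> fi.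
have mD : measurable (`]0, +oo[%classic : set (measurableTypeR R)) by [].
have E n : \int[mu]_(x in `[0, n%:R]) f x =
    \int[mu]_(x in `]0, +oo[) ((f \_ `]0, n%:R]%classic) x).
  have S : `]0, n%:R] `<=` (`]0, +oo[%classic : set R).
    by move=> x /=; rewrite !in_itv/= andbT => /andP[].
  rewrite -Rintegral_itv_obnd_cbnd; last exact: integrableS fi.
  rewrite [LHS]Rintegral_mkcond [RHS]Rintegral_mkcond.
  apply: eq_Rintegral => x _; rewrite -patch_setI; congr (patch _ _ _ _).
  by rewrite setIC setIidl.
under eq_fun do rewrite E.
apply: fine_cvg; rewrite fineK; last exact: integrable_fin_num.
have [] := @dominated_convergence _ (measurableTypeR R) R mu `]0, +oo[ mD
  (fun n t => ((f \_ `]0, n%:R]%classic) t)%:E) (fun t => (f t)%:E)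
  (fun t => `|(f t)%:E|%E) => //.
- move=> n; apply/measurable_EFinP.
  have mDn : measurable (`]0, n%:R]%classic : set (measurableTypeR R)) by [].
  apply: (measurable_restrict f mDn mD).1.
  apply: measurable_funS (@subIsetl _ _ _) _ => //.
  by apply/measurable_EFinP; exact: measurable_int fi.
- exact: measurable_int fi.
- apply: aeW => t; rewrite /= in_itv/= andbT => t0.
  apply: cvg_near_cst; near=> n.
  rewrite patchE ifT// inE/= in_itv/= t0/=; near: n.
  exact: nbhs_infty_ger.
- exact: integrable_abse fi.
- apply: aeW => t n _; rewrite patchE; case: ifPn => _ //.
  by rewrite (_ : point = 0 :> R)// abse0.
Unshelve. all: end_near. Qed.

(** For [n = 0] and [g = f'] this is the quotient (f(x) - f(a))/(x - a); the weight
    [t ^+ n] makes the family stable under differentiation in [x]. *)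
Definition hquot a n g x := \int[mu]_(t in `[0, 1]) (t ^+ n * g (a + t * (x - a))).

Lemma continuous_hquot a n g x : continuous g ->
  continuous (fun t => t ^+ n * g (a + t * (x - a))).
Proof.
move=> cg t; apply: cvgM; first exact: exprn_continuous.
apply: (@continuous_comp _ _ _ (fun t => a + t * (x - a)) g); last exact: cg.
by apply: cvgD; [exact: cvg_cst|apply: cvgM; [exact: cvg_id|exact: cvg_cst]].
Qed.

Lemma is_derive_hquot a n g g' x : (forall x, is_derive x 1 g (g' x)) ->
  continuous g' -> is_derive x 1 (hquot a n g) (hquot a n.+1 g' x).
Proof.
move=> gg' cg'; have cg y := is_derive_continuous (gg' y).
pose K := 2 * `|a| + `|x| + 1.
have K0 : - K <= K by rewrite /K; have := normr_ge0 a; have := normr_ge0 x; lra.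
have [c _ cM] := @EVT_max R (fun y => `|g' y|) (- K) K K0
  (continuous_subspaceT (fun y => continuous_comp (cg' y) (@norm_continuous _ _ _))).
pose M := `|g' c|.
have xI : `]x - 1, x + 1[%classic x by rewrite /= in_itv/=; lra.
pose f y t := t ^+ n * g (a + t * (y - a)).
have D (y t : R) : is_derive y 1 (fun y => f y t) (t ^+ n.+1 * g' (a + t * (y - a))).
  have h := gg' (a + t * (y - a)).
  have E : (fun y => g (a + t * (y - a))) = (fun y => g ((a - t * a) + t * y)).
    by apply/funext => z; congr g; ring.
  have h2 : is_derive y 1 (fun y => g (a + t * (y - a))) (t * g' (a + t * (y - a))).
    rewrite E; apply: is_derive_affine.
    by rewrite (_ : a - t * a + t * y = a + t * (y - a))//; ring.
  rewrite exprSr -mulrA /f.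
  exact: is_deriveZ.
have E y t : partial1of2 f y t = t ^+ n.+1 * g' (a + t * (y - a)).
  exact: derive1_val (D y t).
have mD : measurable (`[0, 1]%classic : set (measurableTypeR R)) by [].
have h1 : forall y, `]x - 1, x + 1[%classic y ->
    mu.-integrable `[0, 1] (EFin \o f y).
  by move=> y _; apply: continuous_integrable; exact: continuous_hquot.
have h2 : forall y t, `]x - 1, x + 1[%classic y -> `[0, 1]%classic t ->
    derivable (f ^~ t) y 1.
  by move=> y t _ _; have := D y t.
have h3 : forall y t, `]x - 1, x + 1[%classic y -> `[0, 1]%classic t ->
    `|partial1of2 f y t| <= M.
  move=> y t /=; rewrite !in_itv/= E => /andP[y1 y2] /andP[t0 t1].
  rewrite normrM -[leRHS]mul1r ler_pM//.
    by rewrite normrX (ger0_norm t0) exprn_ile1.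
  apply: cM; rewrite in_itv/= -ler_norml.
  apply: le_trans (ler_normD _ _) _; rewrite normrM (ger0_norm t0).
  have : t * `|y - a| <= 1 * `|y - a| by rewrite ler_wpM2r.
  have := ler_normB y a; have : `|y| <= `|x| + 1.
    have := ler_norm x; have := ler_norm (- x); rewrite normrN => ? ?.
    by have [y0|y0] := leP 0 y; rewrite ?(ger0_norm y0) ?(ltr0_norm y0); lra.
  rewrite /K; lra.
have h4 (t : R) : 0 <= M by exact: normr_ge0.
have h5 : mu.-integrable `[0, 1] (EFin \o (fun _ : R => M)).
  by apply: continuous_integrable => y; exact: cvg_cst.
apply: DeriveDef.
  exact: (derivable_under_integral mD xI h1 h2 h4 h5 h3).
rewrite -derive1E (differentiation_under_integral mD xI h1 h2 h4 h5 h3).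
by apply: eq_Rintegral => t _; rewrite E.
Qed.

Lemma hquot_Ck a n m g : Ck setT m.+1 g -> Ck setT m (hquot a n g).
Proof.
elim: m n g => [|m IH] n g [g' gg' Cg'].
  move=> x _; apply: is_derive_continuous (is_derive_hquot a n x _ _).
    by move=> y; exact: gg'.
  by move=> y; exact: Cg'.
exists (hquot a n.+1 g'); last exact: IH.
move=> x _; apply: is_derive_hquot; first by move=> y; exact: gg'.
by move=> y; exact: (@Ck_continuous _ setT m.+1 g').
Qed.

(** Taylor's formula with integral remainder; the remainder is smooth because
    [hquot] can be differentiated under the integral sign. *)
Lemma hadamard f a : Cinf setT f -> exists q,
  [/\ Cinf setT q, forall x, f x = f a + (x - a) * q x & q a = derive1 f a].
Proof.
move=> Cf; have Cf' := Cinf_derive1 openT Cf.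
have ff' x := Cinf_is_derive Cf (I : setT x).
have cf' x : {for x, continuous (derive1 f)} by exact: (Ck_continuous (Cf' 0%N)).
exists (hquot a 0 (derive1 f)); split.
- by move=> n; exact: hquot_Ck.
- move=> x.
  have ch : continuous (fun t => derive1 f (a + t * (x - a))).
    have := @continuous_hquot a 0 (derive1 f) x cf'.
    by under eq_fun do rewrite expr0 mul1r.
  have dF t : is_derive t 1 (fun t => f (a + t * (x - a)))
      ((x - a) * derive1 f (a + t * (x - a))).
    rewrite (_ : (fun t => _) = (fun t => f (a + (x - a) * t))); last first.
      by apply/funext => s; rewrite mulrC.
    by rewrite [t * _]mulrC; exact: is_derive_affine.
  have h : \int[mu]_(t in `[0, 1]) ((x - a) * derive1 f (a + t * (x - a))) = f x - f a.
    rewrite (Rintegral_FTC2 ltr01 dF).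
      by rewrite mul1r mul0r addr0 (addrC a) subrK.
    by move=> t; apply: cvgM; [exact: cvg_cst|exact: ch].
  rewrite RintegralZl// in h; last first.
    exact: continuous_integrable.
  rewrite /hquot; under eq_Rintegral do rewrite expr0 mul1r.
  by rewrite h addrC subrK.
- rewrite /hquot; under eq_Rintegral do rewrite expr0 mul1r subrr mulr0 addr0.
  rewrite Rintegral_cst//= lebesgue_measure_itv/= lte_fin ltr01.
  by rewrite -EFinB/= subr0 mulr1.
Qed.

End hadamard.

(** * Principal values at a double zero *)

Section schwartz.
Context {R : realType}.
Local Notation mu := (@lebesgue_measure R).
Implicit Types (f g : R -> R) (l t x a b : R).

Definition Schwartz f := forall n, Sch n f.

Lemma Schwartz_Cinf f : Schwartz f -> Cinf setT f.
Proof. by move=> Sf n; exact: Sch_Ck. Qed.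

Lemma Schwartz_is_derive f x : Schwartz f -> is_derive x 1 f (derive1 f x).
Proof. by move=> Sf; exact: (Cinf_is_derive (Schwartz_Cinf Sf)). Qed.

Lemma Schwartz_derive1 f : Schwartz f -> Schwartz (derive1 f).
Proof.
move=> Sf n; have [_ [g fg Sg]] := Sf n.+1.
by rewrite (_ : derive1 f = g)//; apply/funext => x; exact: derive1_val (fg x).
Qed.

Lemma pv_Cinf f : Schwartz f -> Cinf setT (pv f).
Proof. by move=> Sf n; exact: pv_Ck. Qed.

Lemma derive1_pv f x : Schwartz f -> derive1 (pv f) x = pv (derive1 f) x.
Proof.
move=> Sf; apply: derive1_val; apply: is_derive_pv; last exact: Schwartz_derive1.
  by move=> y; exact: Schwartz_is_derive.
exact: Sf.
Qed.

(** Hadamard's lemma applied twice. *)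
Lemma double_zero f a : Cinf setT f -> f a = 0 -> derive1 f a = 0 ->
  exists2 q, Cinf setT q & forall x, f x = (x - a) ^+ 2 * q x.
Proof.
move=> Cf fa f'a; have [q [Cq fq qa]] := hadamard a Cf.
have [r [Cr qr _]] := hadamard a Cq.
exists r => // x; rewrite fq fa add0r qr qa f'a add0r; ring.
Qed.

(** The double zero removes the singularity, and [f] itself is bounded far away. *)
Lemma integrable_div_sqr f a : Schwartz f -> f a = 0 -> derive1 f a = 0 ->
  mu.-integrable setT (fun x => (f x / (x - a) ^+ 2)%:E).
Proof.
move=> Sf fa f'a; have Cf := Schwartz_Cinf Sf.
have [q Cq fq] := double_zero Cf fa f'a.
have cq x : {for x, continuous q} by exact: (Ck_continuous (Cq 0%N)).
have [c _ cM] := @EVT_max R (fun y => `|q y|) (a - 1) (a + 1) ltac:(lra)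
  (continuous_subspaceT (fun y => continuous_comp (cq y) (@norm_continuous _ _ _))).
have [M fM] := Sch_decaying (Sf 0%N).
have M0 : 0 <= M by apply: le_trans (fM 0); rewrite mulr_ge0 ?addr_ge0.
have fM' x : `|f x| <= M.
  by apply: le_trans (fM x); rewrite ler_peMl// lerDl.
pose A := (1 + (`|a| + 1) ^+ 2).
have c1 : 0 <= `|q c| * A by rewrite mulr_ge0// addr_ge0// sqr_ge0.
have c2 : 0 <= M * (2 * (a ^+ 2) + 3) by rewrite mulr_ge0// addr_ge0// mulr_ge0 ?sqr_ge0.
have := integrable_oneDsqr (`|q c| * A + M * (2 * (a ^+ 2) + 3)) (@measurableT _ (measurableTypeR R)).
apply: le_integrable => //.
  apply/measurable_EFinP; apply: measurable_funM.
    by apply: continuous_measurable_fun; exact: Sch_continuous (Sf 0%N).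
  apply: (measurableT_comp (measurable_inv measurableT)).
  by apply: measurable_funX; exact: measurable_funB.
move=> x _; rewrite lee_fin; apply: le_trans (ler_norm _).
have [->|xa] := eqVneq x a.
  by rewrite fa mul0r normr0 divr_ge0 ?(addr_ge0 c1 c2)// addr_ge0 ?sqr_ge0.
have xa2 : 0 < (x - a) ^+ 2 by rewrite exprn_even_gt0// subr_eq0.
have x2 : 0 < 1 + x ^+ 2 by rewrite ltr_pwDl// sqr_ge0.
rewrite ler_pdivlMr// normf_div (gtr0_norm xa2).
have [h|h] := leP `|x - a| 1.
  have qx : `|q x| <= `|q c|.
    by apply: cM; move: h; rewrite ler_norml in_itv/= => /andP[? ?]; apply/andP; split; lra.
  rewrite fq normrM (gtr0_norm xa2) [_ * `|_|]mulrC mulfK ?gt_eqF//.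
  have : 1 + x ^+ 2 <= A.
    rewrite lerD2l -[x ^+ 2]real_normK ?num_real// lerXn2r ?nnegrE ?addr_ge0//.
    have := ler_normD (x - a) a; rewrite subrK; lra.
  move=> xA; have : `|q x| * (1 + x ^+ 2) <= `|q c| * A by rewrite ler_pM// ltW.
  lra.
have h2 : 1 <= (x - a) ^+ 2.
  by rewrite -[X in _ <= X]real_normK ?num_real// exprn_ege1// ltW.
have : `|f x| / (x - a) ^+ 2 * (1 + x ^+ 2) <= M * (2 * (a ^+ 2) + 3).
  rewrite mulrAC ler_pdivrMr// -mulrA ler_pM// ?(ltW x2)//.
  have : 0 <= (x - 2 * a) ^+ 2 by exact: sqr_ge0.
  have : 0 <= a ^+ 2 * ((x - a) ^+ 2 - 1) by rewrite mulr_ge0 ?sqr_ge0 ?subr_ge0.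
  nra.
lra.
Qed.

Lemma integrable_opp f : mu.-integrable setT (fun x => (f x)%:E) ->
  mu.-integrable setT (fun x => (f (- x))%:E).
Proof.
have mopp : measurable_fun setT (-%R : measurableTypeR R -> measurableTypeR R).
  exact: measurable_funN.
exact: (@integrable_transport _ (measurableTypeR R) R mu -%R 1 mopp
  ge0_integral_opp).
Qed.

(** Fold both integrals at [a] and put N(t) = f(a+t) + f(a-t) = t r(t), where
    r(0) = 0 by the double zero.  Then (f'(a+t) - f'(a-t))/t = N'(t)/t
    = r'(t) + N(t)/t^2.  The first term integrates to zero because r vanishes at
    0 and at infinity; the second is the folded integrand on the right. *)
Lemma derive1_pv_double_zero f a : Schwartz f -> f a = 0 -> derive1 f a = 0 ->
  derive1 (pv f) a = \int[mu]_x (f x / (x - a) ^+ 2).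
Proof.
move=> Sf fa f'a; have Cf := Schwartz_Cinf Sf.
have iw := integrable_div_sqr Sf fa f'a.
pose w x := f x / (x - a) ^+ 2.
have mphi := measurable_affine 1 a.
have T' : forall f : R -> \bar R, measurable_fun setT f -> (forall x, 0 <= f x)%E ->
     (\int[mu]_x f (a + 1 * x)%R = 1%:E * \int[mu]_x f x)%E.
  by move=> h mh h0; rewrite ge0_integral_affine// invr1.
have iwt : mu.-integrable setT (fun x => (w (a + 1 * x))%:E).
  exact: (@integrable_transport _ (measurableTypeR R) R mu _ 1 mphi T' _ iw).
rewrite derive1_pv// -[RHS]mul1r.
rewrite -(@Rintegral_transport _ (measurableTypeR R) R mu _ 1 mphi T' _ iw).
rewrite (Rintegral_half iwt).
pose N t := f (a + t) + f (a - t).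
have CN : Cinf setT N.
  move=> n; have Cn := Cf n; apply: CkD.
    by apply: (@Ck_comp _ setT) => //; apply: CkD; [exact: Ck_cst|exact: Ck_id].
  by apply: (@Ck_comp _ setT) => //; apply: CkB; [exact: Ck_cst|exact: Ck_id].
have dN t : is_derive t 1 N (derive1 f (a + t) - derive1 f (a - t)).
  have h s : is_derive t 1 (fun t => f (a + s * t)) (s * derive1 f (a + s * t)).
    by apply: is_derive_affine; exact: Schwartz_is_derive.
  rewrite /N (_ : (fun t => _) = (fun t => f (a + 1 * t)) + (fun t => f (a + -1 * t))).
    have h1 := h 1; have h2 := h (-1).
    apply: is_derive_eq (is_deriveD h1 h2) _.
    by rewrite !mul1r !mulN1r.
  apply/funext => s; transitivity (f (a + 1 * s) + f (a + -1 * s)) => //.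
  by rewrite mul1r mulN1r.
have [r [Cr Nr r0]] := hadamard 0 CN.
have N0 : N 0 = 0 by rewrite /N addr0 subr0 fa addr0.
have {}Nr t : N t = t * r t by rewrite Nr N0 add0r subr0.
have Cr' := Cinf_derive1 openT Cr.
have rr' t : is_derive t 1 r (derive1 r t) by exact: (Cinf_is_derive Cr).
have E t : 0 < t -> dquot (derive1 f) a t = derive1 r t + (w (a + 1 * t) + w (a + 1 * - t)).
  move=> t0.
  have h : derive1 f (a + t) - derive1 f (a - t) = t * derive1 r t + r t.
    rewrite -(derive1_val (dN t)); apply: derive1_val.
    rewrite (_ : N = (fun t => t * r t)); last exact/funext.
    have h1 := rr' t; apply: is_derive_eq (is_deriveM (is_derive_id t 1) h1) _.
    by rewrite /GRing.scale/= mulr1.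
  rewrite /dquot h /w !mul1r addrAC subrr add0r addrAC subrr add0r sqrrN -mulrDl.
  by rewrite -[f _ + f _]/(N t) Nr; field; rewrite gt_eqF.
have mD : measurable (`]0, +oo[%classic : set (measurableTypeR R)) by [].
have ih : mu.-integrable `]0, +oo[ (fun t => (w (a + 1 * t) + w (a + 1 * - t))%:E).
  apply: integrableRD => //; first exact: integrableS iwt.
  by apply: integrableS (integrable_opp iwt).
have id : mu.-integrable `]0, +oo[ (fun t => (dquot (derive1 f) a t)%:E).
  by apply: integrable_dquot; exact: Schwartz_derive1.
have ir : mu.-integrable `]0, +oo[ (fun t => (derive1 r t)%:E).
  have := integrableRB mD id ih; apply: eq_integrable => // t.
  by rewrite inE/= in_itv/= andbT => t0; rewrite E// addrK.
transitivity (\int[mu]_(t in `]0, +oo[)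
    (derive1 r t + (w (a + 1 * t) + w (a + 1 * - t)))); last first.
  rewrite (RintegralD mD ir ih) -[RHS]add0r; congr (_ + _).
  have := cvg_Rintegral_halfline ir => /cvg_lim <-//.
  apply: cvg_lim => //.
  have {}r0 : r 0 = 0 by rewrite r0 (derive1_val (dN 0)) addr0 subr0 subrr.
  have [M fM] := Sch_decaying (Sf 0%N).
  have fM' x : `|f x| <= M.
    by apply: le_trans (fM x); rewrite ler_peMl// lerDl.
  have M0 : 0 <= M by exact: le_trans (fM' 0).
  apply/cvgr0Pnorm_lt => e e0; near=> n.
  have n0 : 0 < n%:R :> R by near: n; exact: nbhs_infty_gtr.
  rewrite (Rintegral_FTC2 n0 rr'); last first.
    by move=> t; exact: (Ck_continuous (Cr' 0%N)).
  rewrite r0 subr0 -[r _](mulKf (lt0r_neq0 n0)) -Nr normrM normfV (gtr0_norm n0).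
  rewrite mulrC ltr_pdivrMr//; apply: (@le_lt_trans _ _ (2 * M)).
    by apply: le_trans (ler_normD _ _) _; rewrite mulr_natl mulr2n lerD.
  by rewrite -ltr_pdivrMl//; near: n; exact: nbhs_infty_gtr.
apply: eq_Rintegral => t; rewrite inE/= in_itv/= andbT => t0; exact: E.
Unshelve. all: end_near. Qed.

End schwartz.

(** * Branches of a quadratic equation with parameters *)

Section branches.
Context {R : realType}.
Implicit Types (T Q e : R -> R) (l t x a b : R).

Lemma is_interval_ball (x e : R) : is_interval (ball x e).
Proof. by rewrite ball_itv; exact: interval_is_interval. Qed.

(** In the variable b = 1/a the equation is b^2 + T b + Q = 0.  Since its
    discriminant is the square of (l - l0) sqrt(e), both roots are smooth in [l]
    although they meet at [l0].  There they equal 1/a0 and have nonzero slope, by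
    [G != 0]; the branches are the local inverses of [l |-> 1/b(l)]. *)
Lemma quadratic_branches T Q e (a0 l0 S G d : R) :
  Cinf setT T -> Cinf setT Q -> Cinf setT e ->
  (forall l, T l ^+ 2 - 4 * Q l = (l - l0) ^+ 2 * e l) ->
  a0 != 0 -> T l0 = - 2 / a0 -> derive1 T l0 = S -> 0 < d -> e l0 = d ^+ 2 ->
  G != 0 -> 4 * G = S ^+ 2 - d ^+ 2 ->
  exists (I J : set R) (lambda : 'I_2 -> R -> R),
    [/\ [/\ open I, is_interval I & I a0],
        [/\ open J, is_interval J & J l0],
        0 < l0 -> J `<=` `]0, +oo[,
        exists2 a, I a & lambda 0 a != lambda 1 a &
        forall j : 'I_2,
          [/\ smooth_on I (lambda j),
              forall a, I a -> J (lambda j a),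
              lambda j a0 = l0,
              forall a, I a -> 1 + a * T (lambda j a) + a ^+ 2 * Q (lambda j a) = 0 &
              derive1 (lambda j) a0 = (S + (-1) ^+ j * d) / (2 * a0 ^+ 2 * G)]].
Proof.
move=> CT CQ Ce disc a00 Tl0 T'l0 d0 el0 G0 GSd.
pose b (j : 'I_2) l := 2^-1 * ((-1) * T l + ((-1) ^+ j * (l - l0)) * Num.sqrt (e l)).
have bl0 j : b j l0 = a0^-1.
  by rewrite /b subrr mulr0 mul0r addr0 Tl0; field.
have epos : \forall l \near l0, 0 < e l.
  have : {for l0, continuous e} by exact: (Ck_continuous (Ce 0%N)).
  by move=> /cvgr_gt; apply; rewrite el0 exprn_gt0.
have [r0 /= r00 r0P] : \forall l \near l0, 0 < e l /\ (0 < l0 -> 0 < l).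
  near=> l; split; near: l => //.
  have [l0p|l0n] := boolP (0 < l0); last by apply: nearW.
  by near=> l => _; near: l; exact: lt_nbhsr.
have Cb j : Cinf (ball l0 r0) (b j).
  move=> n; apply: CkZ; apply: CkD; first by apply: CkZ; exact: CkS (CT n).
  apply: CkM.
    apply: CkZ; apply: CkB; [exact: Ck_id|exact: Ck_cst].
  apply: (@Ck_comp _ [set x | 0 < x] _ n Num.sqrt).
  - by move=> l /r0P[].
  - exact: Ck_sqrt.
  - exact: CkS (Ce n).
have b0 j : \forall l \near l0, b j l != 0.
  have : {for l0, continuous (b j)}.
    by apply: (Ck_continuous (Cb j 0%N)); exact: ballxx.
  by move=> /cvgr_neq0; apply; rewrite bl0 invr_neq0.
have [r /= rp rP] : \forall l \near l0, ball l0 r0 l /\ forall j, b j l != 0.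
  have h0 := b0 0; have h1 := b0 1.
  near=> l; split; first by near: l; exact: nbhsx_ballx.
  move=> j; have [->|->] : j = 0 \/ j = 1.
    by case: j => -[|[|//]] ?; [left|right]; exact/val_inj.
  - by near: l.
  - by near: l.
have rP' l : ball l0 r l -> ball l0 r0 l /\ forall j, b j l != 0 by move=> /rP.
pose A j l := (b j l)^-1.
have CA j : Cinf (ball l0 r) (A j).
  move=> n; apply: (@Ck_comp _ [set x | x != 0] _ n (fun x => x^-1)).
  - by move=> l /rP'[_ /(_ j)].
  - exact: Ck_inv.
  - by apply: CkS (Cb j n) => l /rP'[].
have Al0 j : A j l0 = a0 by rewrite /A bl0 invrK.
have s1 (j : 'I_2) : ((-1) ^+ j) ^+ 2 = 1 :> R by rewrite sqrr_sign.
have Sd (j : 'I_2) : S - (-1) ^+ j * d != 0.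
  apply: contra G0 => /eqP h.
  have : 4 * G = 0 by rewrite GSd; have := s1 j; nra.
  by move/eqP; rewrite mulf_eq0 pnatr_eq0.
have A' (j : 'I_2) : derive1 (A j) l0 = a0 ^+ 2 * (S - (-1) ^+ j * d) / 2.
  have dT : is_derive l0 1 T S.
    by rewrite -T'l0; exact: (Cinf_is_derive CT).
  have Cs : Cinf (ball l0 r0) (fun l => Num.sqrt (e l)).
    move=> n; apply: (@Ck_comp _ [set x | 0 < x] _ n Num.sqrt).
    - by move=> l /r0P[].
    - exact: Ck_sqrt.
    - exact: CkS (Ce n).
  have ds := Cinf_is_derive Cs (ballxx l0 r00).
  set s' := derive1 _ _ in ds.
  have dw : is_derive l0 1 (fun l => (-1) ^+ j * (l - l0)) ((-1) ^+ j).
    have h : is_derive l0 1 ((-1) ^+ j *: (id - cst l0)) ((-1) ^+ j *: ((1 : R) - 0)).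
      by apply: is_deriveZ; apply: is_deriveB.
    by apply: is_derive_eq h _; rewrite subr0 /GRing.scale/= mulr1.
  have db : is_derive l0 1 (b j) (2^-1 * (- S + (-1) ^+ j * d)).
    have h1 := is_deriveM dw ds.
    have h2 := is_deriveZ (-1) dT.
    have h3 := is_deriveZ 2^-1 (is_deriveD h2 h1).
    apply: is_derive_eq h3 _.
    rewrite subrr mulr0 scale0r add0r el0 sqrtr_sqr gtr0_norm//.
    by rewrite /GRing.scale/= mulN1r [d * _]mulrC.
  apply: derive1_val; apply: DeriveDef.
    by apply: derivableV; [rewrite bl0 invr_neq0|have := db].
  rewrite deriveV ?bl0 ?invr_neq0//.
  by rewrite derive_val /GRing.scale/= exprVn invrK; field.
have l0B : ball l0 r l0 by exact: ballxx.
have inv j : exists2 eps : R, 0 < eps & exists g,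
    [/\ Cinf (ball a0 eps) g, g a0 = l0,
        forall y, ball a0 eps y -> ball l0 r (g y) /\ A j (g y) = y &
        is_derive a0 1 g (derive1 (A j) l0)^-1].
  have := @local_inverse R (ball l0 r) (A j) l0 (ball_open _ _) l0B (CA j).
  rewrite Al0; apply; rewrite A' !mulf_neq0 ?expf_neq0//.
have [eps0 eps00 [g0 [Cg0 g00 g0P dg0]]] := inv 0.
have [eps1 eps10 [g1 [Cg1 g10 g1P dg1]]] := inv 1.
pose eps := Num.min eps0 eps1.
have eps_gt0 : 0 < eps by rewrite lt_min eps00.
pose lam (j : 'I_2) := if j == 0 then g0 else g1.
have lamP (j : 'I_2) : [/\ Cinf (ball a0 eps) (lam j), lam j a0 = l0,
    forall y, ball a0 eps y -> ball l0 r (lam j y) /\ A j (lam j y) = y &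
    is_derive a0 1 (lam j) (derive1 (A j) l0)^-1].
  rewrite /lam; have [->|->] : j = 0 \/ j = 1.
      by case: j => -[|[|//]] ?; [left|right]; exact/val_inj.
    rewrite eqxx; split => //.
      by move=> n; apply: CkS (Cg0 n); apply: le_ball; rewrite ge_min lexx.
    by move=> y By; apply: g0P; apply: le_ball By; rewrite ge_min lexx.
  rewrite /=; split => //.
    by move=> n; apply: CkS (Cg1 n); apply: le_ball; rewrite ge_min lexx orbT.
  by move=> y By; apply: g1P; apply: le_ball By; rewrite ge_min lexx orbT.
have dlam (j : 'I_2) : derive1 (lam j) a0 = (S + (-1) ^+ j * d) / (2 * a0 ^+ 2 * G).
  have [_ _ _ dl] := lamP j; rewrite (derive1_val dl) A'.
  have E : 2 * a0 ^+ 2 * G = a0 ^+ 2 * (S - (-1) ^+ j * d) / 2 * (S + (-1) ^+ j * d).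
    have : G = (S ^+ 2 - d ^+ 2) / 4 by rewrite -GSd; field.
    move: (s1 j); move: ((-1) ^+ j : R) => s s2 ->.
    have -> : d ^+ 2 = s ^+ 2 * d ^+ 2 by rewrite s2 mul1r.
    by field.
  have Sd' : S + (-1) ^+ j * d != 0.
    apply: contra G0 => /eqP h.
    have : 4 * G = 0 by rewrite GSd; have := s1 j; nra.
    by move/eqP; rewrite mulf_eq0 pnatr_eq0.
  rewrite E; move: (a0 ^+ 2 * _ / 2) (S + _) Sd' => v w w0.
  by rewrite invfM mulrCA divff ?mulr1.
exists (ball a0 eps), (ball l0 r), lam; split.
- by split; [exact: ball_open|exact: is_interval_ball|exact: ballxx].
- by split; [exact: ball_open|exact: is_interval_ball|exact: ballxx].
- by move=> l0p l /rP'[/r0P[_ /(_ l0p)]]; rewrite /= in_itv/= andbT.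
- apply: contrapT => H.
  have E x : ball a0 eps x -> lam 0 x = lam 1 x.
    by move=> Bx; apply/eqP/negPn/negP => h; apply: H; exists x.
  have : derive1 (lam 0) a0 = derive1 (lam 1) a0.
    have [_ _ _ d1] := lamP 1; apply/derive1_val.
    rewrite (derive1_val d1); apply: near_eq_is_derive d1.
    apply: filterS (nbhsx_ballx a0 _ eps_gt0) => x /E //.
  rewrite !dlam => /(mulIf _) h.
  have /h : (2 * a0 ^+ 2 * G)^-1 != 0 by rewrite invr_neq0// !mulf_neq0 ?expf_neq0.
  rewrite /= expr0 expr1; lra.
- move=> j; have [Cl la lP _] := lamP j; split => //.
  + exact: Cinf_smooth_on (ball_open _ _) Cl.
  + by move=> x /lP[].
  + move=> x Bx; have [Bl Ax] := lP _ Bx.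
    have [/r0P[el _] bn0] := rP' _ Bl.
    move: (lam j x) Ax Bl el bn0 => l Ax Bl el bn0.
    have bx : b j l = x^-1 by rewrite -Ax invrK.
    have x0 : x != 0 by rewrite -Ax invr_neq0.
    have quad : b j l ^+ 2 + T l * b j l + Q l = 0.
      have : (2 * b j l + T l) ^+ 2 = (l - l0) ^+ 2 * e l.
        rewrite /b mulrA divff// mul1r mulN1r addrAC addNr add0r !exprMn s1 mul1r.
        by rewrite sqr_sqrtr// ltW.
      rewrite -disc; lra.
    have -> : 1 + x * T l + x ^+ 2 * Q l = x ^+ 2 * (b j l ^+ 2 + T l * b j l + Q l).
      by rewrite bx; field.
    by rewrite quad mulr0.
Unshelve. all: end_near. Qed.

End branches.

(** * The Hessian and the Gram determinant *)

Section core.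
Context {R : realType}.
Local Notation mu := (@lebesgue_measure R).
Implicit Types (f g T Q : R -> R) (l t x a b s : R).

Lemma derive1_min0 f x : (forall y, 0 <= f y) -> f x = 0 ->
  (forall y, derivable f y 1) -> derive1 f x = 0.
Proof.
move=> f0 fx df; apply: derive1_val.
apply: (@derive1_at_min _ f (x - 1) (x + 1) x).
- lra.
- by move=> t _; exact: df.
- by rewrite in_itv/=; apply/andP; split; lra.
- by move=> t _; rewrite fx.
Qed.

Lemma Rintegral_gt0 f x0 c : mu.-integrable setT (EFin \o f) ->
  (forall x, 0 <= f x) -> 0 < c -> (\forall x \near x0, c <= f x) ->
  0 < \int[mu]_x f x.
Proof.
move=> fi f0 c0 [r /= r0 rP].
have fB x : ball x0 r x -> c <= f x by move=> /rP.
have mB : measurable (ball x0 r : set (measurableTypeR R)) by exact: measurable_ball.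
have fiB : mu.-integrable (ball x0 r : set (measurableTypeR R)) (EFin \o f).
  exact: integrableS fi.
rewrite -lte_fin /Rintegral fineK ?integrable_fin_num//.
apply: (@lt_le_trans _ _ (\int[mu]_(x in ball x0 r) (f x)%:E)%E); last first.
  apply: ge0_subset_integral => //; first exact: measurable_int fi.
  by move=> x _; rewrite lee_fin.
apply: (@lt_le_trans _ _ (\int[mu]_(x in ball x0 r) c%:E)%E).
  rewrite ball_itv integral_cst//= lebesgue_measure_itv/= lte_fin ifT; last lra.
  by rewrite -EFinB -EFinM lte_fin mulr_gt0//; lra.
apply: ge0_le_integral => //.
- by move=> x _; rewrite lee_fin ltW.
- exact: measurable_int fiB.
Qed.

Lemma Rintegral_eq0 f : mu.-integrable setT (EFin \o f) ->
  (forall x, 0 <= f x) -> \int[mu]_x f x = 0 ->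
  forall x, {for x, continuous f} -> f x = 0.
Proof.
move=> fi f0 If x cf; apply/eqP; rewrite eq_le f0 andbT leNgt; apply/negP => fx.
have : 0 < \int[mu]_x f x.
  apply: (@Rintegral_gt0 f x (f x / 2)) => //; first by rewrite divr_gt0.
  have fx2 : f x / 2 < f x by rewrite ltr_pdivrMr// ltr_pMr// ltr1n.
  near=> y; apply/ltW; near: y.
  by move/cvgr_gt : cf; exact.
by rewrite If ltxx.
Unshelve. all: end_near. Qed.

(** The directional derivatives in the Hessian are ordinary derivatives of the
    partial functions. *)
Lemma derive_fst (F : R * R -> R) a l :
  'D_((1 : R), (0 : R)) F (a, l) = derive1 (fun x => F (x, l)) a.
Proof.
rewrite /derive /derive1.
set f1 := (fun h : R => _); set f2 := (fun h : R => _).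
suff -> : f1 = f2 by []; apply/funext => h; rewrite /f1 /f2.
congr (_ *: (_ - _)); transitivity (F (h * 1 + a, h * 0 + l)) => //.
by rewrite mulr1 mulr0 add0r.
Qed.

Lemma derive_snd (F : R * R -> R) a l :
  'D_((0 : R), (1 : R)) F (a, l) = derive1 (fun x => F (a, x)) l.
Proof.
rewrite /derive /derive1.
set f1 := (fun h : R => _); set f2 := (fun h : R => _).
suff -> : f1 = f2 by []; apply/funext => h; rewrite /f1 /f2.
congr (_ *: (_ - _)); transitivity (F (h * 0 + a, h * 1 + l)) => //.
by rewrite mulr1 mulr0 add0r.
Qed.

Lemma is_derive_poly2 (c0 c1 c2 x : R) :
  is_derive x 1 (fun x => c0 + x * c1 + x ^+ 2 * c2) (c1 + 2 * x * c2).
Proof.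
have h1 := is_deriveZ c1 (is_derive_id x (1 : R)).
have h2 := is_deriveZ c2 (is_deriveM (is_derive_id x (1 : R)) (is_derive_id x (1 : R))).
have h := is_deriveD (is_deriveD (is_derive_cst c0 x (1 : R)) h1) h2.
rewrite (_ : (fun x => _) = cst c0 + c1 *: id + c2 *: (id * id)).
  by apply: is_derive_eq h _; rewrite /GRing.scale/=; ring.
apply/funext => y; transitivity (c0 + c1 * y + c2 * (y * y)) => //.
by ring.
Qed.

Lemma is_derive_lin2 (c0 c1 c2 : R) T Q l (t q : R) :
  is_derive l 1 T t -> is_derive l 1 Q q ->
  is_derive l 1 (fun l => c0 + c1 * T l + c2 * Q l) (c1 * t + c2 * q).
Proof.
move=> dT dQ.
have h := is_deriveD (is_deriveD (is_derive_cst c0 l (1 : R)) (is_deriveZ c1 dT))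
  (is_deriveZ c2 dQ).
by apply: is_derive_eq h _; rewrite /GRing.scale/= add0r.
Qed.

Lemma det_mx2 (K : comNzRingType) (M : 'M[K]_2) :
  \det M = M 0 0 * M 1 1 - M 0 1 * M 1 0.
Proof.
rewrite (expand_det_row M ord0) 2!big_ord_recl big_ord0 addr0 /cofactor.
rewrite !det_mx11 !mxE /= /bump/= !addn0 expr0 mul1r expr1 mulN1r mulrN.
by congr (_ * M _ _ - M _ _ * M _ _); exact/val_inj.
Qed.

Lemma det_hessian_quadratic T Q a l : Cinf setT T -> Cinf setT Q ->
  \det (hessian (fun q : R * R => 1 + q.1 * T q.2 + q.1 ^+ 2 * Q q.2) (a, l)) =
  2 * Q l * (a * derive1 (derive1 T) l + a ^+ 2 * derive1 (derive1 Q) l)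
  - (derive1 T l + 2 * a * derive1 Q l) ^+ 2.
Proof.
move=> CT CQ; set F := (fun q : R * R => _).
have dT x := Cinf_is_derive CT (I : setT x).
have dQ x := Cinf_is_derive CQ (I : setT x).
have dT' x := Cinf_is_derive (Cinf_derive1 openT CT) (I : setT x).
have dQ' x := Cinf_is_derive (Cinf_derive1 openT CQ) (I : setT x).
have D0 : 'D_((1 : R), (0 : R)) F = fun q => T q.2 + 2 * q.1 * Q q.2.
  apply/funext => -[x y]; rewrite derive_fst; apply: derive1_val.
  exact: (is_derive_poly2 1 (T y) (Q y) x).
have D1 : 'D_((0 : R), (1 : R)) F = fun q => q.1 * derive1 T q.2 + q.1 ^+ 2 * derive1 Q q.2.
  apply/funext => -[x y]; rewrite derive_snd; apply: derive1_val.
  exact: (is_derive_lin2 1 x (x ^+ 2) (dT y) (dQ y)).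
rewrite det_mx2 !mxE/= D0 D1 !derive_fst !derive_snd/=.
have -> : derive1 (fun x => T l + 2 * x * Q l) a = 2 * Q l.
  apply: derive1_val; have := is_derive_poly2 (T l) (2 * Q l) 0 a.
  under eq_fun do rewrite mulr0 addr0; rewrite mulr0 addr0.
  by under eq_fun do rewrite mulrA [_ * 2]mulrC.
have -> : derive1 (fun x => x * derive1 T l + x ^+ 2 * derive1 Q l) a =
    derive1 T l + 2 * a * derive1 Q l.
  apply: derive1_val; have := is_derive_poly2 0 (derive1 T l) (derive1 Q l) a.
  by under eq_fun do rewrite add0r.
have -> : derive1 (fun x => T x + 2 * a * Q x) l = derive1 T l + 2 * a * derive1 Q l.
  by apply: derive1_val.
have -> : derive1 (fun x => a * derive1 T x + a ^+ 2 * derive1 Q x) l =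
    a * derive1 (derive1 T) l + a ^+ 2 * derive1 (derive1 Q) l.
  by apply: derive1_val.
by rewrite expr2.
Qed.

End core.

Section real_core.
Context {R : realType}.
Local Notation mu := (@lebesgue_measure R).
Implicit Types (f g T Q e : R -> R) (l t x a b s : R).

Lemma is_derive_mul f g x (df dg : R) : is_derive x 1 f df -> is_derive x 1 g dg ->
  is_derive x 1 (fun x => f x * g x) (f x * dg + g x * df).
Proof. by move=> fd gd; exact: is_deriveM. Qed.

Lemma is_derive_subr l0 x : is_derive x 1 (fun l : R => l - l0) (1 : R).
Proof.
have h := is_deriveB (is_derive_id x (1 : R)) (is_derive_cst l0 x (1 : R)).
by apply: is_derive_eq h _; rewrite subr0.
Qed.

(** Expressing Q through T and e by the discriminant identity, all terms other than
    [e l0] cancel because [T l0 = -2/a0]. *)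
Lemma det_hessian_disc T Q e a0 l0 : Cinf setT T -> Cinf setT Q -> Cinf setT e ->
  (forall l, T l ^+ 2 - 4 * Q l = (l - l0) ^+ 2 * e l) ->
  a0 != 0 -> T l0 = - 2 / a0 ->
  \det (hessian (fun q : R * R => 1 + q.1 * T q.2 + q.1 ^+ 2 * Q q.2) (a0, l0)) = - e l0.
Proof.
move=> CT CQ Ce disc a00 Tl0.
have dT x := Cinf_is_derive CT (I : setT x).
have dT' x := Cinf_is_derive (Cinf_derive1 openT CT) (I : setT x).
have de x := Cinf_is_derive Ce (I : setT x).
have de' x := Cinf_is_derive (Cinf_derive1 openT Ce) (I : setT x).
pose m l := l - l0.
have dm x : is_derive x 1 m 1 by exact: is_derive_subr.
pose k l := m l * derive1 e l + e l * 1.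
have dk0 x := is_derive_mul (dm x) (de x).
have dk x : is_derive x 1 k (m x * derive1 (derive1 e) x + derive1 e x * 1 + 1 * derive1 e x).
  have h := is_deriveD (is_derive_mul (dm x) (de' x)) (de x).
  rewrite (_ : k = (fun x => m x * derive1 e x) + e).
    by apply: is_derive_eq h _; rewrite mul1r.
  by apply/funext => y; rewrite /k mulr1.
have QE : Q = 4^-1 *: ((fun l => T l * T l) - (fun l => m l * (m l * e l))).
  apply/funext => l; transitivity (4^-1 * (T l * T l - m l * (m l * e l))) => //.
  have := disc l; rewrite /m => h.
  have -> : Q l = 4^-1 * (T l ^+ 2 - (T l ^+ 2 - 4 * Q l)) by field.
  by rewrite h; congr (_ * _); ring.
have dQ x : is_derive x 1 Q
   (4^-1 * ((T x * derive1 T x + T x * derive1 T x) - (m x * k x + m x * e x * 1))).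
  have h := is_deriveZ 4^-1 (is_deriveB (is_derive_mul (dT x) (dT x))
    (is_derive_mul (dm x) (dk0 x))).
  by rewrite QE; apply: is_derive_eq h _.
have Q'E : derive1 Q = 4^-1 *: (2 *: (fun l => T l * derive1 T l) -
    ((fun l => m l * k l) + (fun l => m l * e l))).
  apply/funext => l; rewrite (derive1_val (dQ l)).
  transitivity (4^-1 * (2 * (T l * derive1 T l) - (m l * k l + m l * e l))) => //.
  by rewrite mulr1 mulr_natl mulr2n.
have dQ' : derive1 (derive1 Q) l0 = 4^-1 * (2 * (T l0 * derive1 (derive1 T) l0 + derive1 T l0 * derive1 T l0)
    - (m l0 * (m l0 * derive1 (derive1 e) l0 + derive1 e l0 * 1 + 1 * derive1 e l0) + k l0 * 1
       + (m l0 * derive1 e l0 + e l0 * 1))).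
  have h := is_deriveZ 4^-1 (is_deriveB (is_deriveZ 2 (is_derive_mul (dT l0) (dT' l0)))
    (is_deriveD (is_derive_mul (dm l0) (dk l0)) (is_derive_mul (dm l0) (de l0)))).
  by rewrite Q'E; apply: derive1_val; apply: is_derive_eq h _.
rewrite det_hessian_quadratic// dQ' (derive1_val (dQ l0)).
have Ql0 : Q l0 = T l0 ^+ 2 / 4.
  by have := disc l0; rewrite subrr expr0n mul0r => /eqP; rewrite subr_eq0 => /eqP ->; field.
have m0 : m l0 = 0 by rewrite /m subrr.
have k0 : k l0 = e l0 by rewrite /k m0 mul0r add0r mulr1.
rewrite m0 k0 Ql0 Tl0 !mul0r !add0r !subr0 !mulr1.
move: (e l0) (derive1 T l0) (derive1 (derive1 T) l0) => x y z.
by field.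
Qed.

Section four_functions.
Variables (e0 e1 p r : R -> R) (a0 l0 : R).
Hypotheses (Se0 : Schwartz e0) (Se1 : Schwartz e1) (Sp : Schwartz p) (Sr : Schwartz r).
Hypothesis e0_ge0 : forall x, 0 <= e0 x.
Hypothesis q_ge0 : forall s t x,
  0 <= e1 x - 2 * (s * p x + t * r x) + (s ^+ 2 + t ^+ 2) * e0 x.
Hypothesis ie0 : mu.-integrable setT (EFin \o e0).
Hypotheses (Ip : \int[mu]_x p x = 0) (Ir : \int[mu]_x r x = 0).
Hypotheses (e0z : e0 l0 = 0) (e1z : e1 l0 = 0) (pz : p l0 = 0) (rz : r l0 = 0).
Hypotheses (c0 : 1 + a0 * pv e0 l0 = 0) (c1 : 1 + a0 * pv e1 l0 = 0).
Hypotheses (cp : pv p l0 = 0) (cr : pv r l0 = 0).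

Let g f := \int[mu]_x (f x / (x - l0) ^+ 2).
Let Sum := g e0 + g e1.
Let Gram := g e0 * g e1 - (g p ^+ 2 + g r ^+ 2).

Let a00 : a0 != 0.
Proof.
by apply/eqP => a0E; move: c0; rewrite a0E mul0r addr0 => /eqP; rewrite oner_eq0.
Qed.

Let dz f : (forall x, 0 <= f x) -> f l0 = 0 -> Schwartz f -> derive1 f l0 = 0.
Proof.
by move=> f0 fz Sf; apply: derive1_min0 => // y; have := Schwartz_is_derive y Sf.
Qed.

Let e1_ge0 x : 0 <= e1 x.
Proof. by have := q_ge0 0 0 x; rewrite expr0n !mul0r addr0 mulr0 mul0r addr0 subr0. Qed.

Let de0 : derive1 e0 l0 = 0. Proof. exact: dz. Qed.
Let de1 : derive1 e1 l0 = 0. Proof. exact: dz. Qed.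

Let comb s t : R -> R :=
  fun x => e1 x + (-2 * s) * p x + (-2 * t) * r x + (s ^+ 2 + t ^+ 2) * e0 x.

Let combE s t x : comb s t x =
  e1 x - 2 * (s * p x + t * r x) + (s ^+ 2 + t ^+ 2) * e0 x.
Proof. by rewrite /comb; ring. Qed.

Let Scomb s t : Schwartz (comb s t).
Proof.
move=> n; apply: SchD; last exact: SchZ.
by apply: SchD; [apply: SchD => //|]; exact: SchZ.
Qed.

Let comb_ge0 s t x : 0 <= comb s t x. Proof. by rewrite combE. Qed.

Let comb_z s t : comb s t l0 = 0.
Proof. by rewrite /comb e0z e1z pz rz !mulr0 !addr0. Qed.

Let dcomb s t : derive1 (comb s t) l0 = 0.
Proof. by apply: dz. Qed.

Let derive_comb s t : derive1 (comb s t) l0 =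
  derive1 e1 l0 + (-2 * s) * derive1 p l0 + (-2 * t) * derive1 r l0
  + (s ^+ 2 + t ^+ 2) * derive1 e0 l0.
Proof.
have h0 := Schwartz_is_derive l0 Se0; have h1 := Schwartz_is_derive l0 Se1.
have hp := Schwartz_is_derive l0 Sp; have hr := Schwartz_is_derive l0 Sr.
by apply: derive1_val.
Qed.

Let dp : derive1 p l0 = 0.
Proof.
have := derive_comb 1 0; rewrite dcomb de0 de1; lra.
Qed.

Let dr : derive1 r l0 = 0.
Proof.
have := derive_comb 0 1; rewrite dcomb de0 de1; lra.
Qed.

Let g_eq0 f : Schwartz f -> (forall x, 0 <= f x) -> f l0 = 0 -> g f = 0 ->
  forall x, f x = 0.
Proof.
move=> Sf f0 fz gf x; have [->//|xl0] := eqVneq x l0.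
have fi := integrable_div_sqr Sf fz (dz f0 fz Sf).
have xl2 : (x - l0) ^+ 2 != 0 by rewrite expf_neq0// subr_eq0.
have : f x / (x - l0) ^+ 2 = 0.
  apply: (Rintegral_eq0 fi) => //.
    by move=> y; rewrite mulr_ge0// invr_ge0 sqr_ge0.
  apply: cvgM; first exact: (Sch_continuous (Sf 0%N)).
  apply: cvgV => //; rewrite expr2; under eq_fun do rewrite expr2.
  by apply: cvgM; apply: cvgB; [exact: cvg_id|exact: cvg_cst|exact: cvg_id|exact: cvg_cst].
by move/eqP; rewrite mulf_eq0 invr_eq0 (negPf xl2) orbF => /eqP.
Qed.

Let pv_eq0 f : (forall x, f x = 0) -> pv f l0 = 0.
Proof.
move=> f0; rewrite /pv (_ : dquot f l0 = cst 0).
  by rewrite Rintegral_cst// mul0r.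
by apply/funext => t; rewrite /dquot !f0 subrr mul0r.
Qed.

Let e0N0 : ~ (forall x, e0 x = 0).
Proof. by move=> /pv_eq0 h; move: c0; rewrite h mulr0 addr0 => /eqP; rewrite oner_eq0. Qed.

Let e1N0 : ~ (forall x, e1 x = 0).
Proof. by move=> /pv_eq0 h; move: c1; rewrite h mulr0 addr0 => /eqP; rewrite oner_eq0. Qed.

Let gi f : Schwartz f -> f l0 = 0 -> derive1 f l0 = 0 ->
  mu.-integrable setT (fun x => (f x / (x - l0) ^+ 2)%:E).
Proof. exact: integrable_div_sqr. Qed.

Let g_comb s t : g (comb s t) =
  g e1 + (-2 * s) * g p + (-2 * t) * g r + (s ^+ 2 + t ^+ 2) * g e0.
Proof.
have i0 := gi Se0 e0z de0; have i1 := gi Se1 e1z de1.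
have ip := gi Sp pz dp; have ir := gi Sr rz dr.
have mT := @measurableT _ (measurableTypeR R).
have jp := integrableRZ mT (-2 * s) ip; have jr := integrableRZ mT (-2 * t) ir.
have j0 := integrableRZ mT (s ^+ 2 + t ^+ 2) i0.
have j1 := integrableRD mT i1 jp; have j2 := integrableRD mT j1 jr.
rewrite /g -(RintegralZl (-2 * s) mT ip) -(RintegralZl (-2 * t) mT ir)
  -(RintegralZl (s ^+ 2 + t ^+ 2) mT i0).
rewrite -(RintegralD mT i1 jp) -(RintegralD mT j1 jr) -(RintegralD mT j2 j0).
by apply: eq_Rintegral => x _; rewrite /comb !mulrDl !mulrA.
Qed.

Let lin_eq0 (b c : R) : (forall x, 0 <= - (2 * x * b) + x ^+ 2 * c) -> 0 <= c -> b = 0.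
Proof.
move=> H c0'; apply/eqP/negPn/negP => bN.
have c1' : c + 1 != 0 by rewrite gt_eqF// ltr_wpDl.
have := H (b / (c + 1)).
have -> : - (2 * (b / (c + 1)) * b) + (b / (c + 1)) ^+ 2 * c =
   - (b ^+ 2 / (c + 1) ^+ 2) * (c + 2) by field.
have h1 : 0 < b ^+ 2 by rewrite exprn_even_gt0.
have h2 : 0 < (c + 1) ^+ 2 by rewrite exprn_even_gt0.
have h3 : 0 < b ^+ 2 / (c + 1) ^+ 2 by rewrite divr_gt0.
nra.
Qed.

(** A vanishing Gram determinant makes the integral of q(x)/(x - l0)^2 vanish for
    q = e1 - 2 (s p + t r) + (s^2 + t^2) e0 with s, t the projection coefficients;
    as q is nonnegative, q = 0.  Minimality in (s, t) then forces p = s e0 and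
    r = t e0.  Integrating over the line, where p and r have mean zero and e0 does
    not, gives s = t = 0, hence e1 = 0. *)
Lemma gram_neq0 : Gram != 0.
Proof.
apply/eqP => G0.
have g0 : 0 < g e0.
  rewrite lt_neqAle; apply/andP; split.
    by apply/eqP => h; apply: e0N0; apply: g_eq0.
  by apply: Rintegral_ge0 => x _; rewrite mulr_ge0// invr_ge0 sqr_ge0.
(* the minimum of the quadratic form in (s, t) is Gram / g e0 *)
pose s := g p / g e0; pose t := g r / g e0.
have q0 : forall x, comb s t x = 0.
  apply: g_eq0 => //; rewrite g_comb.
  have -> : g e1 = (g p ^+ 2 + g r ^+ 2) / g e0.
    move/eqP: G0; rewrite /Gram subr_eq0 => /eqP <-.
    by rewrite mulrC mulKf ?gt_eqF.
  by rewrite /s /t; field; rewrite gt_eqF.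
have pE x : p x = s * e0 x.
  apply/eqP; rewrite -subr_eq0; apply/eqP; apply: (@lin_eq0 _ (e0 x)) => // y.
  have := comb_ge0 (s + y) t x; have := q0 x; rewrite !combE => h.
  lra.
have rE x : r x = t * e0 x.
  apply/eqP; rewrite -subr_eq0; apply/eqP; apply: (@lin_eq0 _ (e0 x)) => // y.
  have := comb_ge0 s (t + y) x; have := q0 x; rewrite !combE => h.
  lra.
have I0 : \int[mu]_x e0 x != 0.
  apply/eqP => h; apply: e0N0 => x; apply: (Rintegral_eq0 ie0) => //.
  exact: (Sch_continuous (Se0 0%N)).
have s0 : s = 0.
  move: Ip; rewrite (_ : p = fun x => s * e0 x); last exact/funext.
  by rewrite RintegralZl// => /eqP; rewrite mulf_eq0 (negPf I0) orbF => /eqP.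
have t0 : t = 0.
  move: Ir; rewrite (_ : r = fun x => t * e0 x); last exact/funext.
  by rewrite RintegralZl// => /eqP; rewrite mulf_eq0 (negPf I0) orbF => /eqP.
apply: e1N0 => x; have := q0 x.
by rewrite /comb s0 t0 expr0n !mulr0 !mul0r !addr0 mul0r addr0.
Qed.

(** The coefficients of F_1 as a polynomial in [alpha]. *)
Definition lin_coef l := pv e0 l + pv e1 l.
Definition quad_coef l := pv e0 l * pv e1 l - (pv p l ^+ 2 + pv r l ^+ 2)
  - pi ^+ 2 * (e0 l * e1 l - (p l ^+ 2 + r l ^+ 2)).

(** Hadamard's lemma at [l0] for [pv e0 - pv e1], [pv p], [pv r] and for e0, e1, p,
    r writes the discriminant as (l - l0)^2 e(l).  The value
    e(l0) = Sum^2 - 4 Gram uses that e0, p, r have a double zero at [l0]. *)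
Lemma real_branches :
  let F := fun q : R * R => 1 + q.1 * lin_coef q.2 + q.1 ^+ 2 * quad_coef q.2 in
  let d := Num.sqrt (- \det (hessian F (a0, l0))) in
  \det (hessian F (a0, l0)) < 0 ->
  exists (I J : set R) (lambda : 'I_2 -> R -> R),
    [/\ [/\ open I, is_interval I & I a0],
        [/\ open J, is_interval J & J l0],
        0 < l0 -> J `<=` `]0, +oo[,
        exists2 a, I a & lambda 0 a != lambda 1 a &
        forall j : 'I_2,
          [/\ smooth_on I (lambda j),
              forall a, I a -> J (lambda j a),
              lambda j a0 = l0,
              forall a, I a -> F (a, lambda j a) = 0 &
              derive1 (lambda j) a0 = (Sum + (-1) ^+ j * d) / (2 * a0 ^+ 2 * Gram)]].
Proof.
move=> F d.
have C0 := pv_Cinf Se0; have C1 := pv_Cinf Se1.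
have Cp := pv_Cinf Sp; have Cr := pv_Cinf Sr.
have D0 := derive1_pv_double_zero Se0 e0z de0.
have D1 := derive1_pv_double_zero Se1 e1z de1.
have Dp := derive1_pv_double_zero Sp pz dp.
have Dr := derive1_pv_double_zero Sr rz dr.
have K0 := Schwartz_Cinf Se0; have K1 := Schwartz_Cinf Se1.
have Kp := Schwartz_Cinf Sp; have Kr := Schwartz_Cinf Sr.
have pv0 : pv e0 l0 = - a0^-1.
  by apply: (mulfI a00); rewrite mulrN divff//; move/eqP: c0; rewrite addrC addr_eq0 => /eqP.
have pv1 : pv e1 l0 = - a0^-1.
  by apply: (mulfI a00); rewrite mulrN divff//; move/eqP: c1; rewrite addrC addr_eq0 => /eqP.
have CD : Cinf setT (fun l => pv e0 l - pv e1 l) by move=> n; exact: CkB.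
have [A [CA AE Al0]] := hadamard l0 CD.
have [B [CB BE Bl0]] := hadamard l0 Cp.
have [C [CC CE Cl0]] := hadamard l0 Cr.
have [E0 [CE0 E0E E0l0]] := hadamard l0 K0.
have [E1 [CE1 E1E E1l0]] := hadamard l0 K1.
have [P1 [CP1 P1E P1l0]] := hadamard l0 Kp.
have [R1 [CR1 R1E R1l0]] := hadamard l0 Kr.
(* the discriminant divided by (l - l0)^2 *)
pose e l := A l * A l + 4 * (B l * B l + C l * C l)
  + (4 * pi ^+ 2) * (E0 l * E1 l - (P1 l * P1 l + R1 l * R1 l)).
have Ce : Cinf setT e.
  move=> n; apply: CkD; first apply: CkD; first exact: CkM.
    by apply: CkZ; apply: CkD; exact: CkM.
  by apply: CkZ; apply: CkB; [|apply: CkD]; exact: CkM.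
have CT : Cinf setT lin_coef by move=> n; exact: CkD.
have CQ : Cinf setT quad_coef.
  move=> n; rewrite (_ : quad_coef = (fun l => pv e0 l * pv e1 l - (pv p l * pv p l + pv r l * pv r l)
    - pi ^+ 2 * (e0 l * e1 l - (p l * p l + r l * r l)))); last first.
    by apply/funext => l; rewrite /quad_coef !expr2.
  apply: CkB; first by apply: CkB; [|apply: CkD]; exact: CkM.
  apply: CkZ; apply: CkB; first by apply: CkM; [exact: K0|exact: K1].
  by apply: CkD; apply: CkM; [exact: Kp|exact: Kp|exact: Kr|exact: Kr].
have disc l : lin_coef l ^+ 2 - 4 * quad_coef l = (l - l0) ^+ 2 * e l.
  rewrite /lin_coef /quad_coef /e P1E R1E E0E E1E BE CE cp cr e0z e1z pz rz !add0r.
  have -> : pv e1 l = pv e0 l - (l - l0) * A l.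
    by have := AE l; rewrite pv0 pv1 subrr add0r => <-; ring.
  by ring.
have Tl0 : lin_coef l0 = - 2 / a0.
  by rewrite /lin_coef pv0 pv1; field.
have dT : derive1 lin_coef l0 = Sum.
  have h0 := Cinf_is_derive C0 (I : setT l0); have h1 := Cinf_is_derive C1 (I : setT l0).
  rewrite /Sum /g -D0 -D1; apply: derive1_val; exact: (is_deriveD h0 h1).
have dA : A l0 = g e0 - g e1.
  have h0 := Cinf_is_derive C0 (I : setT l0); have h1 := Cinf_is_derive C1 (I : setT l0).
  rewrite Al0 /g -D0 -D1; apply: derive1_val; exact: (is_deriveB h0 h1).
have el0 : e l0 = Sum ^+ 2 - 4 * Gram.
  rewrite /e E0l0 P1l0 R1l0 de0 dp dr dA Bl0 Cl0 Dp Dr -/(g p) -/(g r).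
  by rewrite /Sum /Gram; ring.
have detE := det_hessian_disc CT CQ Ce disc a00 Tl0.
rewrite -/F in detE; rewrite detE => e_lt0.
have e_gt0 : 0 < e l0 by rewrite -oppr_lt0.
have d0 : 0 < d by rewrite sqrtr_gt0 detE opprK.
have d2 : e l0 = d ^+ 2 by rewrite sqr_sqrtr detE opprK// ltW.
apply: (quadratic_branches CT CQ Ce disc a00 Tl0 dT d0 d2 gram_neq0).
by rewrite -d2 el0; ring.
Qed.

End four_functions.
End real_core.

(** * Complex-valued square integrable functions *)

Section complex_numbers.
Context {R : realType}.
Implicit Types z w : R[i].

Definition rdot z w : R :=
  complex.Re z * complex.Re w + complex.Im z * complex.Im w.
Definition abs2 z : R := complex.Re z ^+ 2 + complex.Im z ^+ 2.

Lemma abs2_ge0 z : 0 <= abs2 z. Proof. by rewrite addr_ge0 ?sqr_ge0. Qed.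

Lemma abs2_normc z : abs2 z = ComplexField.Normc.normc z ^+ 2.
Proof. by case: z => a b; rewrite /abs2/= sqr_sqrtr// addr_ge0 ?sqr_ge0. Qed.

Lemma rdotzz z : rdot z z = abs2 z. Proof. by rewrite /rdot /abs2 !expr2. Qed.
Lemma rdotC z w : rdot z w = rdot w z.
Proof. by rewrite /rdot; ring. Qed.

Lemma cReD z w : complex.Re (z + w) = complex.Re z + complex.Re w.
Proof. by case: z w => [a b] [c d]. Qed.
Lemma cImD z w : complex.Im (z + w) = complex.Im z + complex.Im w.
Proof. by case: z w => [a b] [c d]. Qed.
Lemma cReN z : complex.Re (- z) = - complex.Re z.
Proof. by case: z. Qed.
Lemma cImN z : complex.Im (- z) = - complex.Im z.
Proof. by case: z. Qed.
Lemma cReM z w : complex.Re (z * w) =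
  complex.Re z * complex.Re w - complex.Im z * complex.Im w.
Proof. by case: z w => [a b] [c d]. Qed.
Lemma cImM z w : complex.Im (z * w) =
  complex.Re z * complex.Im w + complex.Im z * complex.Re w.
Proof. by case: z w => [a b] [c d]. Qed.
Lemma cRe_conj z : complex.Re (conjc z) = complex.Re z. Proof. by case: z. Qed.
Lemma cIm_conj z : complex.Im (conjc z) = - complex.Im z. Proof. by case: z. Qed.

Definition reimE := (cReD, cImD, cReN, cImN, cReM, cImM, cRe_conj, cIm_conj).

Lemma abs2M z w : abs2 (z * w) = abs2 z * abs2 w.
Proof. by rewrite /abs2 !reimE; ring. Qed.

(** A substitute for the triangle inequality that stays valid for infinite norms. *)
Lemma abs2D_le (d : R) z w : 0 < d ->
  abs2 (z + w) <= (1 + d) * abs2 z + (1 + d^-1) * abs2 w.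
Proof.
move=> d0; rewrite -subr_ge0.
have -> : (1 + d) * abs2 z + (1 + d^-1) * abs2 w - abs2 (z + w) =
    d * ((complex.Re z - d^-1 * complex.Re w) ^+ 2
       + (complex.Im z - d^-1 * complex.Im w) ^+ 2).
  by rewrite /abs2 !reimE; field; rewrite gt_eqF.
by rewrite mulr_ge0 ?(ltW d0)// addr_ge0 ?sqr_ge0.
Qed.

Lemma rdot_le z w : `|rdot z w| <= abs2 z + abs2 w.
Proof.
rewrite ler_norml /rdot /abs2; apply/andP; split; rewrite -subr_ge0.
  have -> : complex.Re z * complex.Re w + complex.Im z * complex.Im w
    - - (complex.Re z ^+ 2 + complex.Im z ^+ 2 + (complex.Re w ^+ 2 + complex.Im w ^+ 2))
    = 2^-1 * ((complex.Re z + complex.Re w) ^+ 2 + (complex.Im z + complex.Im w) ^+ 2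
      + (complex.Re z ^+ 2 + complex.Im z ^+ 2 + (complex.Re w ^+ 2 + complex.Im w ^+ 2))).
    by field.
  by rewrite mulr_ge0 ?invr_ge0// !addr_ge0 ?sqr_ge0.
have -> : complex.Re z ^+ 2 + complex.Im z ^+ 2 + (complex.Re w ^+ 2 + complex.Im w ^+ 2)
    - (complex.Re z * complex.Re w + complex.Im z * complex.Im w)
    = 2^-1 * ((complex.Re z - complex.Re w) ^+ 2 + (complex.Im z - complex.Im w) ^+ 2
      + (complex.Re z ^+ 2 + complex.Im z ^+ 2 + (complex.Re w ^+ 2 + complex.Im w ^+ 2))).
  by field.
by rewrite mulr_ge0 ?invr_ge0// !addr_ge0 ?sqr_ge0.
Qed.

End complex_numbers.

Section L2calculus.
Context d (T : measurableType d) {R : realType} (mu : {measure set T -> \bar R}).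
Implicit Types f g h : T -> R[i].

(** The squared norm in the extended reals, available for measurable functions of
    infinite norm as well. *)
Definition N2 f : \bar R := (\int[mu]_x (abs2 (f x))%:E)%E.
(** The real part of the inner product; its imaginary part is recovered by
    multiplying one argument by the imaginary unit, see [L2dotE]. *)
Definition sdot f g : R := \int[mu]_x rdot (f x) (g x).

Definition cmeasurable f :=
  measurable_fun setT (fun x => complex.Re (f x)) /\
  measurable_fun setT (fun x => complex.Im (f x)).

Lemma N2_ge0 f : (0 <= N2 f)%E.
Proof. by apply: integral_ge0 => x _; rewrite lee_fin abs2_ge0. Qed.

Lemma L2enorm_ge0 f : (0 <= L2enorm mu f)%E.
Proof. exact: Lnorm_ge0. Qed.

Lemma L2enorm_sqr f : (L2enorm mu f * L2enorm mu f = N2 f)%E.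
Proof.
have := @poweR_Lnorm _ T R mu (fun x => (ComplexField.Normc.normc (f x))%:E) 2.
have t0 : (2 : R) != 0 by [].
move=> /(_ t0).
have -> : (\int[mu]_x `|(ComplexField.Normc.normc (f x))%:E| `^ 2 = N2 f)%E.
  apply: eq_integral => x _; rewrite abse_EFin poweR_EFin powR_mulrn//.
  by rewrite abs2_normc real_normK ?num_real.
move=> <-; rewrite -/(L2enorm mu f).
have := L2enorm_ge0 f; case: (L2enorm mu f) => [r| |] // r0.
  by rewrite poweR_EFin powR_mulrn// expr2.
by rewrite poweRyr// mulyy.
Qed.

Lemma inL2P f : inL2 mu f <-> cmeasurable f /\ (N2 f < +oo)%E.
Proof.
rewrite -L2enorm_sqr; split.
  move=> [m1 m2 fi]; split => //; have := L2enorm_ge0 f.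
  by case: (L2enorm mu f) fi => // r _ r0; rewrite -EFinM ltry.
move=> [[m1 m2] fi]; split => //; have := L2enorm_ge0 f.
by case: (L2enorm mu f) fi => // r _ r0; rewrite ltry.
Qed.

Lemma inL2_fin f : inL2 mu f -> (N2 f = (L2norm mu f ^+ 2)%:E)%E.
Proof.
move=> [_ _ fi]; rewrite -L2enorm_sqr /L2norm; have := L2enorm_ge0 f.
by case: (L2enorm mu f) fi => //= r _ r0; rewrite expr2.
Qed.

Lemma L2norm_ge0 f : 0 <= L2norm mu f.
Proof. by rewrite fine_ge0// L2enorm_ge0. Qed.

Lemma measurable_abs2 f : cmeasurable f -> measurable_fun setT (fun x => abs2 (f x)).
Proof. by move=> [? ?]; apply: measurable_funD; exact: measurable_funX. Qed.

Lemma measurable_rdot f g : cmeasurable f -> cmeasurable g ->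
  measurable_fun setT (fun x => rdot (f x) (g x)).
Proof. by move=> [? ?] [? ?]; apply: measurable_funD; exact: measurable_funM. Qed.

Lemma cmeasurableD f g : cmeasurable f -> cmeasurable g ->
  cmeasurable (fun x => f x + g x).
Proof.
move=> [f1 f2] [g1 g2]; split.
  by under eq_fun do rewrite cReD; exact: measurable_funD.
by under eq_fun do rewrite cImD; exact: measurable_funD.
Qed.

Lemma cmeasurableZ c f : cmeasurable f -> cmeasurable (fun x => c * f x).
Proof.
move=> [f1 f2]; split.
  by under eq_fun do rewrite cReM; apply: measurable_funB; exact: measurable_funM.
by under eq_fun do rewrite cImM; apply: measurable_funD; exact: measurable_funM.
Qed.

Lemma N2Z c f : cmeasurable f -> (N2 (fun x => (c * f x)%R) = (abs2 c)%:E * N2 f)%E.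
Proof.
move=> mf; rewrite /N2; under eq_integral do rewrite abs2M EFinM.
rewrite ge0_integralZl//.
- exact/measurable_EFinP/measurable_abs2.
- by move=> x _; rewrite lee_fin abs2_ge0.
- by rewrite lee_fin abs2_ge0.
Qed.

Lemma N2D_le (e : R) f g : 0 < e -> cmeasurable f -> cmeasurable g ->
  (N2 (fun x => (f x + g x)%R) <= (1 + e)%:E * N2 f + (1 + e^-1)%:E * N2 g)%E.
Proof.
move=> e0 mf mg; have mfg := cmeasurableD mf mg.
have e1 : 0 <= 1 + e by rewrite addr_ge0// ltW.
have e2 : 0 <= 1 + e^-1 by rewrite addr_ge0// invr_ge0 ltW.
have m1 := measurable_abs2 mf; have m2 := measurable_abs2 mg.
rewrite /N2 -!ge0_integralZl//; try exact/measurable_EFinP; try by move=> x _; rewrite lee_fin abs2_ge0.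
rewrite -ge0_integralD//.
- apply: ge0_le_integral => //.
  + by move=> x _; rewrite lee_fin abs2_ge0.
  + exact/measurable_EFinP/measurable_abs2.
  + by apply/measurable_EFinP; apply: measurable_funD; exact: measurable_funM.
  + by move=> x _; rewrite lee_fin abs2D_le.
- by move=> x _; rewrite lee_fin mulr_ge0// abs2_ge0.
- by apply/measurable_EFinP; exact: measurable_funM.
- by move=> x _; rewrite lee_fin mulr_ge0// abs2_ge0.
- by apply/measurable_EFinP; exact: measurable_funM.
Qed.

Lemma inL2D f g : inL2 mu f -> inL2 mu g -> inL2 mu (fun x => f x + g x).
Proof.
move=> /inL2P[mf fi] /inL2P[mg gi]; apply/inL2P; split; first exact: cmeasurableD.
apply: le_lt_trans (N2D_le ltr01 mf mg) _.
have := N2_ge0 f; have := N2_ge0 g.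
by case: (N2 f) fi => // a _; case: (N2 g) gi => // b _ _ _; rewrite -!EFinM -EFinD ltry.
Qed.

Lemma inL2Z c f : inL2 mu f -> inL2 mu (fun x => c * f x).
Proof.
move=> /inL2P[mf fi]; apply/inL2P; split; first exact: cmeasurableZ.
rewrite N2Z//; have := N2_ge0 f.
by case: (N2 f) fi => // a _ _; rewrite -!EFinM ltry.
Qed.

Lemma inL2B f g : inL2 mu f -> inL2 mu g -> inL2 mu (fun x => f x - g x).
Proof.
move=> fi gi; rewrite (_ : (fun x => _) = (fun x => f x + (-1) * g x)).
  by apply: inL2D => //; exact: inL2Z.
by apply/funext => x; rewrite mulN1r.
Qed.

Lemma integrable_rdot f g : inL2 mu f -> inL2 mu g ->
  mu.-integrable setT (fun x => (rdot (f x) (g x))%:E).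
Proof.
move=> /inL2P[mf fi] /inL2P[mg gi].
have h k : cmeasurable k -> (N2 k < +oo)%E -> mu.-integrable setT (fun x => (abs2 (k x))%:E).
  move=> mk ki; apply/integrableP; split; first exact/measurable_EFinP/measurable_abs2.
  apply: le_lt_trans ki; rewrite le_eqVlt; apply/orP; left; apply/eqP.
  by apply: eq_integral => x _; rewrite gee0_abs// lee_fin abs2_ge0.
apply: le_integrable (integrableRD measurableT (h _ mf fi) (h _ mg gi)) => //.
  exact/measurable_EFinP/measurable_rdot.
move=> x _; rewrite lee_fin; apply: le_trans (rdot_le _ _) (ler_norm _).
Qed.

Lemma sdotC f g : sdot f g = sdot g f.
Proof. by apply: eq_Rintegral => x _; rewrite rdotC. Qed.

Lemma sdotDl f g h : inL2 mu f -> inL2 mu g -> inL2 mu h ->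
  sdot (fun x => f x + g x) h = sdot f h + sdot g h.
Proof.
move=> fi gi hi.
rewrite /sdot -(RintegralD measurableT (integrable_rdot fi hi) (integrable_rdot gi hi)).
by apply: eq_Rintegral => x _; rewrite /rdot !reimE; ring.
Qed.

Lemma sdotZl (c : R) f h : inL2 mu f -> inL2 mu h ->
  sdot (fun x => c%:C * f x) h = c * sdot f h.
Proof.
move=> fi hi; rewrite /sdot -(RintegralZl c measurableT (integrable_rdot fi hi)).
by apply: eq_Rintegral => x _; rewrite /rdot !reimE /=; ring.
Qed.

Lemma sdotBl f g h : inL2 mu f -> inL2 mu g -> inL2 mu h ->
  sdot (fun x => f x - g x) h = sdot f h - sdot g h.
Proof.
move=> fi gi hi.
rewrite /sdot -(RintegralB measurableT (integrable_rdot fi hi) (integrable_rdot gi hi)).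
by apply: eq_Rintegral => x _; rewrite /rdot !reimE; ring.
Qed.

Lemma sdotBr f g h : inL2 mu f -> inL2 mu g -> inL2 mu h ->
  sdot h (fun x => f x - g x) = sdot h f - sdot h g.
Proof. by move=> *; rewrite sdotC sdotBl// !(sdotC h). Qed.

Lemma sdotff f : inL2 mu f -> sdot f f = L2norm mu f ^+ 2.
Proof.
move=> fi; rewrite /sdot; under eq_Rintegral do rewrite rdotzz.
by rewrite /Rintegral -/(N2 f) inL2_fin.
Qed.

(** Nonpositive discriminant of the quadratic [t |-> norm of f - t g, squared]. *)
Lemma sdot_CS f g : inL2 mu f -> inL2 mu g ->
  `|sdot f g| <= L2norm mu f * L2norm mu g.
Proof.
move=> fi gi.
have quad (t : R) : 0 <= L2norm mu f ^+ 2 - 2 * t * sdot f g + t ^+ 2 * L2norm mu g ^+ 2.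
  have tg := inL2Z t%:C gi; have h := inL2B fi tg.
  have := sqr_ge0 (L2norm mu (fun x => f x - t%:C * g x)).
  rewrite -(sdotff h) sdotBl// !sdotBr// !sdotZl// (sdotC f) sdotZl// (sdotC _ (fun x => _ * _)).
  rewrite sdotZl// !sdotff// (sdotC g f); lra.
have a0 := L2norm_ge0 f; have b0 := L2norm_ge0 g.
rewrite -ler_sqr ?nnegrE ?mulr_ge0// real_normK ?num_real// exprMn.
set a := L2norm mu f in quad a0 *; set b := L2norm mu g in quad b0 *.
move: (sdot f g) quad => s quad.
have [b00|bN] := eqVneq b 0.
  have s0 : s = 0.
    apply/eqP/negPn/negP => sN.
    have := quad ((a ^+ 2 + 1) / (2 * s)).
    rewrite b00 expr0n mulr0 addr0.
    have -> : a ^+ 2 - 2 * ((a ^+ 2 + 1) / (2 * s)) * s = -1 by field.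
    by rewrite oppr_ge0 ler10.
  by rewrite s0 expr0n mulr_ge0 ?sqr_ge0.
have := quad (s / b ^+ 2).
have -> : a ^+ 2 - 2 * (s / b ^+ 2) * s + (s / b ^+ 2) ^+ 2 * b ^+ 2 =
  a ^+ 2 - s ^+ 2 / b ^+ 2 by field.
by rewrite subr_ge0 ler_pdivrMr// exprn_even_gt0.
Qed.

Lemma L2norm_triangle f g : inL2 mu f -> inL2 mu g ->
  L2norm mu (fun x => f x + g x) <= L2norm mu f + L2norm mu g.
Proof.
move=> fi gi; have h := inL2D fi gi.
rewrite -ler_sqr ?nnegrE ?addr_ge0 ?L2norm_ge0// -(sdotff h) sdotDl//.
rewrite (sdotC f) (sdotC g) !sdotDl// !sdotff// (sdotC g f).
have := sdot_CS fi gi; have := ler_norm (sdot f g); nra.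
Qed.

Lemma L2normZ (c : R) f : inL2 mu f ->
  L2norm mu (fun x => c%:C * f x) = `|c| * L2norm mu f.
Proof.
move=> fi; have h := inL2Z c%:C fi.
apply/eqP; rewrite -(eqrXn2 (n := 2))// ?mulr_ge0 ?L2norm_ge0//; apply/eqP.
by rewrite -(sdotff h) sdotZl// sdotC sdotZl// sdotff// exprMn real_normK ?num_real//; ring.
Qed.

Lemma L2dotE f g : L2dot mu f g = sdot f g +i* sdot f (fun x => 'i%C * g x).
Proof.
rewrite /L2dot /cintegral /sdot; congr (_ +i* _); apply: eq_Rintegral => x _.
  by rewrite /rdot !reimE; ring.
by rewrite /rdot !reimE/=; ring.
Qed.

End L2calculus.

(** * Inner products of smooth rapidly decaying families *)

Section smooth_families.
Context d (T : measurableType d) {R : realType} (mu : {measure set T -> \bar R}).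
Implicit Types (V W : nat -> R -> T -> R[i]) (f g : T -> R[i]).

Local Notation n := (L2norm mu).

(** The part of [smooth_trace] that speaks of the family alone. *)
Definition smooth_family V :=
 [/\ forall k (l : R), 0 <= l -> inL2 mu (V k l),
      forall k (l : R), 0 <= l ->
        L2enorm mu
          (fun w : T => (h^-1)%:C * (V k (l + h) w - V k l w) - V k.+1 l w)
          @[h --> within [set h : R | 0 <= l + h] 0^'] --> 0%E,
      forall k N, (l ^- N * n (V k l)) @[l --> 0^'+] --> (0 : R) &
      forall k N, (l ^+ N * n (V k l)) @[l --> +oo] --> (0 : R)].

Section one_family.
Variable V : nat -> R -> T -> R[i].
Hypothesis SV : smooth_family V.

Let inV k l : 0 <= l -> inL2 mu (V k l).
Proof. by case: SV => h _ _ _; exact: h. Qed.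

Definition slope k l h := fun w : T => (h^-1)%:C * (V k (l + h) w - V k l w).
Definition slope_error k l h := n (fun w => slope k l h w - V k.+1 l w).

Let in_slope k l h : 0 <= l -> 0 <= l + h -> inL2 mu (slope k l h).
Proof. by move=> l0 lh; apply: inL2Z; apply: inL2B; exact: inV. Qed.

Lemma cvg_slope_error k l : 0 <= l ->
  slope_error k l h @[h --> within [set h : R | 0 <= l + h] 0^'] --> 0.
Proof. by move=> l0; case: SV => _ h _ _; apply: fine_cvg; exact: h. Qed.

(** [slope_error] measures how far the difference quotient is from the derivative;
    it tends to 0 with [h]. *)
Lemma family_increment k l h : 0 <= l -> 0 <= l + h -> h != 0 ->
  n (fun w => V k (l + h) w - V k l w) <=
    `|h| * (slope_error k l h + n (V k.+1 l)).
Proof.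
move=> l0 lh h0.
have -> : (fun w => V k (l + h) w - V k l w) =
    (fun w => h%:C * ((slope k l h w - V k.+1 l w) + V k.+1 l w)).
  apply/funext => w; rewrite subrK /slope mulrA -rmorphM divff//.
  by rewrite rmorph1 mul1r.
have i1 := inL2B (in_slope k l0 lh) (inV k.+1 l0).
rewrite L2normZ; last exact: inL2D i1 (inV _ l0).
by rewrite ler_wpM2l// L2norm_triangle//; exact: inV.
Qed.

Lemma family_bound k l h : 0 <= l -> 0 <= l + h -> h != 0 ->
  n (V k (l + h)) <= n (V k l) + `|h| * (slope_error k l h + n (V k.+1 l)).
Proof.
move=> l0 lh h0; apply: le_trans (lerD (lexx _) (family_increment k l0 lh h0)).
rewrite -[X in n X](_ : (fun w => V k l w + (V k (l + h) w - V k l w)) = _).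
  by apply: L2norm_triangle; [exact: inV|apply: inL2B; exact: inV].
by apply/funext => w; rewrite addrC subrK.
Qed.

End one_family.

Lemma right_within (P : set R) (l : R) : 0 <= l ->
  within [set h : R | 0 <= l + h] 0^' P -> 0^'+ P.
Proof.
move=> l0; apply: (@filterS _ (nbhs (0:R))) => h H h0.
by apply: H; [rewrite gt_eqF|rewrite /= addr_ge0// ltW].
Qed.

Lemma dnbhs_ge (l : R) : 0 < l -> \forall h \near (0 : R)^', 0 <= l + h.
Proof.
move=> l0.
have hn : \forall h \near (0 : R), 0 <= l + h.
  have : {for 0, continuous (fun h : R => l + h)}.
    by apply: cvgD; [exact: cvg_cst|exact: cvg_id].
  by move=> /cvgr_ge; apply; rewrite addr0.
by apply: (@filterS _ (nbhs (0 : R)) _ _ _ _ hn) => h H _.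
Qed.

Lemma dnbhs_within (P : set R) (l : R) : 0 < l ->
  within [set h : R | 0 <= l + h] 0^' P -> 0^' P.
Proof.
move=> l0 H.
have h0 := dnbhs_ge l0.
by near=> h; have : 0 <= l + h -> P h; [near: h; exact: H|apply; near: h].
Unshelve. all: end_near. Qed.

(** The decay condition at 0 only concerns l -> 0+; strong continuity at 0 carries
    it to the value at 0. *)
Lemma smooth_family0 V : smooth_family V -> forall k, n (V k 0) = 0.
Proof.
move=> SV k; have [iV _ d0 _] := SV.
apply/eqP; rewrite eq_le L2norm_ge0 andbT.
have c1 : n (V k h) @[h --> 0^'+] --> (0 : R).
  by have := d0 k 0%N; under eq_fun do rewrite expr0 invr1 mul1r.
have c2 : slope_error V k 0 h @[h --> 0^'+] --> (0 : R).
  have := cvg_slope_error SV k (lexx 0); apply: cvg_trans.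
  by apply: cvg_app => P; exact: right_within.
have c3 : `|h| @[h --> (0 : R)^'+] --> (0 : R).
  rewrite -[X in _ --> X](normr0 R); apply: cvg_norm.
  exact: cvg_at_right_filter.
have c4 : n (V k h) + `|h| * (slope_error V k 0 h + n (V k.+1 0)) @[h --> 0^'+]
    --> (0 + 0 * (0 + n (V k.+1 0)) : R).
  by apply: cvgD => //; apply: cvgM => //; apply: cvgD => //; exact: cvg_cst.
rewrite mul0r addr0 in c4.
apply: (cvgr_to_ge c4); near=> h.
have h0 : 0 < h by near: h; exact: nbhs_right_gt.
have h1 := family_increment SV k (lexx 0) (_ : 0 <= 0 + h) (lt0r_neq0 h0).
rewrite add0r in h1.
rewrite -[X in n X <= _](_ : (fun w => V k h w + (-1)%:C * (V k h w - V k 0 w)) = _).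
  apply: le_trans (L2norm_triangle _ _) _.
  - by apply: iV; exact: ltW.
  - by apply: inL2Z; apply: inL2B; apply: iV => //; exact: ltW.
  rewrite L2normZ ?normrN1 ?mul1r ?lerD2l ?h1 ?ltW//.
  by apply: inL2B; apply: iV => //; exact: ltW.
apply/funext => w; rewrite rmorphN rmorph1 mulN1r opprB addrC subrK//.
Unshelve. all: end_near. Qed.

(** Taking the extension by 0 as part of the definition, with both orders of
    differentiation as parameters, makes the class of these functions stable under
    differentiation by Leibniz' rule. *)
Definition ext_dot V W (j k : nat) (l : R) : R :=
  if 0 <= l then sdot mu (V j l) (W k l) else 0.

Lemma is_derive_cvg (f : R -> R) x v :
  h^-1 * (f (h + x) - f x) @[h --> 0^'] --> v -> is_derive x 1 f v.
Proof.
move=> h.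
have h' : h^-1 *: ((f \o shift x) (h *: (1 : R)) - f x) @[h --> 0^'] --> v.
  by under eq_fun do rewrite /= [_%:A]mulr1.
by apply: DeriveDef; [apply/cvg_ex; exists v|exact/cvg_lim].
Qed.

Section two_families.
Variables V W : nat -> R -> T -> R[i].
Hypotheses (SV : smooth_family V) (SW : smooth_family W).

Let inV k l : 0 <= l -> inL2 mu (V k l).
Proof. by case: SV => h _ _ _; exact: h. Qed.
Let inW k l : 0 <= l -> inL2 mu (W k l).
Proof. by case: SW => h _ _ _; exact: h. Qed.

Let sdotV0 j k f : inL2 mu f -> sdot mu (V j 0) f = 0 /\ sdot mu f (W k 0) = 0.
Proof.
move=> fi; have h1 := sdot_CS (inV j (lexx 0)) fi.
have h2 := sdot_CS fi (inW k (lexx 0)).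
rewrite (smooth_family0 SV) mul0r normr_le0 in h1.
rewrite (smooth_family0 SW) mulr0 normr_le0 in h2.
by split; exact/eqP.
Qed.

Lemma ext_dot_le0 j k l : l <= 0 -> ext_dot V W j k l = 0.
Proof.
rewrite /ext_dot le_eqVlt => /predU1P[->|l0]; last by rewrite leNgt l0.
by rewrite lexx; apply: (sdotV0 j k _).1; exact: inW.
Qed.

Lemma ext_dot_bound j k l : `|ext_dot V W j k l| <= n (V j l) * n (W k l).
Proof.
rewrite /ext_dot; case: ifPn => [l0|_]; first by rewrite sdot_CS//; [exact: inV|exact: inW].
by rewrite normr0 mulr_ge0 ?L2norm_ge0.
Qed.

(** At l > 0 this is Leibniz' rule, with an explicit error term; at l = 0 both
    one-sided difference quotients tend to 0 by flatness of the families. *)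
Lemma is_derive_ext_dot j k (l : R) : is_derive l 1 (ext_dot V W j k)
  (ext_dot V W j.+1 k l + ext_dot V W j k.+1 l).
Proof.
have [l0|l0|->] := ltgtP l 0.
- rewrite !ext_dot_le0 ?ltW// addr0.
  have c0 : is_derive l 1 (cst 0 : R -> R) (0 : R) by exact: is_derive_cst.
  have nl : \forall x \near l, (cst 0 : R -> R) x = ext_dot V W j k x.
    near=> x; rewrite ext_dot_le0//; near: x.
    by apply: (cvgr_le l) => //; exact: cvg_id.
  exact: (near_eq_is_derive nl c0).
- apply: is_derive_cvg.
  have a0 : slope_error V j l h @[h --> 0^'] --> (0 : R).
    apply: cvg_trans (cvg_slope_error SV j (ltW l0)).
    by apply: cvg_app => P; exact: dnbhs_within.
  have c0 : slope_error W k l h @[h --> 0^'] --> (0 : R).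
    apply: cvg_trans (cvg_slope_error SW k (ltW l0)).
    by apply: cvg_app => P; exact: dnbhs_within.
  have h0 : `|h| @[h --> (0 : R)^'] --> (0 : R).
    rewrite -[X in _ --> X](normr0 R); apply: cvg_norm.
    exact: cvg_within.
  pose b h := slope_error V j l h * (n (W k l) + `|h| * (slope_error W k l h + n (W k.+1 l)))
    + n (V j.+1 l) * (`|h| * (slope_error W k l h + n (W k.+1 l)))
    + n (V j l) * slope_error W k l h.
  have b0 : b h @[h --> 0^'] --> (0 : R).
    have : b h @[h --> 0^'] --> (0 * (n (W k l) + 0 * (0 + n (W k.+1 l)))
      + n (V j.+1 l) * (0 * (0 + n (W k.+1 l))) + n (V j l) * 0).
      have c1 : `|h| * (slope_error W k l h + n (W k.+1 l)) @[h --> 0^']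
          --> (0 * (0 + n (W k.+1 l)) : R) by apply: cvgM => //; apply: cvgD => //; exact: cvg_cst.
      apply: cvgD; first apply: cvgD.
      + by apply: cvgM => //; apply: cvgD => //; exact: cvg_cst.
      + by apply: cvgM => //; exact: cvg_cst.
      + by apply: cvgM => //; exact: cvg_cst.
    by rewrite !mul0r !mulr0 !addr0.
  apply/cvgrPdist_le => e e0; near=> h.
  have hN0 : h != 0 by near: h; exact: nbhs_dnbhs_neq.
  have lh : 0 <= l + h.
    by near: h; exact: dnbhs_ge.
  have Vl := inV j (ltW l0); have Wl := inW k (ltW l0).
  have Vlh := inV j lh; have Wlh := inW k lh.
  have V'l := inV j.+1 (ltW l0); have W'l := inW k.+1 (ltW l0).
  have sV : inL2 mu (slope V j l h) by apply: inL2Z; exact: inL2B.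
  have sW : inL2 mu (slope W k l h) by apply: inL2Z; exact: inL2B.
  have quot : h^-1 * (ext_dot V W j k (h + l) - ext_dot V W j k l) =
      sdot mu (slope V j l h) (W k (l + h)) + sdot mu (V j l) (slope W k l h).
    rewrite /ext_dot (addrC h l) lh (ltW l0) /slope sdotZl//; last exact: inL2B.
    rewrite (sdotC mu (V j l) (fun w => _ * _)) sdotZl//; last exact: inL2B.
    rewrite !sdotBl// (sdotC mu (W k (l + h)) (V j l)) (sdotC mu (W k l)).
    by ring.
  have diff : ext_dot V W j.+1 k l + ext_dot V W j k.+1 l
      - h^-1 * (ext_dot V W j k (h + l) - ext_dot V W j k l) =
      - (sdot mu (fun w => slope V j l h w - V j.+1 l w) (W k (l + h))
        + sdot mu (V j.+1 l) (fun w => W k (l + h) w - W k l w)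
        + sdot mu (V j l) (fun w => slope W k l h w - W k.+1 l w)).
    by rewrite quot /ext_dot (ltW l0) sdotBl// !sdotBr//; ring.
  rewrite diff normrN.
  apply: (@le_trans _ _ (b h)); last first.
    apply: le_trans (ler_norm _) _.
    near: h; move: e e0; exact/cvgr0Pnorm_le.
  apply: le_trans (ler_normD _ _) _; apply: lerD; last first.
    by rewrite sdot_CS//; exact: inL2B.
  apply: le_trans (ler_normD _ _) _; apply: lerD.
    apply: le_trans (sdot_CS _ _) _ => //; first exact: inL2B.
    by rewrite ler_wpM2l ?L2norm_ge0// family_bound// ltW.
  apply: le_trans (sdot_CS _ _) _ => //; first exact: inL2B.
  by rewrite ler_wpM2l ?L2norm_ge0// family_increment// ltW.
- rewrite !ext_dot_le0// addr0; apply: is_derive_cvg.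
  have -> : (fun h => h^-1 * (ext_dot V W j k (h + 0) - ext_dot V W j k 0)) =
      (fun h => h^-1 * ext_dot V W j k h).
    by apply/funext => h; rewrite (ext_dot_le0 j k (lexx 0)) subr0 addr0.
  have [_ _ dV _] := SV; have [_ _ dW _] := SW.
  have b0 : (h ^- 1 * n (V j h)) * (h ^- 0 * n (W k h)) @[h --> 0^'+] --> (0 * 0 : R).
    by apply: cvgM; [exact: dV|exact: dW].
  rewrite mul0r in b0; apply/cvgr0Pnorm_le => e e0.
  suff P1 : \forall h \near 0^'+, `|h^-1 * ext_dot V W j k h| <= e.
    apply: (@filterS _ (nbhs (0 : R)) _ _ _ _ P1) => h H _.
    have [/H//|h0] := ltP 0 h.
    by rewrite ext_dot_le0// mulr0 normr0 ltW.
  near=> h.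
  have h0 : 0 < h by near: h; exact: nbhs_right_gt.
  apply: (@le_trans _ _ ((h ^- 1 * n (V j h)) * (h ^- 0 * n (W k h)))).
    rewrite expr0 invr1 mul1r expr1 -mulrA normrM gtr0_norm ?invr_gt0//.
    by rewrite ler_wpM2l ?ext_dot_bound// invr_ge0 ltW.
  apply: le_trans (ler_norm _) _; near: h.
  by move: e e0; exact/cvgr0Pnorm_le.
Unshelve. all: end_near. Qed.

Lemma decaying_ext_dot j k : decaying (ext_dot V W j k).
Proof.
have [_ _ _ yV] := SV; have [_ _ _ yW] := SW.
have b0 : (l ^+ 1 * n (V j l)) * (l ^+ 0 * n (W k l)) @[l --> +oo] --> (0 * 0 : R).
  by apply: cvgM; [exact: yV|exact: yW].
rewrite mul0r in b0.
have : \forall l \near +oo, (1 + `|l|) * `|ext_dot V W j k l| <= 2.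
  near=> l; have l1 : 1 <= l by near: l; exact: nbhs_pinfty_ge.
  apply: (@le_trans _ _ (2 * ((l ^+ 1 * n (V j l)) * (l ^+ 0 * n (W k l))))).
    rewrite expr0 expr1 mul1r -mulrA mulrA ler_pM ?addr_ge0 ?ext_dot_bound//.
    rewrite ger0_norm; last exact: le_trans l1; lra.
  rewrite -[leRHS]mulr1 ler_wpM2l//; apply: le_trans (ler_norm _) _.
  by near: l; move: (@ltr01 R); move: (1 : R); exact/cvgr0Pnorm_le.
move=> [A [_ AP]].
pose B := Num.max 0 A + 1.
have cE : continuous (ext_dot V W j k).
  by move=> l; exact: is_derive_continuous (is_derive_ext_dot j k l).
have cF : continuous (fun l => (1 + `|l|) * `|ext_dot V W j k l|).
  move=> l; apply: cvgM; last by apply: cvg_norm; exact: cE.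
  by apply: cvgD; [exact: cvg_cst|exact: norm_continuous].
have B0 : 0 <= B by rewrite /B addr_ge0// le_max lexx.
have [c _ cM] := EVT_max B0 (continuous_subspaceT cF).
exists (2 + (1 + `|c|) * `|ext_dot V W j k c|) => l.
have h2 : 0 <= (1 + `|c|) * `|ext_dot V W j k c| by rewrite mulr_ge0// addr_ge0.
have [lA|lA] := ltP A l; first by apply: le_trans (AP _ lA) _; rewrite lerDl.
have [l0|l0] := leP l 0.
  by rewrite ext_dot_le0// normr0 mulr0 addr_ge0.
apply: le_trans (cM l _) _; last by rewrite lerDr.
rewrite in_itv/= (ltW l0)/= /B (le_trans lA)// (@le_trans _ _ (Num.max 0 A))//.
  by rewrite le_max lexx orbT.
by rewrite lerDl.
Unshelve. all: end_near. Qed.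

Lemma Schwartz_ext_dot j k : Schwartz (ext_dot V W j k).
Proof.
move=> m; elim: m j k => [|m IH] j k; split; try exact: decaying_ext_dot.
  by move=> l; exact: is_derive_continuous (is_derive_ext_dot j k l).
exists (fun l => ext_dot V W j.+1 k l + ext_dot V W j k.+1 l).
  by move=> l; exact: is_derive_ext_dot.
exact: SchD.
Qed.

End two_families.
End smooth_families.

(** * Integration over products *)

Section products.
Context d1 d2 (X : measurableType d1) (Y : measurableType d2) {R : realType}.
Variables (m1 : {sigma_finite_measure set X -> \bar R}).
Variables (m2 : {sigma_finite_measure set Y -> \bar R}).

Lemma Rintegral_prod (f : X * Y -> R) : (m1 \x m2)%E.-integrable setT (EFin \o f) ->
  \int[(m1 \x m2)%E]_p f p = \int[m1]_x \int[m2]_y f (x, y).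
Proof.
move=> fi; rewrite {1}/Rintegral -integral12_prod_meas1// /Rintegral.
congr fine; apply: ae_eq_integral => //.
- exact: (measurable_fubini_F fi).
- apply/measurable_EFinP; apply: (measurableT_comp (fine_measurable measurableT)).
  exact: (measurable_fubini_F fi).
- have := ae_integrable1 fi; apply: filterS => x fx _.
  by rewrite fineK//; exact: integrable_fin_num.
Qed.

Lemma Rintegral_prod_swap (f : X * Y -> R) : (m1 \x m2)%E.-integrable setT (EFin \o f) ->
  \int[(m1 \x m2)%E]_p f p = \int[m2]_y \int[m1]_x f (x, y).
Proof.
move=> fi; rewrite {1}/Rintegral -integral21_prod_meas1// /Rintegral.
congr fine; apply: ae_eq_integral => //.
- exact: (measurable_fubini_G fi).
- apply/measurable_EFinP; apply: (measurableT_comp (fine_measurable measurableT)).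
  exact: (measurable_fubini_G fi).
- have := ae_integrable2 fi; apply: filterS => x fx _.
  by rewrite fineK//; exact: integrable_fin_num.
Qed.

Lemma integrable_prod (f : X -> R) (g : Y -> R) :
  m1.-integrable setT (EFin \o f) -> m2.-integrable setT (EFin \o g) ->
  (m1 \x m2)%E.-integrable setT (fun p => (f p.1 * g p.2)%:E).
Proof.
move=> fi gi; have /integrableP[/measurable_EFinP mf ff] := fi.
have /integrableP[/measurable_EFinP mg gg] := gi.
have mfg : measurable_fun setT (fun p : X * Y => f p.1 * g p.2).
  apply: measurable_funM; first exact: (measurableT_comp mf measurable_fst).
  exact: (measurableT_comp mg measurable_snd).
apply/integrable12ltyP; first exact/measurable_EFinP.
have mnf : measurable_fun setT (fun x => `|f x|) by exact: measurableT_comp.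
have mng : measurable_fun setT (fun y => `|g y|) by exact: measurableT_comp.
have E x : (\int[m2]_y `|(f x * g y)%:E| = `|f x|%:E * \int[m2]_y `|g y|%:E)%E.
  under eq_integral => y _ do rewrite /= normrM EFinM.
  by rewrite ge0_integralZl//; exact/measurable_EFinP.
under eq_integral => x _ do rewrite E.
rewrite ge0_integralZr//.
- by rewrite lte_mul_pinfty ?integral_ge0// ge0_fin_numE ?integral_ge0.
- exact/measurable_EFinP.
- exact: integral_ge0.
Qed.

Lemma Rintegral_prodM (f : X -> R) (g : Y -> R) :
  m1.-integrable setT (EFin \o f) -> m2.-integrable setT (EFin \o g) ->
  \int[(m1 \x m2)%E]_p (f p.1 * g p.2) = (\int[m1]_x f x) * (\int[m2]_y g y).
Proof.
move=> fi gi; rewrite Rintegral_prod; last exact: integrable_prod.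
transitivity (\int[m1]_x (f x * \int[m2]_y g y)); last by rewrite RintegralZr.
by apply: eq_Rintegral => x _ /=; rewrite RintegralZl.
Qed.

(** Changes of variables multiply over products, by Tonelli's theorem. *)
Lemma transport_prod (phi : X -> X) (psi : Y -> Y) (a b : R) :
  measurable_fun setT phi -> measurable_fun setT psi -> 0 <= b ->
  (forall f : X -> \bar R, measurable_fun setT f -> (forall x, 0 <= f x)%E ->
    (\int[m1]_x f (phi x) = a%:E * \int[m1]_x f x)%E) ->
  (forall f : Y -> \bar R, measurable_fun setT f -> (forall x, 0 <= f x)%E ->
    (\int[m2]_x f (psi x) = b%:E * \int[m2]_x f x)%E) ->
  forall f : X * Y -> \bar R, measurable_fun setT f -> (forall x, 0 <= f x)%E ->
    (\int[m1 \x m2]_p f (phi p.1, psi p.2) = (a * b)%:E * \int[m1 \x m2]_p f p)%E.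
Proof.
move=> mphi mpsi b0 H1 H2 f mf f0.
have mc : measurable_fun setT (fun p : X * Y => f (phi p.1, psi p.2)).
  apply: (measurableT_comp mf); apply: measurable_fun_pair.
    exact: (measurableT_comp mphi measurable_fst).
  exact: (measurableT_comp mpsi measurable_snd).
rewrite fubini_tonelli1// [in RHS]fubini_tonelli1//.
have E x : (\int[m2]_y f (phi x, psi y) = b%:E * \int[m2]_y f (phi x, y))%E.
  by rewrite (H2 (fun y => f (phi x, y)))//; exact: measurableT_comp.
have mF : measurable_fun setT (fubini_F m2 f).
  exact: measurable_fun_fubini_tonelli_F.
have F0 x : (0 <= fubini_F m2 f x)%E by exact: integral_ge0.
transitivity (\int[m1]_x (b%:E * fubini_F m2 f (phi x)))%E.
  by apply: eq_integral => x _; exact: E.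
rewrite ge0_integralZl//; last exact: (measurableT_comp mF).
by rewrite (H1 (fubini_F m2 f))// muleA -EFinM (mulrC b).
Qed.

(** Including the phase [A] in the hypotheses makes the addition formula for cosine
    unnecessary: the inner integral is again of the form required of the outer one. *)
Lemma cos_transform_prod (E1 c1 : X -> R) (E2 c2 : Y -> R) (k1 k2 : R) :
  m1.-integrable setT (EFin \o E1) -> m2.-integrable setT (EFin \o E2) ->
  measurable_fun setT c1 -> measurable_fun setT c2 ->
  (forall A, \int[m1]_x (E1 x * cos (A + c1 x)) = cos A * k1) ->
  (forall A, \int[m2]_x (E2 x * cos (A + c2 x)) = cos A * k2) ->
  forall A, \int[(m1 \x m2)%E]_p (E1 p.1 * E2 p.2 * cos (A + (c1 p.1 + c2 p.2)))
    = cos A * (k1 * k2).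
Proof.
move=> i1 i2 mc1 mc2 H1 H2 A.
have /integrableP[/measurable_EFinP mE1 _] := i1.
have /integrableP[/measurable_EFinP mE2 _] := i2.
have mcos : measurable_fun setT (@cos R) by apply: continuous_measurable_fun; exact: continuous_cos.
have ii : (m1 \x m2)%E.-integrable setT
    (EFin \o (fun p => E1 p.1 * E2 p.2 * cos (A + (c1 p.1 + c2 p.2)))).
  apply: le_integrable (integrable_prod i1 i2) => //.
    apply/measurable_EFinP; apply: measurable_funM.
      apply: measurable_funM; first exact: (measurableT_comp mE1 measurable_fst).
      exact: (measurableT_comp mE2 measurable_snd).
    apply: (measurableT_comp mcos); apply: measurable_funD => //.
    apply: measurable_funD; first exact: (measurableT_comp mc1 measurable_fst).
    exact: (measurableT_comp mc2 measurable_snd).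
  move=> p _; rewrite lee_fin normrM ler_piMr// ler_norml cos_geN1//= cos_le1.
rewrite Rintegral_prod//.
have E x : \int[m2]_y (E1 x * E2 y * cos (A + (c1 x + c2 y))) =
    E1 x * cos (A + c1 x) * k2.
  rewrite -mulrA -H2 -RintegralZl//.
    by apply: eq_Rintegral => y _; rewrite mulrA addrA.
  apply: le_integrable i2 => //.
    apply/measurable_EFinP; apply: measurable_funM => //.
    by apply: (measurableT_comp mcos); exact: measurable_funD.
  by move=> y _; rewrite lee_fin normrM ler_piMr// ler_norml cos_geN1/= cos_le1.
under eq_Rintegral do rewrite E.
rewrite RintegralZr//; first by rewrite H1 mulrA.
apply: le_integrable i1 => //.
  apply/measurable_EFinP; apply: measurable_funM => //.
  by apply: (measurableT_comp mcos); exact: measurable_funD.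
by move=> y _; rewrite lee_fin normrM ler_piMr// ler_norml cos_geN1/= cos_le1.
Qed.

Lemma sigma_finite_prod : sigma_finite setT (m1 \x m2)%E.
Proof.
by case: (lebesgue_integral_fubini.measure_function_Measure_isSigmaFinite__to__measure_function_isSigmaFinite m1 m2).
Qed.

(** The product measure under a name of its own that carries its sigma-finite
    structure, so that products can be iterated. *)
Definition sprod : set (X * Y)%type -> \bar R := (m1 \x m2)%E.
HB.instance Definition _ := Measure.on sprod.
HB.instance Definition _ :=
  Measure_isSigmaFinite.Build _ _ _ sprod sigma_finite_prod.

End products.

(** * Plancherel's formula by Abel summation *)

Section plancherel.
Context d (X : measurableType d) {R : realType}.
Variable m : {sigma_finite_measure set X -> \bar R}.
Variables (dot : X -> X -> R) (E : nat -> X -> R) (K : nat -> X * X -> R).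
Variables (k : X -> R) (add : nat -> X * X -> X) (a b : X -> R) (M : R).
Hypothesis mdot : measurable_fun setT (fun p : X * X => dot p.1 p.2).
Hypothesis E_gt0 : forall n x, 0 < E n x.
Hypothesis iE : forall n, m.-integrable setT (EFin \o E n).
Hypothesis E_nd : forall x, {homo (E ^~ x) : i j / (i <= j)%N >-> i <= j}.
Hypothesis E_cvg : forall x, E n x @[n --> \oo] --> (1 : R).
Hypothesis EK : forall n x y A,
  \int[m]_xi (E n xi * cos (A + (dot xi x - dot xi y))) = cos A * K n (x, y).
Hypothesis mK : forall n, measurable_fun setT (K n).
Hypothesis k_ge0 : forall x, 0 <= k x.
Hypothesis ik : m.-integrable setT (EFin \o k).
Hypothesis madd : forall n, measurable_fun setT (add n).
Hypothesis Kadd : forall n x (h : X -> R), m.-integrable setT (EFin \o h) ->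
  \int[m]_y (h y * K n (x, y)) = \int[m]_z (h (add n (x, z)) * k z).
Hypotheses (ma : measurable_fun setT a) (mb : measurable_fun setT b).
Hypotheses (ia : m.-integrable setT (EFin \o a)) (ib : m.-integrable setT (EFin \o b)).
Hypotheses (aM : forall x, `|a x| <= M) (bM : forall x, `|b x| <= M).
Hypothesis add_a : forall x z, a (add n (x, z)) @[n --> \oo] --> a x.
Hypothesis add_b : forall x z, b (add n (x, z)) @[n --> \oo] --> b x.

Let mcos : measurable_fun setT (@cos R).
Proof. by apply: continuous_measurable_fun; exact: continuous_cos. Qed.
Let msin : measurable_fun setT (@sin R).
Proof. by apply: continuous_measurable_fun; exact: continuous_sin. Qed.

Let u xi x := a x * cos (dot xi x) + b x * sin (dot xi x).
Let v xi x := b x * cos (dot xi x) - a x * sin (dot xi x).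
Let g x := `|a x| + `|b x|.

(** The real and imaginary parts of the unnormalized Fourier integral of a + i b. *)
Definition FRe xi := \int[m]_x u xi x.
Definition FIm xi := \int[m]_x v xi x.

Let mg : measurable_fun setT g.
Proof. by apply: measurable_funD; exact: measurableT_comp. Qed.

Let ig : m.-integrable setT (EFin \o g).
Proof. by apply: integrableRD => //; exact: (integrable_norm (f := _)). Qed.

Let g_ge0 x : 0 <= g x. Proof. exact: addr_ge0. Qed.

Let cos1 (x : R) : `|cos x| <= 1. Proof. by rewrite ler_norml cos_geN1 cos_le1. Qed.
Let sin1 (x : R) : `|sin x| <= 1. Proof. by rewrite ler_norml sin_geN1 sin_le1. Qed.

Let bnd1 (p x : R) : `|x| <= 1 -> `|p * x| <= `|p|.
Proof. by move=> x1; rewrite normrM ler_piMr. Qed.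

Let uP xi x : `|u xi x| <= g x.
Proof. by apply: le_trans (ler_normD _ _) _; rewrite lerD// bnd1. Qed.
Let vP xi x : `|v xi x| <= g x.
Proof. by apply: le_trans (ler_normB _ _) _; rewrite addrC lerD// bnd1. Qed.

Let mdot1 xi : measurable_fun setT (dot xi).
Proof. exact: (measurableT_comp mdot (measurable_pair1 xi)). Qed.

Let mcd xi : measurable_fun setT (fun x => cos (dot xi x)).
Proof. exact: measurableT_comp. Qed.
Let msd xi : measurable_fun setT (fun x => sin (dot xi x)).
Proof. exact: measurableT_comp. Qed.

Let iu xi : m.-integrable setT (EFin \o u xi).
Proof.
apply: le_integrable ig => //.
  by apply/measurable_EFinP; apply: measurable_funD; exact: measurable_funM.
by move=> x _; rewrite lee_fin (le_trans (uP _ _))// ler_norm.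
Qed.

Let iv xi : m.-integrable setT (EFin \o v xi).
Proof.
apply: le_integrable ig => //.
  by apply/measurable_EFinP; apply: measurable_funB; exact: measurable_funM.
by move=> x _; rewrite lee_fin (le_trans (vP _ _))// ler_norm.
Qed.

Let mfst f : measurable_fun setT f -> measurable_fun setT (fun p : X * X => f p.1 : R).
Proof. by move=> mf; exact: (measurableT_comp mf measurable_fst). Qed.
Let msnd f : measurable_fun setT f -> measurable_fun setT (fun p : X * X => f p.2 : R).
Proof. by move=> mf; exact: (measurableT_comp mf measurable_snd). Qed.

Let mE n : measurable_fun setT (E n).
Proof. by have /integrableP[/measurable_EFinP] := iE n. Qed.

(** The damped integrand is integrable over the product, so Fubini's theorem gives
    measurability of the damped transform. *)
Lemma measurable_FRe : measurable_fun setT FRe.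
Proof.
have mu2 : measurable_fun setT (fun p : X * X => u p.1 p.2).
  apply: measurable_funD; apply: measurable_funM; try exact: msnd.
    exact: measurableT_comp.
  exact: measurableT_comp.
have i2 : (m \x m)%E.-integrable setT (EFin \o (fun p : X * X => E 0%N p.1 * u p.1 p.2)).
  apply: le_integrable (integrable_prod (iE 0) ig) => //.
    by apply/measurable_EFinP; apply: measurable_funM => //; exact: mfst.
  by move=> p _; rewrite lee_fin !normrM ler_wpM2l// (le_trans (uP _ _))// ler_norm.
have -> : FRe = (fun xi => (E 0%N xi)^-1 * fine (fubini_F m
    (fun p : X * X => (E 0%N p.1 * u p.1 p.2)%:E) xi)).
  apply/funext => xi; rewrite /fubini_F/= -[fine _]/(\int[m]_x (E 0%N xi * u xi x)).
  by rewrite RintegralZl// mulKf// gt_eqF.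
apply: measurable_funM.
  exact: (measurableT_comp (measurable_inv measurableT)).
apply: (measurableT_comp (fine_measurable measurableT)).
exact: (measurable_fubini_F i2).
Qed.

Lemma measurable_FIm : measurable_fun setT FIm.
Proof.
have mv2 : measurable_fun setT (fun p : X * X => v p.1 p.2).
  apply: measurable_funB; apply: measurable_funM; try exact: msnd.
    exact: measurableT_comp.
  exact: measurableT_comp.
have i2 : (m \x m)%E.-integrable setT (EFin \o (fun p : X * X => E 0%N p.1 * v p.1 p.2)).
  apply: le_integrable (integrable_prod (iE 0) ig) => //.
    by apply/measurable_EFinP; apply: measurable_funM => //; exact: mfst.
  by move=> p _; rewrite lee_fin !normrM ler_wpM2l// (le_trans (vP _ _))// ler_norm.
have -> : FIm = (fun xi => (E 0%N xi)^-1 * fine (fubini_F m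
    (fun p : X * X => (E 0%N p.1 * v p.1 p.2)%:E) xi)).
  apply/funext => xi; rewrite /fubini_F/= -[fine _]/(\int[m]_x (E 0%N xi * v xi x)).
  by rewrite RintegralZl// mulKf// gt_eqF.
apply: measurable_funM.
  exact: (measurableT_comp (measurable_inv measurableT)).
apply: (measurableT_comp (fine_measurable measurableT)).
exact: (measurable_fubini_F i2).
Qed.

Let S xi := FRe xi ^+ 2 + FIm xi ^+ 2.
Let H xi (p : X * X) := (a p.1 * a p.2 + b p.1 * b p.2) * cos (dot xi p.1 - dot xi p.2)
  + (b p.1 * a p.2 - a p.1 * b p.2) * sin (dot xi p.1 - dot xi p.2).

Let HE xi p : H xi p = u xi p.1 * u xi p.2 + v xi p.1 * v xi p.2.
Proof. by rewrite /H cosB sinB /u /v; ring. Qed.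

Let iuu xi : (m \x m)%E.-integrable setT (fun p => (u xi p.1 * u xi p.2)%:E).
Proof. exact: integrable_prod. Qed.
Let ivv xi : (m \x m)%E.-integrable setT (fun p => (v xi p.1 * v xi p.2)%:E).
Proof. exact: integrable_prod. Qed.

Let SE xi : S xi = \int[(m \x m)%E]_p H xi p.
Proof.
rewrite /S !expr2 /FRe /FIm -!Rintegral_prodM// -(RintegralD measurableT (iuu xi) (ivv xi)).
by apply: eq_Rintegral => p _; rewrite HE.
Qed.

Let HP xi p : `|H xi p| <= 2 * (g p.1 * g p.2).
Proof.
rewrite HE; apply: le_trans (ler_normD _ _) _; rewrite mulr_natl mulr2n.
by apply: lerD; rewrite normrM ler_pM.
Qed.

Let PP := (X * X)%type.
Let m2 : {sigma_finite_measure set PP -> \bar R} := sprod m m.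

Let mD : measurable_fun setT (fun q : X * PP => dot q.1 q.2.1 - dot q.1 q.2.2).
Proof.
have m21 : measurable_fun setT (fun q : X * PP => q.2.1).
  exact: (measurableT_comp measurable_fst measurable_snd).
have m22 : measurable_fun setT (fun q : X * PP => q.2.2).
  exact: (measurableT_comp measurable_snd measurable_snd).
apply: measurable_funB.
  apply: (measurableT_comp mdot (g := fun q : X * PP => (q.1, q.2.1))).
  exact: measurable_fun_pair.
apply: (measurableT_comp mdot (g := fun q : X * PP => (q.1, q.2.2))).
exact: measurable_fun_pair.
Qed.

Let mA : measurable_fun setT (fun p : PP => a p.1 * a p.2 + b p.1 * b p.2).
Proof.
by apply: measurable_funD; apply: measurable_funM; try exact: msnd; exact: mfst.
Qed.
Let mB : measurable_fun setT (fun p : PP => b p.1 * a p.2 - a p.1 * b p.2).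
Proof.
by apply: measurable_funB; apply: measurable_funM; try exact: msnd; exact: mfst.
Qed.

Let G n (q : X * PP) := E n q.1 * H q.1 q.2.

Let igg : m2.-integrable setT (fun p : PP => (2 * (g p.1 * g p.2))%:E).
Proof. by apply: integrableRZ => //; exact: integrable_prod. Qed.

Let iG n : (m \x m2)%E.-integrable setT (EFin \o G n).
Proof.
apply: le_integrable (integrable_prod (iE n) igg) => //.
  apply/measurable_EFinP; apply: measurable_funM.
    exact: (measurableT_comp (mE n) measurable_fst).
  apply: measurable_funD; apply: measurable_funM.
  - exact: (measurableT_comp mA measurable_snd).
  - exact: (measurableT_comp mcos mD).
  - exact: (measurableT_comp mB measurable_snd).
  - exact: (measurableT_comp msin mD).
move=> q _; rewrite lee_fin !normrM ler_wpM2l// (le_trans (HP _ _))//.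
by rewrite -!normrM ler_norm.
Qed.

Let iH xi : m2.-integrable setT (EFin \o H xi).
Proof.
have := integrableRD measurableT (iuu xi) (ivv xi); apply: eq_integrable => // p _.
by rewrite /= HE.
Qed.

Let ESE n xi : E n xi * S xi = \int[m2]_p G n (xi, p).
Proof. by rewrite SE -RintegralZl. Qed.

Let iES n : m.-integrable setT (fun xi => (E n xi * S xi)%:E).
Proof.
have := integrable_fubini_F (iG n); apply: eq_integrable => // xi _.
rewrite ESE /Rintegral fineK//; apply: integrable_fin_num => //.
have := integrableRZ measurableT (E n xi) (iH xi).
by apply: eq_integrable => // p _.
Qed.

Let EH n x y : \int[m]_xi G n (xi, (x, y)) =
  (a x * a y + b x * b y) * K n (x, y).
Proof.
pose D xi := dot xi x - dot xi y.
have mD1 : measurable_fun setT D.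
  apply: measurable_funB; first exact: (measurableT_comp mdot (measurable_pair2 x)).
  exact: (measurableT_comp mdot (measurable_pair2 y)).
have ic A : m.-integrable setT (fun xi => (E n xi * cos (A + D xi))%:E).
  apply: le_integrable (iE n) => //.
    apply/measurable_EFinP; apply: measurable_funM => //.
    by apply: (measurableT_comp mcos); exact: measurable_funD.
  by move=> xi _; rewrite lee_fin bnd1.
have e1 := integrableRZ measurableT (a x * a y + b x * b y) (ic 0).
have e2 := integrableRZ measurableT (b x * a y - a x * b y) (ic (- (pi / 2))).
transitivity (\int[m]_xi ((a x * a y + b x * b y) * (E n xi * cos (0 + D xi))
    + (b x * a y - a x * b y) * (E n xi * cos (- (pi / 2) + D xi)))).
  apply: eq_Rintegral => xi _; rewrite /G /H /= add0r -[dot xi x - dot xi y]/(D xi) [cos (- _ + _)]cosD cosN sinN.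
  by rewrite cos_pihalf sin_pihalf mul0r mulN1r opprK add0r; ring.
rewrite (RintegralD measurableT e1 e2) (RintegralZl _ measurableT (ic _)).
rewrite (RintegralZl _ measurableT (ic _)).
by rewrite !EK cosN cos_pihalf cos0 mul0r mulr0 addr0 mul1r.
Qed.

Let aK n : measurable_fun setT (fun p : PP => (a p.1 * a p.2 + b p.1 * b p.2) * K n p).
Proof. exact: measurable_funM. Qed.

Let Kbound n p : `|K n p| <= \int[m]_xi E n xi.
Proof.
case: p => x y; have := EK n x y 0; rewrite cos0 mul1r => <-.
have mD1 : measurable_fun setT (fun xi => dot xi x - dot xi y).
  apply: measurable_funB; first exact: (measurableT_comp mdot (measurable_pair2 x)).
  exact: (measurableT_comp mdot (measurable_pair2 y)).
have ic : m.-integrable setT (fun xi => (E n xi * cos (0 + (dot xi x - dot xi y)))%:E).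
  apply: le_integrable (iE n) => //.
    apply/measurable_EFinP; apply: measurable_funM => //.
    by apply: (measurableT_comp mcos); exact: measurable_funD.
  by move=> xi _; rewrite lee_fin bnd1.
apply: le_trans (le_normr_Rintegral measurableT ic) _.
apply: le_Rintegral => //; first exact: (integrable_norm (f := _)).
by move=> xi _; rewrite (le_trans (bnd1 _ _))// gtr0_norm.
Qed.

Let iaK n : m2.-integrable setT
  (fun p : PP => ((a p.1 * a p.2 + b p.1 * b p.2) * K n p)%:E).
Proof.
have h := integrableRZ measurableT (\int[m]_xi E n xi) (integrable_prod ig ig).
apply: le_integrable h => //; first exact/measurable_EFinP.
move=> p _; rewrite lee_fin normrM (le_trans _ (ler_norm _))// mulrC ler_pM//.
rewrite /g mulrDl !mulrDr; apply: le_trans (ler_normD _ _) _; rewrite !normrM.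
by rewrite -addrA lerD2l addrA lerDr addr_ge0// mulr_ge0.
Qed.

Let J n := \int[m2]_(p in setT) ((a p.1 * a (add n p) + b p.1 * b (add n p)) * k p.2).

Let mk : measurable_fun setT k.
Proof. by have /integrableP[/measurable_EFinP] := ik. Qed.

Let ih n : m2.-integrable setT
  (fun p : PP => ((a p.1 * a (add n p) + b p.1 * b (add n p)) * k p.2)%:E).
Proof.
have h := integrableRZ measurableT M (integrable_prod ig ik).
apply: le_integrable h => //.
  apply/measurable_EFinP; apply: measurable_funM; last exact: (msnd mk).
  apply: measurable_funD; apply: measurable_funM; try exact: mfst.
    exact: (measurableT_comp ma (madd n)).
  exact: (measurableT_comp mb (madd n)).
move=> p _; rewrite lee_fin mulrA normrM [leRHS]normrM ler_wpM2r//.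
rewrite (le_trans _ (ler_norm _))// (le_trans (ler_normD _ _))// mulrDr.
by rewrite !normrM ![M * _]mulrC lerD// ler_wpM2l.
Qed.

Let intES n : \int[m]_xi (E n xi * S xi) = J n.
Proof.
transitivity (\int[m]_xi \int[m2]_p G n (xi, p)).
  by apply: eq_Rintegral => xi _; exact: ESE.
rewrite -Rintegral_prod// Rintegral_prod_swap//.
transitivity (\int[m2]_p ((a p.1 * a p.2 + b p.1 * b p.2) * K n p)).
  by apply: eq_Rintegral => -[x y] _; exact: EH.
apply: etrans (Rintegral_prod (iaK n)) _.
apply: etrans (esym (Rintegral_prod (ih n))).
apply: eq_Rintegral => x _ /=.
have ih1 : m.-integrable setT (EFin \o (fun y => a x * a y + b x * b y)).
  by apply: integrableRD => //; exact: integrableRZ.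
exact: (Kadd n x ih1).
Qed.

Lemma integrable_sqr_sum :
  m.-integrable setT (EFin \o (fun x => a x ^+ 2 + b x ^+ 2)).
Proof.
have h := integrableRZ measurableT M ig; apply: le_integrable h => //.
  by apply/measurable_EFinP; apply: measurable_funD; exact: measurable_funX.
move=> x _; rewrite lee_fin (le_trans _ (ler_norm _))// ger0_norm ?addr_ge0 ?sqr_ge0//.
rewrite /g mulrDr lerD// -real_normK ?num_real// expr2.
  by rewrite ler_wpM2r.
by rewrite ler_wpM2r.
Qed.

(** Writing the squared transform as a double integral in (x, y) and damping by the
    factor E n, the integral over xi produces the kernel K n(x, y).  The change of
    variables y = add n (x, z) turns K n into a fixed kernel k(z), and
    add n (x, z) -> x.  The limit is taken by monotone convergence on the side of
    the transform and by dominated convergence on the other side. *)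
Lemma plancherel : (\int[m]_xi (FRe xi ^+ 2 + FIm xi ^+ 2)%:E =
  ((\int[m]_x (a x ^+ 2 + b x ^+ 2)) * \int[m]_x k x)%:E)%E.
Proof.
have S0 xi : 0 <= S xi by rewrite addr_ge0 ?sqr_ge0.
have i2 := integrable_sqr_sum.
have cJ : J n @[n --> \oo] --> (\int[m]_x (a x ^+ 2 + b x ^+ 2)) * \int[m]_x k x.
  have ilim := integrable_prod i2 ik.
  rewrite -Rintegral_prodM//; apply: fine_cvg; rewrite fineK; last first.
    exact: (integrable_fin_num measurableT ilim).
  have [] := @dominated_convergence _ _ R m2 setT measurableT
    (fun n p => ((a p.1 * a (add n p) + b p.1 * b (add n p)) * k p.2)%:E)
    (fun p => ((a p.1 ^+ 2 + b p.1 ^+ 2) * k p.2)%:E)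
    (fun p => (M * (g p.1 * k p.2))%:E) => //.
  - by move=> n; exact: measurable_int (ih n).
  - exact: measurable_int ilim.
  - apply: aeW => -[x z] _; apply: cvg_EFin; first exact: nearW.
    apply: cvgM; last exact: cvg_cst.
    rewrite !expr2; apply: cvgD; apply: cvgM; try exact: cvg_cst.
      exact: add_a.
    exact: add_b.
  - exact: (integrableRZ measurableT M (integrable_prod ig ik)).
  - apply: aeW => p n _; rewrite lee_fin mulrA normrM (ger0_norm (k_ge0 _)) ler_wpM2r//.
    rewrite (le_trans (ler_normD _ _))// mulrDr.
    by rewrite !normrM ![M * _]mulrC lerD// ler_wpM2l.
have mono : ((\int[m]_xi (E n xi * S xi)%:E) @[n --> \oo] --> \int[m]_xi (S xi)%:E)%E.
  rewrite [X in _ --> X](_ : _ = \int[m]_xi limn (fun n => (E n xi * S xi)%:E))%E.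
    apply: cvg_monotone_convergence => //.
    - by move=> n; exact: measurable_int (iES n).
    - by move=> n xi _; rewrite lee_fin mulr_ge0// ltW.
    - by move=> xi _ i j ij; rewrite lee_fin ler_wpM2r// E_nd.
  apply: eq_integral => xi _; apply/esym/cvg_lim => //.
  apply: cvg_EFin; first exact: nearW.
  rewrite -[X in _ --> X]mul1r; apply: cvgM => //; exact: cvg_cst.
have mono' : ((J n)%:E @[n --> \oo] --> \int[m]_xi (S xi)%:E)%E.
  apply: cvg_trans mono; apply: near_eq_cvg; apply: nearW => n.
  by rewrite -intES /Rintegral fineK//; exact: integrable_fin_num.
have cJ' : ((J n)%:E @[n --> \oo] --> ((\int[m]_x (a x ^+ 2 + b x ^+ 2)) * \int[m]_x k x)%:E)%E.
  by apply: cvg_EFin; first exact: nearW.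
exact: (cvg_unique _ mono' cJ').
Qed.

End plancherel.

(** * Measurability and the Poisson kernel in three dimensions *)

Section caratheodory.
Context d (X : measurableType d) {R : realType}.

(** Rounding the second variable to a multiple of 1/(n+1) leaves countably many
    sections, each of them measurable; continuity gives convergence. *)
Lemma measurable_caratheodory (f : X * measurableTypeR R -> R) :
  (forall t, measurable_fun setT (fun x => f (x, t))) ->
  (forall x, continuous (fun t : R => f (x, t))) -> measurable_fun setT f.
Proof.
move=> mf cf.
pose q n (t : R) : R := (Num.floor (n.+1%:R * t))%:~R / n.+1%:R.
  have qt (t : R) : q n t @[n --> \oo] --> t.
    apply: (@squeeze_cvgr _ _ _ _ (fun n => t - n.+1%:R^-1) (fun=> t)); last first.
    - exact: cvg_cst.
    - rewrite -[X in _ --> X]subr0; apply: cvgB; first exact: cvg_cst.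
      exact: cvg_harmonic.
    - apply: nearW => n; have /andP[] := floor_itv (n.+1%:R * t).
      rewrite intrD mulr1z => h1 h2; have n0 : 0 < n.+1%:R :> R by [].
      apply/andP; split; last by rewrite /q ler_pdivrMr// [t * _]mulrC.
      rewrite /q ler_pdivlMr// mulrBl mulVf ?gt_eqF// [t * _]mulrC; lra.
apply: (measurable_fun_cvg (h := fun n p => f (p.1, q n p.2))); last first.
  move=> [x t] _ /=.
  exact: (cvg_comp _ _ (qt t) (cf x t)).
move=> n _ B mB; rewrite setTI.
have -> : (fun p => f (p.1, q n p.2)) @^-1` B = \bigcup_(z in [set: int])
    (((fun x => f (x, z%:~R / n.+1%:R)) @^-1` B) `*`
     `[z%:~R / n.+1%:R, (z + 1)%:~R / n.+1%:R[ ).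
  have n0 : 0 < n.+1%:R :> R by [].
  apply/seteqP; split => -[x t] /=.
    move=> Bq; exists (Num.floor (n.+1%:R * t)) => //; split => //=.
    rewrite in_itv/= ler_pdivrMr// ltr_pdivlMr// ![t * _]mulrC.
    exact: floor_itv.
  move=> [z _ []] /=; rewrite in_itv/= ler_pdivrMr// ltr_pdivlMr// ![t * _]mulrC.
  by move=> Bz tz; rewrite /q (floor_def tz).
apply: countable_bigcupT_measurable; first exact: countableP.
move=> z; apply: measurableX => //.
by rewrite -[X in measurable X]setTI; exact: mf.
Qed.

End caratheodory.

Section poisson_line.
Context {R : realType}.
Local Notation mu := (@lebesgue_measure R).
Variable e : R.
Hypothesis e0 : 0 < e.

(** The damping factor of Abel summation. *)
Definition expabs (t : R) : R := expR (- (e * `|t|)).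

Lemma continuous_expabs : continuous expabs.
Proof.
move=> t; apply: (@continuous_comp _ _ _ (fun t : R => - (e * `|t|)) expR).
  apply: cvgN; apply: cvgM; first exact: cvg_cst.
  exact: norm_continuous.
exact: continuous_expR.
Qed.

Lemma integrable_expabs : mu.-integrable setT (EFin \o expabs).
Proof.
apply: le_integrable (integrable_oneDsqr (1 + 4 / e ^+ 2) measurableT) => //.
  by apply/measurable_EFinP; apply: continuous_measurable_fun; exact: continuous_expabs.
move=> t _; rewrite lee_fin ger0_norm ?expR_ge0//.
have q0 : 0 < 1 + t ^+ 2 by have := sqr_ge0 t; lra.
have c0 : 0 <= 4 / e ^+ 2 by rewrite divr_ge0// ?sqr_ge0.
rewrite ger0_norm; last by rewrite mulr_ge0 ?invr_ge0 ?ltW//; lra.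
rewrite ler_pdivlMr// mulrDr mulr1 lerD//.
  by rewrite expR_le1 oppr_le0 mulr_ge0// ltW.
rewrite -real_normK ?num_real// /expabs; have s0 : 0 <= `|t| by [].
move: `|t| s0 => s s0.
have h : e * s / 2 <= expR (e * s / 2) by have := expR_ge1Dx (e * s / 2); lra.
have h0 : 0 <= e * s / 2 by rewrite mulr_ge0// mulr_ge0// ltW.
have := lerXn2r 2 h0 (expR_ge0 _) h; rewrite -expRM_natl.
have -> : 2 * (e * s / 2) = e * s by lra.
rewrite expRN => h2; rewrite ler_pdivrMl ?expR_gt0//.
rewrite mulrA ler_pdivlMr ?exprn_gt0//; move: h2; rewrite !exprMn; lra.
Qed.

(** Folding at 0 leaves the integral over t > 0 of 2 cos(A) exp(-e t) cos(t z), which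
    has an elementary primitive. *)
Lemma cos_transform_expabs (z A : R) :
  \int[mu]_t (expabs t * cos (A + t * z)) = cos A * (2 * e / (e ^+ 2 + z ^+ 2)).
Proof.
have q0 : 0 < e ^+ 2 + z ^+ 2 by have := sqr_ge0 z; have := exprn_gt0 2 e0; lra.
have mc : measurable_fun setT (fun t : measurableTypeR R => cos (A + t * z)).
  apply: continuous_measurable_fun => t.
  apply: (@continuous_comp _ _ _ (fun t : R => A + t * z) cos).
    by apply: cvgD; [exact: cvg_cst|apply: cvgM; [exact: cvg_id|exact: cvg_cst]].
  exact: continuous_cos.
have me : measurable_fun setT (expabs : measurableTypeR R -> R).
  by apply: continuous_measurable_fun; exact: continuous_expabs.
have icos (c : measurableTypeR R -> R) : measurable_fun setT c ->
    (forall t, `|c t| <= 1) -> mu.-integrable setT (fun t => (expabs t * c t)%:E).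
  move=> mmc c1; apply: le_integrable integrable_expabs => //.
    by apply/measurable_EFinP; exact: measurable_funM.
  by move=> t _; rewrite lee_fin normrM ler_piMr.
have cosle (x : R) : `|cos x| <= 1 by rewrite ler_norml cos_geN1/= cos_le1.
rewrite Rintegral_half; last exact: icos.
pose g (t : R) : R := expR (- (e * t)) * cos (t * z).
pose G (t : R) : R := expR (- (e * t)) * ((e ^+ 2 + z ^+ 2)^-1 *
  (z * sin (t * z) - e * cos (t * z))).
have GD (t : R) : is_derive t 1 G (g t).
  have d1 : is_derive t 1 (fun t : R => expR (- (e * t))) (- e * expR (- (e * t))).
    by apply: is_derive_eq; rewrite /GRing.scale/=; ring.
  have d2 : is_derive t 1 (fun t : R => sin (t * z)) (z * cos (t * z)).
    by apply: is_derive_eq; rewrite /GRing.scale/=; ring.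
  have d3 : is_derive t 1 (fun t : R => cos (t * z)) (- z * sin (t * z)).
    by apply: is_derive_eq; rewrite /GRing.scale/=; ring.
  apply: is_derive_eq; rewrite /GRing.scale/= /g.
  by field; rewrite gt_eqF.
have cg : continuous g.
  move=> t; apply: cvgM.
    apply: (@continuous_comp _ _ _ (fun t : R => - (e * t)) expR).
      by apply: cvgN; apply: cvgM; [exact: cvg_cst|exact: cvg_id].
    exact: continuous_expR.
  apply: (@continuous_comp _ _ _ (fun t : R => t * z) cos).
    by apply: cvgM; [exact: cvg_id|exact: cvg_cst].
  exact: continuous_cos.
have mD : measurable (`]0, +oo[%classic : set (measurableTypeR R)) by [].
have gE (t : R) : 0 < t -> expabs t * cos (t * z) = g t.
  by move=> t0; rewrite /expabs gtr0_norm.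
have ig : mu.-integrable `]0, +oo[ (EFin \o g).
  have h : mu.-integrable `]0, +oo[ (fun t : measurableTypeR R => (expabs t * cos (t * z))%:E).
    apply: integrableS (icos (fun t => cos (t * z)) _ _) => //.
    apply: continuous_measurable_fun => t.
    apply: (@continuous_comp _ _ _ (fun t : R => t * z) cos).
      by apply: cvgM; [exact: cvg_id|exact: cvg_cst].
    exact: continuous_cos.
  apply: eq_integrable h => // t; rewrite inE/= in_itv/= andbT => t0.
  by rewrite gE.
transitivity (\int[mu]_(t in `]0, +oo[) (2 * cos A * g t)).
  apply: eq_Rintegral => t; rewrite inE/= in_itv/= andbT => t0.
  rewrite /expabs normrN gtr0_norm// /g cosD cosD mulNr sinN cosN; ring.
rewrite RintegralZl//.
have -> : \int[mu]_(t in `]0, +oo[) g t = e / (e ^+ 2 + z ^+ 2); last by ring.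
have c1 := cvg_Rintegral_halfline ig.
have c2 : \int[mu]_(x in `[0, n%:R]) g x @[n --> \oo] --> e / (e ^+ 2 + z ^+ 2).
  apply: cvg_trans (_ : (G n%:R - G 0) @[n --> \oo] --> _).
    apply: near_eq_cvg; near=> n; rewrite (Rintegral_FTC2 _ GD cg)// ltr0n.
    by near: n; exists 1%N.
  have -> : e / (e ^+ 2 + z ^+ 2) = 0 - G 0.
    by rewrite /G mulr0 oppr0 expR0 mul0r sin0 cos0; ring.
  apply: cvgB; last exact: cvg_cst.
  pose C := (e ^+ 2 + z ^+ 2)^-1 * (`|z| + e).
  apply: (@norm_cvg0 _ R^o).
  apply: (@squeeze_cvgr _ _ _ _ (fun=> 0) (fun n => C * expR (- e) ^+ n)).
  - apply: nearW => n; rewrite normr_ge0/= normrM ger0_norm ?expR_ge0// mulrC.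
    rewrite (_ : expR _ = expR (- e) ^+ n); last first.
      by rewrite -expRM_natl; congr expR; ring.
    rewrite ler_wpM2r ?exprn_ge0 ?expR_ge0// normrM gtr0_norm ?invr_gt0//.
    rewrite ler_wpM2l ?invr_ge0 ?(ltW q0)//.
    apply: le_trans (ler_normB _ _) _; rewrite !normrM lerD// ?ler_piMr//.
      by rewrite ler_norml sin_geN1/= sin_le1.
    by rewrite (gtr0_norm e0) ler_piMr// ltW.
  - exact: cvg_cst.
  - rewrite -[X in _ --> X](mulr0 C); apply: cvgM; first exact: cvg_cst.
    by apply: cvg_expr; rewrite gtr0_norm ?expR_gt0// expR_lt1 oppr_lt0.
by rewrite -(cvg_lim _ c1)// -(cvg_lim _ c2).
Unshelve. all: by end_near. Qed.

End poisson_line.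

Section space.
Context {R : realType}.
Local Notation mu := (@lebesgue_measure R).
Local Notation T1 := (measurableTypeR R).
Implicit Types f g h : T1 -> R.

(** The measure [leb3] with its sigma-finite structure; the two are convertible. *)
Definition leb3s : {sigma_finite_measure set (R3 R) -> \bar R} :=
  sprod (sprod mu mu) mu.

Lemma measurable_x1 : measurable_fun setT (fun x : R3 R => x.1.1).
Proof. exact: (measurableT_comp measurable_fst measurable_fst). Qed.
Lemma measurable_x2 : measurable_fun setT (fun x : R3 R => x.1.2).
Proof. exact: (measurableT_comp measurable_snd measurable_fst). Qed.
Lemma measurable_x3 : measurable_fun setT (fun x : R3 R => x.2).
Proof. exact: measurable_snd. Qed.

Lemma measurable_triple d (X : measurableType d) (f g h : X -> T1) :
  measurable_fun setT f -> measurable_fun setT g -> measurable_fun setT h ->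
  measurable_fun setT (fun x => (f x, g x, h x) : R3 R).
Proof. by move=> mf mg mh; do 2 apply: measurable_fun_pair => //. Qed.

Lemma measurable_dot3 d (X : measurableType d) (f g : X -> R3 R) :
  measurable_fun setT f -> measurable_fun setT g ->
  measurable_fun setT (fun x => dot3 (f x) (g x)).
Proof.
move=> mf mg; apply: measurable_funD; first apply: measurable_funD;
  apply: measurable_funM; (try exact: (measurableT_comp measurable_x1));
  (try exact: (measurableT_comp measurable_x2)); exact: (measurableT_comp measurable_x3).
Qed.

Lemma integrable_prod3 f g h : mu.-integrable setT (EFin \o f) ->
  mu.-integrable setT (EFin \o g) -> mu.-integrable setT (EFin \o h) ->
  leb3s.-integrable setT (fun x : R3 R => (f x.1.1 * g x.1.2 * h x.2)%:E).
Proof.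
move=> fi gi hi.
exact: (@integrable_prod _ _ _ _ R (sprod mu mu) mu (fun p => f p.1 * g p.2) h
  (integrable_prod fi gi) hi).
Qed.

Lemma Rintegral_prod3 f g h : mu.-integrable setT (EFin \o f) ->
  mu.-integrable setT (EFin \o g) -> mu.-integrable setT (EFin \o h) ->
  \int[leb3s]_(x in setT) (f x.1.1 * g x.1.2 * h x.2) =
  (\int[mu]_t f t) * (\int[mu]_t g t) * (\int[mu]_t h t).
Proof.
move=> fi gi hi; rewrite -(Rintegral_prodM fi gi).
exact: (@Rintegral_prodM _ _ _ _ R (sprod mu mu) mu (fun p => f p.1 * g p.2) h
  (integrable_prod fi gi) hi).
Qed.

Lemma transport_prod3 (phi1 phi2 phi3 : T1 -> T1) (a : R) : 0 <= a ->
  measurable_fun setT phi1 -> measurable_fun setT phi2 -> measurable_fun setT phi3 ->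
  (forall f : T1 -> \bar R, measurable_fun setT f -> (forall x, 0 <= f x)%E ->
    (\int[mu]_x f (phi1 x) = a%:E * \int[mu]_x f x)%E) ->
  (forall f : T1 -> \bar R, measurable_fun setT f -> (forall x, 0 <= f x)%E ->
    (\int[mu]_x f (phi2 x) = a%:E * \int[mu]_x f x)%E) ->
  (forall f : T1 -> \bar R, measurable_fun setT f -> (forall x, 0 <= f x)%E ->
    (\int[mu]_x f (phi3 x) = a%:E * \int[mu]_x f x)%E) ->
  forall f : R3 R -> \bar R, measurable_fun setT f -> (forall x, 0 <= f x)%E ->
  (\int[leb3s]_x f (phi1 x.1.1, phi2 x.1.2, phi3 x.2) =
    (a * a * a)%:E * \int[leb3s]_x f x)%E.
Proof.
move=> a0 m1 m2 m3 H1 H2 H3.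
have m12 : measurable_fun setT (fun p : T1 * T1 => (phi1 p.1, phi2 p.2)).
  apply: measurable_fun_pair; first exact: (measurableT_comp m1 measurable_fst).
  exact: (measurableT_comp m2 measurable_snd).
exact: (@transport_prod _ _ _ _ R (sprod mu mu) mu (fun p => (phi1 p.1, phi2 p.2)) phi3
  (a * a) a m12 m3 a0 (transport_prod m1 m2 a0 H1 H2) H3).
Qed.

Lemma cos_transform_prod3 (E : T1 -> R) (z1 z2 z3 c1 c2 c3 A : R) :
  mu.-integrable setT (EFin \o E) ->
  (forall A, \int[mu]_t (E t * cos (A + t * z1)) = cos A * c1) ->
  (forall A, \int[mu]_t (E t * cos (A + t * z2)) = cos A * c2) ->
  (forall A, \int[mu]_t (E t * cos (A + t * z3)) = cos A * c3) ->
  \int[leb3s]_(x in setT) (E x.1.1 * E x.1.2 * E x.2 *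
     cos (A + (x.1.1 * z1 + x.1.2 * z2 + x.2 * z3))) = cos A * (c1 * c2 * c3).
Proof.
move=> iE H1 H2 H3.
have ml (z : R) : measurable_fun setT (fun t : T1 => t * z : R).
  exact: measurable_funM.
have ml2 : measurable_fun setT (fun p : T1 * T1 => p.1 * z1 + p.2 * z2 : R).
  apply: measurable_funD; first exact: (measurableT_comp (ml z1) measurable_fst).
  exact: (measurableT_comp (ml z2) measurable_snd).
exact: (@cos_transform_prod _ _ _ _ R (sprod mu mu) mu (fun p => E p.1 * E p.2)
  (fun p => p.1 * z1 + p.2 * z2) E (fun t => t * z3) (c1 * c2) c3
  (integrable_prod iE iE) iE ml2 (ml z3)
  (cos_transform_prod iE iE (ml z1) (ml z2) H1 H2) H3 A).
Qed.

Lemma cvg_triple (T : Type) (F : set_system T) {FF : Filter F} (f g h : T -> R)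
    (a b c : R) : f t @[t --> F] --> a -> g t @[t --> F] --> b ->
  h t @[t --> F] --> c -> (f t, g t, h t) @[t --> F] --> (a, b, c).
Proof.
move=> fa gb hc.
exact: (@cvg_pair _ _ _ F (nbhs (a, b)) (nbhs c) _ _ _ (fun t => (f t, g t)) h
  (@cvg_pair _ _ _ F (nbhs a) (nbhs b) _ _ _ f g fa gb) hc).
Qed.

(** [measurable_caratheodory] for the last variable, then for the middle one. *)
Lemma continuous_measurable3 (f : R * R * R -> R) : continuous f ->
  measurable_fun setT (f : R3 R -> R).
Proof.
move=> cf.
have c1 (y z : R) : continuous (fun t : R => f (t, y, z)).
  move=> t; apply: (cvg_comp (fun t : R => (t, y, z)) f _ (cf (t, y, z))).
  by apply: cvg_triple; by [exact: cvg_id|exact: cvg_cst].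
have c2 (x z : R) : continuous (fun t : R => f (x, t, z)).
  move=> t; apply: (cvg_comp (fun t : R => (x, t, z)) f _ (cf (x, t, z))).
  by apply: cvg_triple; by [exact: cvg_id|exact: cvg_cst].
have c3 (x y : R) : continuous (fun t : R => f (x, y, t)).
  move=> t; apply: (cvg_comp (fun t : R => (x, y, t)) f _ (cf (x, y, t))).
  by apply: cvg_triple; by [exact: cvg_id|exact: cvg_cst].
apply: measurable_caratheodory => [t|[x1 x2]]; last exact: c3.
apply: (@measurable_caratheodory _ T1 R (fun p => f (p, t))) => [s|x1].
  by apply: continuous_measurable_fun; exact: c1.
exact: c2.
Qed.

End space.

Section poisson_space.
Context {R : realType}.
Local Notation mu := (@lebesgue_measure R).
Local Notation T1 := (measurableTypeR R).

Let ep (n : nat) : R := n.+1%:R^-1.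
Let ep0 n : 0 < ep n. Proof. by rewrite invr_gt0. Qed.

(** The Fourier transform of [expabs e]: the Poisson kernel of the half plane, up to
    normalization. *)
Definition poisson (e z : R) : R := 2 * e / (e ^+ 2 + z ^+ 2).
Definition damping3 n (x : R3 R) : R :=
  expabs (ep n) x.1.1 * expabs (ep n) x.1.2 * expabs (ep n) x.2.
Definition poisson3 n (p : R3 R * R3 R) : R :=
  poisson (ep n) (p.1.1.1 - p.2.1.1) * poisson (ep n) (p.1.1.2 - p.2.1.2)
  * poisson (ep n) (p.1.2 - p.2.2).
Definition poisson3_unit (x : R3 R) : R := poisson 1 x.1.1 * poisson 1 x.1.2 * poisson 1 x.2.
Definition shift3 n (p : R3 R * R3 R) : R3 R :=
  (p.1.1.1 + ep n * p.2.1.1, p.1.1.2 + ep n * p.2.1.2, p.1.2 + ep n * p.2.2).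

Let poisson_den_gt0 (e z : R) : 0 < e -> 0 < e ^+ 2 + z ^+ 2.
Proof. by move=> e0; have := sqr_ge0 z; have := exprn_gt0 2 e0; lra. Qed.

Lemma poisson_ge0 e z : 0 < e -> 0 <= poisson e z.
Proof. by move=> e0; rewrite divr_ge0 ?ltW ?poisson_den_gt0 ?mulr_gt0. Qed.

Lemma poisson_le e z : 0 < e -> poisson e z <= 2 / e.
Proof.
move=> e0; rewrite ler_pdivrMr ?poisson_den_gt0// mulrAC ler_pdivlMr//.
by rewrite -mulrA -expr2 ler_wpM2l// lerDl sqr_ge0.
Qed.

Lemma measurable_poisson e : measurable_fun setT (poisson e : T1 -> R).
Proof.
apply: measurable_funM => //; apply: (measurableT_comp (measurable_inv measurableT)).
by apply: measurable_funD => //; exact: measurable_funX.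
Qed.

Lemma poisson_scale e z : 0 < e -> poisson e (e * z) = e^-1 * poisson 1 z.
Proof.
move=> e0; have h1 := poisson_den_gt0 (e * z) e0; have h2 := poisson_den_gt0 z ltr01.
by rewrite /poisson; field; rewrite -(expr1n R 2) !lt0r_neq0.
Qed.

Lemma poisson1E z : poisson 1 z = 2 * (1 + z ^+ 2)^-1.
Proof. by rewrite /poisson expr1n mulr1. Qed.

Lemma integrable_poisson1 : mu.-integrable setT (EFin \o poisson 1).
Proof.
apply: eq_integrable (integrable_oneDsqr 2 measurableT) => // z _.
by rewrite /= poisson1E.
Qed.

Lemma Rintegral_poisson1 : \int[mu]_z poisson 1 z = 2 * pi.
Proof.
transitivity (\int[mu]_z (2 * (1 + z ^+ 2)^-1)).
  by apply: eq_Rintegral => z _; rewrite poisson1E.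
have i1 := integrable_oneDsqr 1 (measurableT : measurable [set: T1]).
rewrite RintegralZl//; last first.
  by apply: eq_integrable i1 => // z _; rewrite mul1r.
by rewrite /Rintegral integral_oneDsqr.
Qed.

Lemma integrable_damping3 n : leb3s.-integrable setT (EFin \o damping3 n).
Proof. by apply: integrable_prod3; exact: integrable_expabs. Qed.

Lemma damping3_gt0 n x : 0 < damping3 n x.
Proof. by rewrite /damping3 !mulr_gt0// expR_gt0. Qed.

Lemma damping3_nd x : {homo (damping3 ^~ x) : i j / (i <= j)%N >-> i <= j}.
Proof.
move=> i j ij; have h (t : R) : expabs (ep i) t <= expabs (ep j) t.
  rewrite ler_expR lerN2 ler_wpM2r// lef_pV2 ?posrE// ler_nat; exact: ij.
by rewrite /damping3 !ler_pM// ?mulr_ge0 ?expR_ge0// ?h.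
Qed.

Lemma damping3_cvg x : damping3 n x @[n --> \oo] --> (1 : R).
Proof.
have h (t : R) : expabs (ep n) t @[n --> \oo] --> (1 : R).
  rewrite -expR0; apply: continuous_cvg; first exact: continuous_expR.
  rewrite -[X in _ --> X]oppr0; apply: cvgN; rewrite -(mul0r `|t|).
  by apply: cvgM; [exact: cvg_harmonic|exact: cvg_cst].
have := cvgM (cvgM (h x.1.1) (h x.1.2)) (h x.2); rewrite !mulr1; exact.
Qed.

Lemma cos_transform_damping3 n x y A :
  \int[leb3s]_(xi in setT) (damping3 n xi * cos (A + (dot3 xi x - dot3 xi y))) =
  cos A * poisson3 n (x, y).
Proof.
rewrite -(@cos_transform_prod3 R (expabs (ep n)) (x.1.1 - y.1.1) (x.1.2 - y.1.2)
  (x.2 - y.2)).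
- apply: eq_Rintegral => xi _; congr (_ * cos (A + _)); rewrite /dot3; ring.
- exact: integrable_expabs.
- by move=> B; exact: cos_transform_expabs.
- by move=> B; exact: cos_transform_expabs.
- by move=> B; exact: cos_transform_expabs.
Qed.

Let mp d (X : measurableType d) (f g : X -> T1) (c : R) :
  measurable_fun setT f -> measurable_fun setT g ->
  measurable_fun setT (fun x => f x + c * g x : T1).
Proof. by move=> mf mg; apply: measurable_funD => //; exact: measurable_funM. Qed.

Let m11 : measurable_fun setT (fun p : R3 R * R3 R => p.1.1.1).
Proof. exact: (measurableT_comp measurable_x1 measurable_fst). Qed.
Let m12 : measurable_fun setT (fun p : R3 R * R3 R => p.1.1.2).
Proof. exact: (measurableT_comp measurable_x2 measurable_fst). Qed.
Let m13 : measurable_fun setT (fun p : R3 R * R3 R => p.1.2).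
Proof. exact: (measurableT_comp measurable_x3 measurable_fst). Qed.
Let m21 : measurable_fun setT (fun p : R3 R * R3 R => p.2.1.1).
Proof. exact: (measurableT_comp measurable_x1 measurable_snd). Qed.
Let m22 : measurable_fun setT (fun p : R3 R * R3 R => p.2.1.2).
Proof. exact: (measurableT_comp measurable_x2 measurable_snd). Qed.
Let m23 : measurable_fun setT (fun p : R3 R * R3 R => p.2.2).
Proof. exact: (measurableT_comp measurable_x3 measurable_snd). Qed.

Lemma measurable_shift3 n : measurable_fun setT (shift3 n).
Proof. by apply: measurable_triple; exact: mp. Qed.

Lemma measurable_poisson3 n : measurable_fun setT (poisson3 n).
Proof.
by apply: measurable_funM; first apply: measurable_funM;
  apply: (measurableT_comp (measurable_poisson (ep n))); exact: measurable_funB.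
Qed.

Lemma poisson3_bound n p : `|poisson3 n p| <= (2 / ep n) ^+ 3.
Proof.
have g0 z : 0 <= poisson (ep n) z by exact: poisson_ge0.
rewrite ger0_norm; last by apply: mulr_ge0 => //; exact: mulr_ge0.
have l1 z : poisson (ep n) z <= 2 / ep n by exact: poisson_le.
rewrite /poisson3 exprSr expr2; apply: ler_pM => //; first exact: mulr_ge0.
exact: ler_pM.
Qed.

(** The Poisson kernel at scale e is a rescaling of the one at scale 1. *)
Lemma poisson3_shift n x (h : R3 R -> R) : leb3s.-integrable setT (EFin \o h) ->
  \int[leb3s]_(y in setT) (h y * poisson3 n (x, y)) =
  \int[leb3s]_(z in setT) (h (shift3 n (x, z)) * poisson3_unit z).
Proof.
move=> hi; have /integrableP[/measurable_EFinP mh _] := hi.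
have e0 := ep0 n; set e := ep n in e0.
have mphi : measurable_fun setT (fun z : R3 R => shift3 n (x, z)).
  exact: (measurableT_comp (measurable_shift3 n) (measurable_pair1 x)).
have tr : forall f : R3 R -> \bar R, measurable_fun setT f -> (forall x, 0 <= f x)%E ->
    (\int[leb3s]_z f (shift3 n (x, z)) = (e^-1 * e^-1 * e^-1)%:E * \int[leb3s]_z f z)%E.
  apply: (@transport_prod3 R (fun t => x.1.1 + e * t) (fun t => x.1.2 + e * t)
    (fun t => x.2 + e * t)); rewrite ?invr_ge0 ?(ltW e0)//; try exact: measurable_affine;
    by move=> f mf f0; exact: ge0_integral_affine.
have hK : leb3s.-integrable setT (fun y => (e ^+ 3 * (h y * poisson3 n (x, y)))%:E).
  apply: integrableRZ => //.
  have := integrableRZ measurableT ((2 / ep n) ^+ 3) (integrable_norm hi).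
  apply: le_integrable => //.
    apply/measurable_EFinP; apply: measurable_funM => //.
    exact: (measurableT_comp (measurable_poisson3 n) (measurable_pair1 x)).
  move=> y _; rewrite lee_fin normrM mulrC (le_trans _ (ler_norm _))//.
  by rewrite ler_wpM2r// poisson3_bound.
have hK' : leb3s.-integrable setT (fun y => (h y * poisson3 n (x, y))%:E).
  have := integrableRZ measurableT (e ^- 3) hK; apply: eq_integrable => // y _.
  by rewrite mulKf// expf_neq0// gt_eqF.
transitivity (\int[leb3s]_(z in setT) ((fun y => e ^+ 3 * (h y * poisson3 n (x, y))) (shift3 n (x, z)))).
  rewrite (Rintegral_transport mphi tr hK) (RintegralZl _ measurableT hK').
  move: (Rintegral _ _ _) => I0.
  by field; rewrite gt_eqF.
apply: eq_Rintegral => z _; rewrite mulrCA; congr (_ * _).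
(* the powers of e from the kernel and from the Jacobian cancel *)
have sq (a b : R) : poisson e (a - (a + e * b)) = e^-1 * poisson 1 b.
  by rewrite -poisson_scale// /poisson; congr (_ / (_ + _)); ring.
by rewrite /poisson3 /= !sq /poisson3_unit; field; rewrite gt_eqF.
Qed.

Lemma shift3_cvg (f : R * R * R -> R) x z : continuous f ->
  f (shift3 n (x, z)) @[n --> \oo] --> f x.
Proof.
move=> cf; case: x => -[x1 x2] x3.
have h (a b : R) : a + ep n * b @[n --> \oo] --> a.
  rewrite -[X in _ --> X]addr0 -[X in _ --> _ + X](mul0r b).
  by apply: cvgD; [exact: cvg_cst|apply: cvgM; [exact: cvg_harmonic|exact: cvg_cst]].
apply: (cvg_comp (fun n => shift3 n (x1, x2, x3, z) : R * R * R) f _ (cf (x1, x2, x3))).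
by apply: cvg_triple; exact: h.
Qed.

End poisson_space.

(** * The Fourier transform as an isometry *)

Section L2limits.
Context d {T : measurableType d} {R : realType}.
Variable mu : {measure set T -> \bar R}.
Implicit Types f g : T -> R[i].

Lemma inL2_L2enorm f : inL2 mu f -> L2enorm mu f = (L2norm mu f)%:E.
Proof.
by move=> [_ _ fi]; rewrite /L2norm fineK// ge0_fin_numE// L2enorm_ge0.
Qed.

Lemma L2norm_sqrD f g : inL2 mu f -> inL2 mu g ->
  L2norm mu (fun x => f x + g x) ^+ 2 =
  L2norm mu f ^+ 2 + L2norm mu g ^+ 2 + 2 * sdot mu f g.
Proof.
move=> fi gi; have fgi := inL2D fi gi.
rewrite -(sdotff fgi) sdotDl// (sdotC mu f) (sdotC mu g) !sdotDl//.
by rewrite !sdotff// (sdotC mu g f); ring.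
Qed.

Lemma L2enorm_i f : L2enorm mu (fun x => 'i%C * f x) = L2enorm mu f.
Proof.
rewrite /L2enorm; congr Lnorm; apply/funext => x; congr EFin.
by rewrite ComplexField.Normc.normcM /= expr0n expr1n add0r sqrtr1 mul1r.
Qed.

Lemma L2norm_sqrZ (c : R[i]) f : inL2 mu f ->
  L2norm mu (fun x => c * f x) ^+ 2 = abs2 c * L2norm mu f ^+ 2.
Proof.
move=> fi; have mf : cmeasurable f by have /inL2P[] := fi.
by have := N2Z mu c mf; rewrite (inL2_fin (inL2Z c fi)) (inL2_fin fi) => -[].
Qed.

(** The two triangle inequalities; it transfers the isometry from the dense class. *)
Lemma cvg_L2norm (f_ : nat -> T -> R[i]) f :
  (forall n, inL2 mu (f_ n)) -> inL2 mu f ->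
  L2enorm mu (fun x => f_ n x - f x) @[n --> \oo] --> 0%E ->
  L2norm mu (f_ n) @[n --> \oo] --> L2norm mu f.
Proof.
move=> fn fi /fine_cvg h.
have h0 : L2norm mu (fun x => f_ n x - f x) @[n --> \oo] --> (0 : R) by exact: h.
apply/cvgrPdist_le => e e0; near=> n.
have he : L2norm mu (fun x => f_ n x - f x) <= e.
  rewrite -[leLHS]ger0_norm ?L2norm_ge0//.
  by near: n; exact: (cvgr0_norm_le _ h0).
have hB := inL2B (fn n) fi.
have h1 : L2norm mu (f_ n) <= L2norm mu f + L2norm mu (fun x => f_ n x - f x).
  rewrite {1}(_ : f_ n = fun x => f x + (f_ n x - f x)); first exact: L2norm_triangle.
  by apply/funext => x; rewrite addrCA subrr addr0.
have h2 : L2norm mu f <= L2norm mu (f_ n) + L2norm mu (fun x => f_ n x - f x).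
  have hB' := inL2Z (-1) hB.
  have -> : L2norm mu (fun x => f_ n x - f x) = L2norm mu (fun x => (-1)%:C * (f_ n x - f x)).
    by rewrite L2normZ// normrN normr1 mul1r.
  rewrite {1}(_ : f = fun x => f_ n x + (-1)%:C * (f_ n x - f x)).
    by apply: L2norm_triangle => //; exact: inL2Z.
  apply/funext => x; rewrite (_ : (-1)%:C = -1 :> R[i]); first by ring.
  by rewrite rmorphN rmorph1.
rewrite ler_norml; lra.
Unshelve. all: by end_near. Qed.

End L2limits.

Section compact_support.
Context {R : realType}.
Local Notation mu := (@lebesgue_measure R).

Lemma coord_norm3 (x : R3 R) :
  [/\ `|x.1.1| <= norm3 x, `|x.1.2| <= norm3 x & `|x.2| <= norm3 x].
Proof.
have h (a b : R) : a ^+ 2 <= b -> `|a| <= Num.sqrt b.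
  by move=> ab; rewrite -sqrtr_sqr ler_wsqrtr.
have := sqr_ge0 x.1.1; have := sqr_ge0 x.1.2; have := sqr_ge0 x.2.
by move=> *; split; apply: h; rewrite /dot3 -!expr2; lra.
Qed.

(** A function supported in the cube of side 2 s is dominated there by a multiple of
    the product of the functions 1/(1 + x_i^2). *)
Lemma compact_support_bounded (f : R * R * R -> R) r : continuous f ->
  (forall x : R3 R, r < norm3 x -> f x = 0) ->
  exists M, (forall x, `|f x| <= M) /\ leb3s.-integrable setT (EFin \o (f : R3 R -> R)).
Proof.
move=> cf f0; pose s := `|r| + 1.
have s0 : - s <= s by rewrite /s; have := normr_ge0 r; lra.
pose A : set (R * R * R) := (`[- s, s]%classic `*` `[- s, s]%classic) `*` `[- s, s]%classic.
have cA : compact A by do 2 ?[apply: compact_setX]; exact: segment_compact.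
have A0 : A (0, 0, 0).
  by rewrite /A/= !in_itv/= oppr_le0 /s addr_ge0.
have out x : ~ A x -> f x = 0.
  move=> Ax; apply: f0; rewrite ltNge; apply/negP => xr; apply: Ax.
  have [h1 h2 h3] := coord_norm3 x; have rr := ler_norm r.
  by rewrite /A/= !in_itv/= -!ler_norml /s; split; [split|]; lra.
have cnf : continuous (fun x => `|f x|).
  by move=> x; apply: (cvg_comp f _ (cf x)); exact: norm_continuous.
have [c _ cM] := compact_EVT_max (ex_intro _ _ A0) cA (continuous_subspaceT cnf).
have fM x : `|f x| <= `|f c|.
  have [Ax|Ax] := pselect (A x); first by apply: cM; rewrite inE.
  by rewrite (out x Ax) normr0.
exists `|f c|; split => //.
have i1 := integrable_oneDsqr (1 + s ^+ 2) (measurableT : measurable [set: measurableTypeR R]).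
have i3 := integrableRZ measurableT `|f c| (integrable_prod3 i1 i1 i1).
apply: le_integrable i3 => //.
  by apply/measurable_EFinP; exact: continuous_measurable3.
move=> x _; rewrite lee_fin; apply: le_trans (ler_norm _).
have q (t : R) : 0 <= (1 + s ^+ 2) / (1 + t ^+ 2).
  by rewrite divr_ge0 ?addr_ge0 ?sqr_ge0.
have [Ax|Ax] := pselect (A x); last first.
  rewrite /= (out x Ax) normr0; apply: mulr_ge0 => //; apply: mulr_ge0 => //.
  exact: mulr_ge0.
apply: le_trans (fM x) _; rewrite ler_peMr//.
have q1 (t : R) : t \in `[- s, s] -> 1 <= (1 + s ^+ 2) / (1 + t ^+ 2).
  rewrite in_itv/= -ler_norml => ts.
  rewrite ler_pdivlMr ?mul1r ?lerD2l; last by have := sqr_ge0 t; lra.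
  by rewrite -(real_normK (num_real t)) lerXn2r// nnegrE (le_trans _ ts).
move: Ax => [[/= a1 a2] a3].
by apply: mulr_ege1; [apply: mulr_ege1|]; apply: q1.
Qed.

End compact_support.

Section fourier_isometry.
Context {R : realType}.
Local Notation mu := (@lebesgue_measure R).
Implicit Types v w g : R3 R -> R[i].
Local Notation F := (@fourier_integral R).

Let c0 : R := (2 * pi) `^ (- (3 / 2)).

Lemma ccs_bounded_integrable v : continuous_compact_support v -> exists M,
  [/\ (forall x, `|complex.Re (v x)| <= M) /\ (forall x, `|complex.Im (v x)| <= M),
      leb3s.-integrable setT (EFin \o (fun x => complex.Re (v x))),
      leb3s.-integrable setT (EFin \o (fun x => complex.Im (v x))) &
      cmeasurable v].
Proof.
move=> [c1 c2 [r vr]].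
have [x rx|M1 [b1 i1]] := compact_support_bounded (r := r) c1.
  by rewrite vr.
have [x rx|M2 [b2 i2]] := compact_support_bounded (r := r) c2.
  by rewrite vr.
exists (Num.max M1 M2); split => //.
- by split => x; rewrite le_max ?b1 ?b2 ?orbT.
- by split; exact: continuous_measurable3.
Qed.

Let re_int v xi := \int[leb3s]_(x in setT) (complex.Re (v x) * cos (dot3 xi x)
  + complex.Im (v x) * sin (dot3 xi x)).
Let im_int v xi := \int[leb3s]_(x in setT) (complex.Im (v x) * cos (dot3 xi x)
  - complex.Re (v x) * sin (dot3 xi x)).

Lemma fourier_integralE v xi :
  fourier_integral v xi = c0%:C * (re_int v xi +i* im_int v xi).
Proof.
apply: (congr1 (fun z => c0%:C * z)); apply: (congr2 (@Complex R)).
  by rewrite /re_int; apply: eq_Rintegral => x _; rewrite cReM /expmi /=; ring.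
by rewrite /im_int; apply: eq_Rintegral => x _; rewrite cImM /expmi /=; ring.
Qed.

Lemma poisson3_unit_ge0 (x : R3 R) : 0 <= poisson3_unit x.
Proof.
have h z : 0 <= poisson 1 z :> R by exact: poisson_ge0.
by apply: mulr_ge0 => //; exact: mulr_ge0.
Qed.

Lemma Rintegral_poisson3_unit : \int[leb3s]_(x in setT) poisson3_unit x = (2 * pi) ^+ 3 :> R.
Proof.
have i1 := @integrable_poisson1 R.
by rewrite (Rintegral_prod3 i1 i1 i1) Rintegral_poisson1 exprSr expr2.
Qed.

Lemma plancherel_ccs v : continuous_compact_support v ->
  [/\ cmeasurable (F v), N2 leb3 (F v) = N2 leb3 v & inL2 leb3 v].
Proof.
move=> cv; have [M [[b1 b2] i1 i2 mv]] := ccs_bounded_integrable cv; have [c1 c2 _] := cv.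
have md : measurable_fun setT (fun p : R3 R * R3 R => dot3 p.1 p.2).
  exact: measurable_dot3.
have mr : measurable_fun setT (re_int v).
  exact: (@measurable_FRe _ _ _ leb3s dot3 damping3 _ _ md damping3_gt0 integrable_damping3 mv.1 mv.2 i1 i2).
have mi : measurable_fun setT (im_int v).
  exact: (@measurable_FIm _ _ _ leb3s dot3 damping3 _ _ md damping3_gt0 integrable_damping3 mv.1 mv.2 i1 i2).
have mF : cmeasurable (F v).
  split.
    under eq_fun do rewrite fourier_integralE cReM /= mul0r subr0.
    exact: measurable_funM.
  under eq_fun do rewrite fourier_integralE cImM /= mul0r addr0.
  exact: measurable_funM.
have ik : leb3s.-integrable setT (EFin \o (poisson3_unit : R3 R -> R)).
  by apply: integrable_prod3; exact: integrable_poisson1.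
have P := @plancherel _ _ R leb3s dot3 damping3 poisson3 poisson3_unit shift3 _ _ M md damping3_gt0 integrable_damping3
  damping3_nd damping3_cvg cos_transform_damping3 measurable_poisson3 poisson3_unit_ge0 ik measurable_shift3 poisson3_shift mv.1 mv.2 i1 i2 b1 b2
  (fun x z => @shift3_cvg R _ x z c1) (fun x z => @shift3_cvg R _ x z c2).
have i3 := integrable_sqr_sum mv.1 mv.2 i1 i2 b1 b2.
have iN : (N2 leb3 v = (\int[leb3s]_(x in setT) (complex.Re (v x) ^+ 2 + complex.Im (v x) ^+ 2))%:E)%E.
  by rewrite /Rintegral fineK//; exact: (integrable_fin_num measurableT i3).
split => //; last by apply/inL2P; rewrite iN ltry.
have -> : F v = fun xi => c0%:C * (re_int v xi +i* im_int v xi).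
  by apply/funext => xi; exact: fourier_integralE.
rewrite N2Z//.
have -> : (N2 leb3 (fun xi => (re_int v xi +i* im_int v xi)%C) =
    (((\int[leb3s]_(x in setT) (complex.Re (v x) ^+ 2 + complex.Im (v x) ^+ 2))
      * (2 * pi) ^+ 3)%R)%:E)%E.
  rewrite -Rintegral_poisson3_unit; exact: P.
rewrite iN -EFinM; congr EFin; rewrite mulrCA -[RHS]mulr1; congr (_ * _).
rewrite /abs2/= expr0n addr0 -powR_mulrn ?powR_ge0// -powRrM.
rewrite -powR_mulrn ?mulr_ge0 ?pi_ge0// -powRD; last first.
  by rewrite mulf_neq0 ?implybT// gt_eqF// pi_gt0.
by rewrite (_ : _ + _ = 0) ?powRr0//; lra.
Qed.

Lemma fourier_integral_inL2 v : continuous_compact_support v -> inL2 leb3 (F v).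
Proof.
move=> cv; have [mF FE /inL2P[_ vf]] := plancherel_ccs cv.
by apply/inL2P; rewrite FE.
Qed.

(** Both norms are limits of the norms along an approximating sequence, where they
    agree by [plancherel_ccs]. *)
Lemma is_fourier_norm v g : is_fourier v g -> L2norm leb3 v = L2norm leb3 g.
Proof.
move=> [vi gi [w [cw wv Fg]]].
have h1 : L2norm leb3 (w n) @[n --> \oo] --> L2norm leb3 v.
  by apply: cvg_L2norm => // n; have [] := plancherel_ccs (cw n).
have h2 : L2norm leb3 (F (w n)) @[n --> \oo] --> L2norm leb3 g.
  by apply: cvg_L2norm => // n; exact: fourier_integral_inL2.
have E n : L2norm leb3 (w n) = L2norm leb3 (F (w n)).
  have [_ FE wi] := plancherel_ccs (cw n); apply/eqP.
  rewrite -(eqrXn2 (n := 2))// ?L2norm_ge0//; apply/eqP.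
  have := FE; rewrite (inL2_fin wi) (inL2_fin (fourier_integral_inL2 (cw n))).
  by case=> ->.
rewrite -(cvg_lim _ h1)// -(cvg_lim _ h2)//.
by rewrite (_ : (fun n => L2norm leb3 (w n)) = (fun n => L2norm leb3 (F (w n))))//; apply/funext.
Qed.

Lemma ccs_integrable v xi : continuous_compact_support v ->
  leb3s.-integrable setT (fun x => (complex.Re (v x) * cos (dot3 xi x)
    + complex.Im (v x) * sin (dot3 xi x))%:E) /\
  leb3s.-integrable setT (fun x => (complex.Im (v x) * cos (dot3 xi x)
    - complex.Re (v x) * sin (dot3 xi x))%:E).
Proof.
move=> /ccs_bounded_integrable[_ [_ v1 v2 mv]].
have mt : measurable_fun setT (dot3 xi).
  exact: (@measurable_dot3 R _ _ (fun=> xi) id).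
have mc : measurable_fun setT (fun x => cos (dot3 xi x)).
  by apply: measurableT_comp => //; apply: continuous_measurable_fun; exact: continuous_cos.
have ms : measurable_fun setT (fun x => sin (dot3 xi x)).
  by apply: measurableT_comp => //; apply: continuous_measurable_fun; exact: continuous_sin.
have ic (a b : R3 R -> R) : measurable_fun setT b -> (forall x, `|b x| <= 1) ->
    leb3s.-integrable setT (EFin \o a) ->
    leb3s.-integrable setT (fun x => (a x * b x)%:E).
  move=> mb b1 ai; have /integrableP[/measurable_EFinP ma _] := ai.
  apply: le_integrable ai => //; first by apply/measurable_EFinP; exact: measurable_funM.
  by move=> x _; rewrite lee_fin normrM ler_piMr.
have c1 x : `|cos (dot3 xi x)| <= 1 by rewrite ler_norml cos_geN1/= cos_le1.
have s1 x : `|sin (dot3 xi x)| <= 1 by rewrite ler_norml sin_geN1/= sin_le1.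
by split; [apply: integrableRD|apply: integrableRB] => //; exact: ic.
Qed.

Lemma fourier_integralD v w xi :
  continuous_compact_support v -> continuous_compact_support w ->
  F (fun x => v x + w x) xi = F v xi + F w xi.
Proof.
move=> /(ccs_integrable xi)[v1 v2] /(ccs_integrable xi)[w1 w2].
rewrite !fourier_integralE -mulrDr; congr (_ * _).
apply/eqP; rewrite eq_complex /= -(RintegralD measurableT v1 w1).
rewrite -(RintegralD measurableT v2 w2).
by apply/andP; split; apply/eqP; apply: eq_Rintegral => x _; rewrite ?cReD ?cImD; ring.
Qed.

Lemma fourier_integral_i v xi : continuous_compact_support v ->
  F (fun x => 'i%C * v x) xi = 'i%C * F v xi.
Proof.
move=> /(ccs_integrable xi)[v1 v2].
rewrite !fourier_integralE mulrCA; congr (_ * _); apply/eqP.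
rewrite eq_complex cReM cImM/= !mul0r !mul1r !add0r.
rewrite -mulN1r -(RintegralZl _ measurableT v2).
by apply/andP; split; apply/eqP; apply: eq_Rintegral => x _; rewrite ?cReM ?cImM/=; ring.
Qed.

Lemma ccsD v w : continuous_compact_support v -> continuous_compact_support w ->
  continuous_compact_support (fun x => v x + w x).
Proof.
move=> [v1 v2 [r vr]] [w1 w2 [s ws]]; split.
- rewrite (_ : (fun x => _) = (fun x : R * R * R =>
    complex.Re (v x) + complex.Re (w x))); last by apply/funext => x; rewrite cReD.
  by move=> x; apply: cvgD; [exact: v1|exact: w1].
- rewrite (_ : (fun x => _) = (fun x : R * R * R =>
    complex.Im (v x) + complex.Im (w x))); last by apply/funext => x; rewrite cImD.
  by move=> x; apply: cvgD; [exact: v2|exact: w2].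
- exists (Num.max r s) => x; rewrite gt_max => /andP[rx sx].
  by rewrite vr// ws// addr0.
Qed.

Lemma ccs_i v : continuous_compact_support v ->
  continuous_compact_support (fun x => 'i%C * v x).
Proof.
move=> [v1 v2 [r vr]]; split.
- rewrite (_ : (fun x => _) = (fun x : R * R * R => - complex.Im (v x))).
    by move=> x; apply: cvgN; exact: v2.
  by apply/funext => x; rewrite cReM/=; ring.
- rewrite (_ : (fun x => _) = (fun x : R * R * R => complex.Re (v x))) //.
  by apply/funext => x; rewrite cImM/=; ring.
- by exists r => x /vr ->; rewrite mulr0.
Qed.

Lemma cvg_L2enormD (f g : nat -> R3 R -> R[i]) :
  (forall n, inL2 leb3 (f n)) -> (forall n, inL2 leb3 (g n)) ->
  L2enorm leb3 (f n) @[n --> \oo] --> 0%E -> L2enorm leb3 (g n) @[n --> \oo] --> 0%E ->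
  L2enorm leb3 (fun x : R3 R => f n x + g n x) @[n --> \oo] --> 0%E.
Proof.
move=> fi gi f0 g0.
apply: (@squeeze_cvge _ _ _ _ (fun=> 0%E) _
  (fun n => L2enorm leb3 (f n) + L2enorm leb3 (g n))%E).
- apply: nearW => n; rewrite L2enorm_ge0/= !inL2_L2enorm//; last exact: inL2D.
  by rewrite -EFinD lee_fin L2norm_triangle.
- exact: cvg_cst.
- by rewrite -[X in _ --> X]adde0; apply: cvgeD.
Qed.

Lemma is_fourierD v w g h : is_fourier v g -> is_fourier w h ->
  is_fourier (fun x => v x + w x) (fun x => g x + h x).
Proof.
move=> [vi gi [a [ca av Fa]]] [wi hi [b [cb bw Fb]]].
have ai n : inL2 leb3 (a n) by have [] := plancherel_ccs (ca n).
have bi n : inL2 leb3 (b n) by have [] := plancherel_ccs (cb n).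
have Fai n := fourier_integral_inL2 (ca n); have Fbi n := fourier_integral_inL2 (cb n).
split; [exact: inL2D|exact: inL2D|exists (fun n x => a n x + b n x); split].
- by move=> n; exact: ccsD.
- rewrite (_ : (fun n => _) = (fun n => L2enorm leb3
    (fun x : R3 R => (a n x - v x) + (b n x - w x)))).
    by apply: cvg_L2enormD => // n; exact: inL2B.
  by apply/funext => n; congr L2enorm; apply/funext => x; ring.
- rewrite (_ : (fun n => _) = (fun n => L2enorm leb3
    (fun x : R3 R => (F (a n) x - g x) + (F (b n) x - h x)))).
    by apply: cvg_L2enormD => // n; exact: inL2B.
  apply/funext => n; congr L2enorm; apply/funext => x.
  by rewrite fourier_integralD//; ring.
Qed.

Lemma is_fourier_i v g : is_fourier v g ->
  is_fourier (fun x => 'i%C * v x) (fun x => 'i%C * g x).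
Proof.
move=> [vi gi [a [ca av Fa]]].
have ai n : inL2 leb3 (a n) by have [] := plancherel_ccs (ca n).
have Fai n := fourier_integral_inL2 (ca n).
have E (f h : R3 R -> R[i]) :
    L2enorm leb3 (fun x => 'i%C * f x - 'i%C * h x) = L2enorm leb3 (fun x => f x - h x).
  by rewrite -[RHS]L2enorm_i; congr L2enorm; apply/funext => x; rewrite mulrBr.
split; [exact: inL2Z|exact: inL2Z|exists (fun n x => 'i%C * a n x); split].
- by move=> n; exact: ccs_i.
- by rewrite (_ : (fun n => _) = (fun n => L2enorm leb3 (fun x : R3 R => a n x - v x)))//; apply/funext => n; exact: E.
- rewrite (_ : (fun n => _) = (fun n => L2enorm leb3 (fun x : R3 R => F (a n) x - g x)))//.
  apply/funext => n; rewrite -(E (F (a n)) g); congr L2enorm; apply/funext => x.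
  by rewrite fourier_integral_i.
Qed.

End fourier_isometry.

(** * Polar coordinates *)

Section norm3_facts.
Context {R : realType}.
Local Notation T1 := (measurableTypeR R).
Implicit Types x y : R3 R.

Lemma measurable_sqrt : measurable_fun setT (@Num.sqrt R : T1 -> T1).
Proof. exact: (continuous_measurable_fun (@sqrt_continuous R)). Qed.

Lemma measurable_norm3 : measurable_fun setT (norm3 : R3 R -> R).
Proof. by apply: (measurableT_comp measurable_sqrt); exact: measurable_dot3. Qed.

Lemma measurable_scale3 d (X : measurableType d) (f : X -> T1) (g : X -> R3 R) :
  measurable_fun setT f -> measurable_fun setT g ->
  measurable_fun setT (fun t => scale3 (f t) (g t)).
Proof.
move=> mf mg; apply: measurable_triple; apply: measurable_funM => //.
- exact: (measurableT_comp measurable_x1 mg).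
- exact: (measurableT_comp measurable_x2 mg).
- exact: (measurableT_comp measurable_x3 mg).
Qed.

Lemma norm3_ge0 x : 0 <= norm3 x. Proof. exact: sqrtr_ge0. Qed.

Lemma norm3_scale (t : R) x : 0 <= t -> norm3 (scale3 t x) = t * norm3 x.
Proof.
move=> t0; rewrite /norm3 -[X in _ = X * _](ger0_norm t0) -sqrtr_sqr -sqrtrM ?sqr_ge0//.
by congr Num.sqrt; rewrite /dot3/=; ring.
Qed.

Lemma norm3_eq0 x : norm3 x = 0 -> x = (0, 0, 0).
Proof.
have [h1 h2 h3] := coord_norm3 x => x0; move: h1 h2 h3; rewrite x0 !normr_le0.
by case: x {x0} => -[x1 x2] x3/= /eqP-> /eqP-> /eqP->.
Qed.

Lemma scale3A (s t : R) x : scale3 s (scale3 t x) = scale3 (s * t) x.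
Proof. by rewrite /scale3/= !mulrA. Qed.

Lemma leb3_origin : leb3 [set (0, 0, 0) : R3 R] = 0%E.
Proof.
have mp (t : R) : measurable ([set t] : set T1) by exact: measurable_set1.
pose o : set T1 := [set 0].
have -> : [set (0, 0, 0) : R3 R] = (o `*` o) `*` o.
  apply/seteqP; split => -[[a b] c] /=; first by case=> -> -> ->.
  by case=> -[-> ->] ->.
have mo : measurable o by exact: mp.
have moo : measurable (o `*` o) by exact: measurableX.
have h := @product_measure1E _ _ _ _ R (sprod (@lebesgue_measure R) (@lebesgue_measure R))
  (@lebesgue_measure R) (o `*` o) o moo mo.
have h0 : @lebesgue_measure R o = 0%E by exact: lebesgue_measure_set1.
apply: (etrans h); apply: etrans (mule0 (sprod (@lebesgue_measure R) (@lebesgue_measure R) (o `*` o))).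
exact: (congr1 (fun z => _ * z)%E h0).
Qed.

End norm3_facts.

Section restriction.
Context d (T : measurableType d) {R : realType} (mu : {measure set T -> \bar R}).
Variables (D : set T) (mD : measurable D).

Lemma ge0_integral_mrestr (f : T -> \bar R) : measurable_fun setT f ->
  (forall x, 0 <= f x)%E ->
  (\int[mrestr mu mD]_x f x = \int[mu]_(x in D) f x)%E.
Proof.
move=> mf f0; pose nu : {measure set T -> \bar R} := mrestr mu mD.
have N0 : nu (~` D) = 0%E by rewrite /nu/= /mrestr setICl measure0.
have := @ge0_negligible_integral _ _ _ nu setT (~` D) f (measurableC mD) measurableT mf
  (fun x _ => f0 x) N0.
rewrite setTD setCK => ->; apply: eq_measure_integral => A mA AD.
by rewrite /nu/= /mrestr; congr (mu _); apply/setIidl.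
Qed.

End restriction.

Section polar.
Context {R : realType}.
Local Notation mu := (@lebesgue_measure R).
Local Notation T1 := (measurableTypeR R).

Let B : set (R3 R) := [set x | 0 < norm3 x <= 1].
Let mB : measurable B.
Proof.
rewrite (_ : B = norm3 @^-1` `]0, 1]); last by apply/seteqP; split => x /=; rewrite in_itv.
by rewrite -[X in measurable X]setTI; apply: measurable_norm3.
Qed.

(** The surface measure is three times the image of Lebesgue measure on the punctured
    unit ball under radial projection. *)
Lemma integral_surface (f : R3 R -> \bar R) : measurable_fun setT f ->
  (forall x, 0 <= f x)%E ->
  (\int[surface]_w f w = 3%:E * \int[leb3]_(x in [set x | (0 < norm3 x <= 1)%R])
     f (scale3 (norm3 x)^-1 x))%E.
Proof.
move=> mf f0; pose dir (x : R3 R) := scale3 (norm3 x)^-1 x.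
have mdir : measurable_fun setT dir.
  apply: measurable_scale3 => //.
  exact: (measurableT_comp (measurable_inv measurableT) measurable_norm3).
pose k : {nonneg R} := NngNum (ler0n R 3).
pose nu1 : {measure set (R3 R) -> \bar R} := mrestr leb3 mB.
pose nu2'' : {measure set (R3 R) -> \bar R} := pushforward nu1 dir.
pose nu : {measure set (R3 R) -> \bar R} := mscale k (nu2'' mdir).
transitivity (\int[nu]_w f w)%E.
  apply: eq_measure_integral => A mA _.
  rewrite /nu/= /mscale/= /pushforward /nu1/= /mrestr /surface; congr (_ * leb3 _)%E.
  by apply/seteqP; split => x [].
have e1 := @ge0_integral_mscale _ _ R (nu2'' mdir) setT measurableT k f mf (fun x _ => f0 x).
have e2 := @ge0_integral_pushforward _ _ _ _ R dir mdir nu1 setT f measurableT mf (fun y _ => f0 y).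
have e3 := @ge0_integral_mrestr _ _ R leb3 B mB (f \o dir) (measurableT_comp mf mdir)
  (fun x => f0 (dir x)).
apply: (etrans e1); apply: (congr1 (fun z => 3%:E * z)%E).
by apply: (etrans e2); rewrite preimage_setT; exact: e3.
Qed.

(** The radial density that remains after the two rescalings in
    [polar_coordinates] has total mass one. *)
Lemma integral_tail (r : R) : 0 < r ->
  (\int[mu]_s (if (0 < s) && (r <= Num.sqrt s)
    then 3 / 2 * r ^+ 3 * (Num.sqrt s)^-1 ^+ 5 else 0)%:E = 1)%E.
Proof.
move=> r0; have a0 : 0 < r ^+ 2 by exact: exprn_gt0.
pose f (s : R) : R := 3 / 2 * r ^+ 3 * (Num.sqrt s)^-1 ^+ 5.
pose F (s : R) : R := - r ^+ 3 * (Num.sqrt s)^-1 ^+ 3.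
have cond (s : R) : (0 < s) && (r <= Num.sqrt s) = (r ^+ 2 <= s).
  rewrite -[X in X <= Num.sqrt s](ger0_norm (ltW r0)) -sqrtr_sqr; apply/andP/idP => [[s0]|rs].
    by rewrite ler_sqrt// ltW.
  by have s0 := lt_le_trans a0 rs; rewrite s0 ler_sqrt// ltW.
transitivity (\int[mu]_(s in `[(r ^+ 2)%R, +oo[%classic) (f s)%:E)%E.
  rewrite [RHS]integral_mkcond; apply: eq_integral => s _.
  rewrite cond patchE mem_setE in_itv/= andbT.
  by case: ifP.
have sq0 (s : R) : 0 < s -> 0 < Num.sqrt s by rewrite sqrtr_gt0.
have FD (s : R) : 0 < s -> is_derive s 1 F (f s).
  move=> s0; have d1 := is_derive1_sqrt s0.
  have n0 : Num.sqrt s != 0 by rewrite gt_eqF ?sq0.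
  have d2 := is_deriveV n0 d1.
  apply: is_derive_eq; rewrite /GRing.scale/= /f /= expr2.
  by field.
have cf (s : R) : 0 < s -> {for s, continuous f}.
  move=> s0; apply: cvgM; first exact: cvg_cst.
  have n0 : Num.sqrt s != 0 by rewrite gt_eqF ?sq0.
  have c1 : {for s, continuous (fun s : R => (Num.sqrt s)^-1)}.
    by apply: cvgV => //; exact: sqrt_continuous.
  apply: (cvg_comp (fun s : R => (Num.sqrt s)^-1) (fun y : R => y ^+ 5) c1).
  exact: exprn_continuous.
rewrite (@ge0_continuous_FTC2y R f F (r ^+ 2) 0).
- rewrite -EFinB /F sqrtr_sqr ger0_norm ?(ltW r0)//; congr EFin.
  by field; rewrite gt_eqF.
- by move=> x _; rewrite /f !mulr_ge0// ?exprn_ge0 ?invr_ge0 ?sqrtr_ge0 ?(ltW r0).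
- apply: continuous_in_subspaceT => x; rewrite inE/= in_itv/= andbT => rx.
  by apply: cf; exact: lt_le_trans rx.
- apply/cvgr0Pnorm_le => e e0; near=> s.
  have s1 : 1 <= s by near: s; exact: (nbhs_pinfty_ge (num_real _)).
  have se : r ^+ 3 / e <= s by near: s; exact: (nbhs_pinfty_ge (num_real _)).
  have s0 : 0 < s by exact: lt_le_trans s1.
  have q1 : 1 <= Num.sqrt s by rewrite -sqrtr1 ler_sqrt// ltW.
  rewrite /F normrM normrN (ger0_norm (exprn_ge0 _ (ltW r0))) exprVn ger0_norm; last first.
    by rewrite invr_ge0 exprn_ge0// sqrtr_ge0.
  rewrite ler_pdivrMr ?exprn_gt0 ?sq0//.
  rewrite [Num.sqrt s ^+ 3]exprSr sqr_sqrtr ?(ltW s0)//.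
  rewrite ler_pdivrMr// mulrC in se.
  by apply: (le_trans se); rewrite mulrA ler_peMr// mulr_ge0 ?ltW.
- by move=> x rx; have := FD x (lt_trans a0 rx); case.
- by apply: cvg_at_right_filter; apply: is_derive_continuous (FD _ a0).
- by move=> x; rewrite in_itv/= andbT => rx; apply: derive1_val (FD x (lt_trans a0 rx)).
Unshelve. all: by end_near. Qed.

(** By [integral_surface] the left-hand side is an integral over (l, x) with x in the
    unit ball.  Substituting l = s |x|^2 turns the point of evaluation into
    sqrt(s) x, and substituting y = sqrt(s) x turns it into y; what is left of the
    integral over s is [integral_tail].  Only one-dimensional affine substitutions
    and Tonelli's theorem are used. *)
Lemma polar_coordinates (h : R3 R -> \bar R) : measurable_fun setT h ->
  (forall x, 0 <= h x)%E ->
  measurable_fun setT (fun l : T1 => ((if (0 < l)%R then 2^-1 * Num.sqrt l else 0)%:E *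
     \int[surface]_w h (scale3 (Num.sqrt l) w))%E) /\
  (\int[mu]_l ((if (0 < l)%R then 2^-1 * Num.sqrt l else 0)%:E *
     \int[surface]_w h (scale3 (Num.sqrt l) w)) = \int[leb3]_x h x)%E.
Proof.
move=> mh h0.
pose G1 (p : T1 * R3 R) := ((if (0 < p.1) && (0 < norm3 p.2 <= 1)
  then 3 / 2 * Num.sqrt p.1 else 0)%:E
  * h (scale3 (Num.sqrt p.1 * (norm3 p.2)^-1) p.2))%E.
pose G2 (p : T1 * R3 R) := ((if (0 < p.1) && (0 < norm3 p.2 <= 1)
  then 3 / 2 * norm3 p.2 ^+ 3 * Num.sqrt p.1 else 0)%:E
  * h (scale3 (Num.sqrt p.1) p.2))%E.
pose G3 (p : T1 * R3 R) := ((if (0 < p.1) && (0 < norm3 p.2 <= Num.sqrt p.1)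
  then 3 / 2 * norm3 p.2 ^+ 3 * (Num.sqrt p.1)^-1 ^+ 5 else 0)%:E * h p.2)%E.
have ms : measurable_fun setT (fun p : T1 * R3 R => Num.sqrt p.1 : T1).
  exact: (measurableT_comp measurable_sqrt measurable_fst).
have mn : measurable_fun setT (fun p : T1 * R3 R => norm3 p.2 : T1).
  exact: (measurableT_comp measurable_norm3 measurable_snd).
have mnV : measurable_fun setT (fun p : T1 * R3 R => (norm3 p.2)^-1 : T1).
  exact: (measurableT_comp (measurable_inv measurableT)).
have msV : measurable_fun setT (fun p : T1 * R3 R => (Num.sqrt p.1)^-1 : T1).
  exact: (measurableT_comp (measurable_inv measurableT)).
have mc (b : T1 * R3 R -> R) : measurable_fun setT b ->
    measurable_fun setT (fun p : T1 * R3 R => (0 < p.1) && (0 < norm3 p.2 <= b p)).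
  move=> mb; apply: measurable_and.
    by apply: measurable_fun_ltr => //; exact: measurable_fst.
  by apply: measurable_and; [exact: measurable_fun_ltr|exact: measurable_fun_ler].
have mG1 : measurable_fun setT G1.
  apply: emeasurable_funM.
    apply/measurable_EFinP; apply: measurable_fun_ifT => //; first exact: mc.
    exact: measurable_funM.
  apply: (measurableT_comp mh); apply: measurable_scale3 => //.
  exact: measurable_funM.
have mG2 : measurable_fun setT G2.
  apply: emeasurable_funM.
    apply/measurable_EFinP; apply: measurable_fun_ifT => //; first exact: mc.
    apply: measurable_funM => //; apply: measurable_funM => //.
    exact: measurable_funX.
  by apply: (measurableT_comp mh); exact: measurable_scale3.
have mG3 : measurable_fun setT G3.
  apply: emeasurable_funM.
    apply/measurable_EFinP; apply: measurable_fun_ifT => //; first exact: mc.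
    apply: measurable_funM; last exact: measurable_funX.
    by apply: measurable_funM => //; exact: measurable_funX.
  exact: (measurableT_comp mh measurable_snd).
have G10 p : (0 <= G1 p)%E.
  by rewrite /G1 mule_ge0// lee_fin; case: ifP.
have G20 p : (0 <= G2 p)%E.
  rewrite /G2 mule_ge0// lee_fin; case: ifP => // _.
  by rewrite !mulr_ge0 ?exprn_ge0 ?norm3_ge0 ?sqrtr_ge0.
have G30 p : (0 <= G3 p)%E.
  rewrite /G3 mule_ge0// lee_fin; case: ifP => // _.
  by rewrite !mulr_ge0 ?exprn_ge0 ?norm3_ge0 ?invr_ge0 ?sqrtr_ge0.
have E1 l : ((if (0 < l)%R then 2^-1 * Num.sqrt l else 0)%:E *
     \int[surface]_w h (scale3 (Num.sqrt l) w) = \int[leb3s]_x G1 (l, x))%E.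
  case: (ltP 0 l) => l0; last first.
    rewrite mul0e; apply/esym/integral0_eq => x _.
    by rewrite /G1 /= ltNge l0 mul0e.
  have mhl : measurable_fun setT (fun w => h (scale3 (Num.sqrt l) w)).
    by apply: (measurableT_comp mh); exact: measurable_scale3.
  rewrite integral_surface// muleA -EFinM integral_mkcond.
  rewrite -ge0_integralZl//.
  - apply: eq_integral => x _; rewrite patchE /G1/= l0/=.
    rewrite (_ : x \in _ = (0 < norm3 x <= 1)); last by apply/idP/idP; rewrite inE.
    case: ifP => _; last by rewrite mule0 mul0e.
    rewrite scale3A; congr (_%:E * _)%E; ring.
  - apply/(measurable_restrictT _ mB); apply: measurable_funTS.
    apply: (measurableT_comp mh); apply: measurable_scale3 => //.
    apply: measurable_scale3 => //.
    exact: (measurableT_comp (measurable_inv measurableT) measurable_norm3).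
  - by move=> x _; rewrite patchE; case: ifP.
under eq_fun do rewrite E1.
split; first exact: (@measurable_fun_fubini_tonelli_F _ _ T1 (R3 R) R leb3s G1 mG1 G10).
rewrite (fubini_tonelli G1)//.
transitivity (\int[leb3s]_x \int[mu]_s G2 (s, x))%E.
  apply: eq_integral => x _.
  have [xB|xB] := boolP (0 < norm3 x <= 1); last first.
    transitivity (0 : \bar R)%E; [|symmetry]; apply: integral0_eq => s _.
      by rewrite /G1/= (negbTE xB) andbF mul0e.
    by rewrite /G2/= (negbTE xB) andbF mul0e.
  have x0 : 0 < norm3 x by case/andP: xB.
  have r0 : 0 < norm3 x ^+ 2 by exact: exprn_gt0.
  have mG1x : measurable_fun setT (fun l => G1 (l, x)).
    exact: (measurableT_comp mG1 (measurable_pair2 x)).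
  have E := @ge0_integral_affine R _ 0 (fun l => G1 (l, x)) r0 mG1x (fun l => G10 (l, x)).
  transitivity ((norm3 x ^+ 2)%:E * \int[mu]_s G1 ((0 + norm3 x ^+ 2 * s)%R, x))%E.
    by rewrite E muleA -EFinM mulfV ?gt_eqF// mul1e.
  rewrite -ge0_integralZl//; last by rewrite lee_fin ltW.
    apply: eq_integral => s _; rewrite /G1 /G2/= add0r xB !andbT pmulr_rgt0// muleA -EFinM.
    rewrite sqrtrM ?(ltW r0)// sqrtr_sqr (ger0_norm (ltW x0)) [_ * _ / norm3 x]mulrAC mulfV ?gt_eqF// mul1r.
    by congr (_%:E * _)%E; case: ifP => _; ring.
  by apply: (measurableT_comp mG1x); exact: measurable_affine.
rewrite -(fubini_tonelli G2)//.
transitivity (\int[mu]_s \int[leb3s]_x G3 (s, x))%E.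
  apply: eq_integral => s _; case: (ltP 0 s) => s0; last first.
    transitivity (0 : \bar R)%E; [|symmetry]; apply: integral0_eq => x _.
      by rewrite /G2 /= ltNge s0 mul0e.
    by rewrite /G3 /= ltNge s0 mul0e.
  have q0 : 0 < Num.sqrt s by rewrite sqrtr_gt0.
  pose f (y : R3 R) := ((if 0 < norm3 y <= Num.sqrt s
    then 3 / 2 * (norm3 y / Num.sqrt s) ^+ 3 * Num.sqrt s else 0)%:E * h y)%E.
  have mf : measurable_fun setT f.
    apply: emeasurable_funM => //; apply/measurable_EFinP.
    apply: measurable_fun_ifT => //.
      by apply: measurable_and; [apply: measurable_fun_ltr|apply: measurable_fun_ler] => //;
        exact: measurable_norm3.
    apply: measurable_funM => //; apply: measurable_funM => //; apply: measurable_funX.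
    by apply: measurable_funM => //; exact: measurable_norm3.
  have f0 y : (0 <= f y)%E.
    rewrite /f mule_ge0// lee_fin; case: ifP => // _.
    by rewrite !mulr_ge0 ?exprn_ge0 ?divr_ge0 ?norm3_ge0 ?sqrtr_ge0.
  transitivity (\int[leb3s]_x f (scale3 (Num.sqrt s) x))%E.
    apply: eq_integral => x _; rewrite /G2 /f/= s0/= norm3_scale ?(ltW q0)//.
    rewrite pmulr_rgt0// ger_pMr//; congr ((if _ then _ else _)%:E * _)%E.
    by rewrite [_ * _ / Num.sqrt s]mulrAC mulfV ?gt_eqF// mul1r.
  have E := @transport_prod3 R (fun t => 0 + Num.sqrt s * t) (fun t => 0 + Num.sqrt s * t)
    (fun t => 0 + Num.sqrt s * t) (Num.sqrt s)^-1.
  have Ef := E _ (measurable_affine _ _) (measurable_affine _ _) (measurable_affine _ _)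
   (fun f mf f0 => ge0_integral_affine _ q0 mf f0)
   (fun f mf f0 => ge0_integral_affine _ q0 mf f0)
   (fun f mf f0 => ge0_integral_affine _ q0 mf f0) f mf f0.
  transitivity (\int[leb3s]_x f (0 + Num.sqrt s * x.1.1, 0 + Num.sqrt s * x.1.2,
      0 + Num.sqrt s * x.2)%R)%E.
    by apply: eq_integral => x _; rewrite !add0r.
  rewrite Ef ?invr_ge0 ?(ltW q0)// -ge0_integralZl//.
  apply: eq_integral => x _; rewrite /G3 /f/= s0/= muleA -EFinM; congr (_%:E * _)%E.
  by case: ifP => _; [field; rewrite gt_eqF|rewrite mulr0].
rewrite (fubini_tonelli G3)//.
have n000 : norm3 ((0, 0, 0) : R3 R) = 0 by rewrite /norm3 /dot3/= !mulr0 !addr0 sqrtr0.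
have mO : measurable [set (0, 0, 0) : R3 R].
  rewrite (_ : [set _] = norm3 @^-1` [set 0]).
    by rewrite -[X in measurable X]setTI; apply: measurable_norm3.
  by apply/seteqP; split => x /=; [move=> ->|exact: norm3_eq0].
transitivity (\int[leb3s]_(x in setT `\` [set (0, 0, 0)%R]) h x)%E; last first.
  by apply/esym/ge0_negligible_integral => //; exact: leb3_origin.
rewrite [RHS]integral_mkcond; apply: eq_integral => x _; rewrite patchE.
have [->|x0] := eqVneq x (0, 0, 0).
  rewrite memNset; last by move=> [_ /(_ erefl)].
  by apply: integral0_eq => s _; rewrite /G3/= n000 ltxx andbF mul0e.
rewrite mem_set; last by split => //; exact/eqP.
have r0 : 0 < norm3 x.
  rewrite lt_neqAle norm3_ge0 andbT eq_sym; apply: contra_neq x0; exact: norm3_eq0.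
transitivity (\int[mu]_s ((if (0 < s) && (norm3 x <= Num.sqrt s)
    then 3 / 2 * norm3 x ^+ 3 * (Num.sqrt s)^-1 ^+ 5 else 0)%:E * h x))%E.
  by apply: eq_integral => s _; rewrite /G3/= r0.
rewrite ge0_integralZr//.
- by rewrite integral_tail// mul1e.
- apply/measurable_EFinP; apply: measurable_fun_ifT => //.
    apply: measurable_and; first by apply: measurable_fun_ltr => //.
    by apply: measurable_fun_ler => //; exact: measurable_sqrt.
  apply: measurable_funM => //; apply: measurable_funX.
  exact: (measurableT_comp (measurable_inv measurableT) measurable_sqrt).
- move=> s _; rewrite lee_fin; case: ifP => // _.
  by rewrite !mulr_ge0 ?exprn_ge0 ?invr_ge0 ?norm3_ge0 ?sqrtr_ge0.
Qed.

End polar.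

(** * Norms and inner products in terms of traces *)

Section trace_norm.
Context {R : realType}.
Local Notation mu := (@lebesgue_measure R).
Local Notation T1 := (measurableTypeR R).
Local Notation halfline := (`]0%R, +oo[%classic : set (measurableTypeR R)).
Implicit Types (v w : R3 R -> R[i]) (V W : R -> R3 R -> R[i]).

Lemma ae_neq (a : R) : {ae mu, forall l : T1, l != a}.
Proof.
exists [set a]; split; first exact: measurable_set1.
  exact: lebesgue_measure_set1.
by move=> l /=; case: eqP.
Qed.

(** The normalization of the trace matches the density of [polar_coordinates]. *)
Lemma abs2_trace_factor (l : R) : 0 < l ->
  abs2 ((2 `^ (- (1 / 2)) * l `^ (1 / 4))%:C : R[i]) = 2^-1 * Num.sqrt l.
Proof.
move=> l0; rewrite /abs2/= expr0n addr0 exprMn -!powR_mulrn ?powR_ge0// -!powRrM.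
rewrite (_ : - (1 / 2) * 2 = -1); last by lra.
rewrite (_ : 1 / 4 * 2 = 2^-1); last by lra.
by rewrite powR_inv1// powR12_sqrt// ltW.
Qed.

(** The exceptional energy [a] is allowed for the sake of traces that are divided by
    [l - a]. *)
Lemma N2_trace v V (a : R) (N : R -> R) : is_trace v V ->
  measurable_fun setT (N : T1 -> T1) ->
  (forall l, 0 < l -> l != a -> inL2 surface (V l) /\ N2 surface (V l) = (N l)%:E) ->
  (N2 leb3 v = \int[mu]_(l in halfline) (N l)%:E)%E.
Proof.
move=> [g fg Vg] mN VN; have [vi gi _] := fg.
have -> : N2 leb3 v = N2 leb3 g by rewrite !inL2_fin// (is_fourier_norm fg).
have /inL2P[mg _] := gi.
have mh : measurable_fun setT (fun x => (abs2 (g x))%:E).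
  by apply/measurable_EFinP; exact: measurable_abs2.
have [mP P] := polar_coordinates mh (fun x => abs2_ge0 (g x)).
rewrite /N2 -P [RHS]integral_mkcond; apply: ae_eq_integral => //.
  apply/(measurable_restrictT _ _).1 => //; apply: measurable_funTS.
  exact/measurable_EFinP.
have := Vg; have := ae_neq a; apply: filterS2 => l la Vl _.
rewrite patchE mem_setE in_itv/= andbT; case: (ltP 0 l) => l0; last first.
  by rewrite mul0e.
have [/inL2P[mV _] <-] := VN l l0 la.
have mgl : cmeasurable (fun y : R3 R => g (scale3 (Num.sqrt l) y)).
  by split; [apply: (measurableT_comp mg.1)|apply: (measurableT_comp mg.2)];
    exact: measurable_scale3.
rewrite -abs2_trace_factor// -N2Z//.
apply: ge0_ae_eq_integral => //.
- by apply/measurable_EFinP; apply: measurable_abs2; exact: cmeasurableZ.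
- by apply/measurable_EFinP; exact: measurable_abs2.
- by move=> w _; rewrite lee_fin abs2_ge0.
- by move=> w _; rewrite lee_fin abs2_ge0.
- by have := Vl l0; apply: filterS => w -> _.
Qed.

(** Applying [N2_trace] to both N and its absolute value yields integrability without
    a sign condition at the exceptional energy. *)
Lemma trace_norm v V (a : R) (N : R -> R) : is_trace v V ->
  measurable_fun setT (N : T1 -> T1) ->
  (forall l, 0 < l -> l != a ->
    inL2 surface (V l) /\ L2norm surface (V l) ^+ 2 = N l) ->
  mu.-integrable halfline (EFin \o N) /\
  L2norm leb3 v ^+ 2 = \int[mu]_(l in halfline) N l.
Proof.
move=> tv mN VN; have [g [vi _ _] _] := tv.
have E : (N2 leb3 v = \int[mu]_(l in halfline) (N l)%:E)%E.
  apply: (N2_trace (a := a) tv mN) => l l0 la; have [Vi <-] := VN l l0 la.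
  by split => //; exact: inL2_fin.
have E' : (N2 leb3 v = \int[mu]_(l in halfline) `|N l|%:E)%E.
  apply: (N2_trace (a := a) tv (N := fun l => `|N l|)).
    exact: (measurableT_comp (@normr_measurable R setT) mN).
  move=> l l0 la; have [Vi <-] := VN l l0 la.
  by split => //; rewrite ger0_norm ?sqr_ge0//; exact: inL2_fin.
split.
  apply/integrableP; split.
    by apply: measurable_funTS; exact/measurable_EFinP.
  by rewrite -E'; have /inL2P[] := vi.
by rewrite /Rintegral -E (inL2_fin vi).
Qed.

Let fleb : Filter (almost_everywhere (@leb R)).
Proof. exact: ae_filter_ringOfSetsType. Qed.
Let fsurf : Filter (almost_everywhere (@surface R)).
Proof. exact: ae_filter_ringOfSetsType. Qed.

Lemma is_traceD v w V W : is_trace v V -> is_trace w W ->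
  is_trace (fun x => v x + w x) (fun l x => V l x + W l x).
Proof.
move=> [g fg Vg] [h fh Wh]; exists (fun x => g x + h x); first exact: is_fourierD.
move: Vg Wh; apply: (@filterS2 _ _ fleb) => l Vl Wl l0.
by move: (Vl l0) (Wl l0); apply: (@filterS2 _ _ fsurf) => x -> ->; rewrite mulrDr.
Qed.

Lemma is_trace_i v V : is_trace v V ->
  is_trace (fun x => 'i%C * v x) (fun l x => 'i%C * V l x).
Proof.
move=> [g fg Vg]; exists (fun x => 'i%C * g x); first exact: is_fourier_i.
move: Vg; apply: (@filterS _ _ fleb) => l Vl l0.
by move: (Vl l0); apply: (@filterS _ _ fsurf) => x ->; rewrite mulrCA.
Qed.

(** Polarization of [trace_norm]. *)
Lemma trace_sdot v w V W (a : R) (N M S : R -> R) : is_trace v V -> is_trace w W ->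
  measurable_fun setT (N : T1 -> T1) -> measurable_fun setT (M : T1 -> T1) ->
  measurable_fun setT (S : T1 -> T1) ->
  (forall l, 0 < l -> l != a ->
    inL2 surface (V l) /\ L2norm surface (V l) ^+ 2 = N l) ->
  (forall l, 0 < l -> l != a ->
    inL2 surface (W l) /\ L2norm surface (W l) ^+ 2 = M l) ->
  (forall l, 0 < l -> l != a -> sdot surface (V l) (W l) = S l) ->
  mu.-integrable halfline (EFin \o S) /\
  sdot leb3 v w = \int[mu]_(l in halfline) S l.
Proof.
move=> tv tw mN mM mS VN WM VWS.
have mH : measurable halfline by [].
have [g [vi _ _] _] := tv; have [h [wi _ _] _] := tw.
have [iN EN] := trace_norm tv mN VN; have [iM EM] := trace_norm tw mM WM.
have mNM : measurable_fun setT (fun l : T1 => N l + M l + 2 * S l : T1).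
  by apply: measurable_funD; [exact: measurable_funD|exact: measurable_funM].
have [|iS ES] := trace_norm (a := a) (is_traceD tv tw) mNM.
  move=> l l0 la; have [Vi <-] := VN l l0 la; have [Wi <-] := WM l l0 la.
  by split; [exact: inL2D|rewrite -(VWS l l0 la) L2norm_sqrD].
have iNM := integrableRD mH iN iM.
have iS2 := integrableRB mH iS iNM.
have iSS : mu.-integrable halfline (EFin \o S).
  have := integrableRZ mH 2^-1 iS2; apply: eq_integrable => // l _ /=.
  by congr EFin; field.
split => //.
have := L2norm_sqrD vi wi; rewrite ES EN EM => E.
have : 2 * sdot leb3 v w = 2 * \int[mu]_(l in halfline) S l.
  rewrite -(RintegralZl 2 mH iSS).
  transitivity (\int[mu]_(l in halfline) (N l + M l + 2 * S l - (N l + M l))).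
    by rewrite (RintegralB mH iS iNM) (RintegralD mH iN iM) E; ring.
  by apply: eq_Rintegral => l _; ring.
by move/(mulfI _); apply.
Qed.

End trace_norm.

(** * The matrix B and its determinant *)

Section hermitian.
Context d {T : measurableType d} {R : realType}.
Variable mu : {measure set T -> \bar R}.
Implicit Types f g : T -> R[i].

Lemma L2norm_i f : L2norm mu (fun x => 'i%C * f x) = L2norm mu f.
Proof. by rewrite /L2norm L2enorm_i. Qed.

Lemma sdot_i_anti f g : inL2 mu f -> inL2 mu g ->
  sdot mu f (fun x => 'i%C * g x) = - sdot mu g (fun x => 'i%C * f x).
Proof.
move=> fi gi; have h := integrable_rdot gi (inL2Z 'i%C fi).
rewrite -mulN1r -(RintegralZl _ measurableT h); apply: eq_Rintegral => x _.
by rewrite /rdot !reimE/=; ring.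
Qed.

(** This is the squared norm of g - (s - i t) f. *)
Lemma hermitian_square_ge0 f g (s t : R) : inL2 mu f -> inL2 mu g ->
  0 <= L2norm mu g ^+ 2 - 2 * (s * sdot mu f g + t * sdot mu f (fun x => 'i%C * g x))
    + (s ^+ 2 + t ^+ 2) * L2norm mu f ^+ 2.
Proof.
move=> fi gi; pose c : R[i] := (- s) +i* t.
have := sqr_ge0 (L2norm mu (fun x => g x + c * f x)).
rewrite (L2norm_sqrD gi (inL2Z c fi)) (L2norm_sqrZ c fi) /abs2/= sqrrN.
have h1 := integrableRZ measurableT (- s) (integrable_rdot fi gi).
have h2 := integrableRZ measurableT (- t) (integrable_rdot fi (inL2Z 'i%C gi)).
have -> : sdot mu g (fun x => c * f x) =
    - s * sdot mu f g + - t * sdot mu f (fun x => 'i%C * g x).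
  rewrite /sdot -(RintegralZl _ measurableT (integrable_rdot fi gi)).
  rewrite -(RintegralZl _ measurableT (integrable_rdot fi (inL2Z 'i%C gi))).
  rewrite -(RintegralD measurableT h1 h2); apply: eq_Rintegral => x _.
  by rewrite /rdot !reimE/=; ring.
by move=> h; apply: (le_trans h); rewrite le_eqVlt; apply/orP; left; apply/eqP; ring.
Qed.

Lemma smooth_family_i (V : nat -> R -> T -> R[i]) : smooth_family mu V ->
  smooth_family mu (fun k l w => 'i%C * V k l w).
Proof.
move=> [iV dV zV yV]; split.
- by move=> k l l0; exact/inL2Z/iV.
- move=> k l l0; have := dV k l l0; apply: cvg_trans.
  rewrite (_ : (fun h => _) = (fun h => L2enorm mu (fun w : T =>
    (h^-1)%:C * (V k (l + h) w - V k l w) - V k.+1 l w)))//.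
  apply/funext => h; rewrite -[RHS]L2enorm_i; congr L2enorm; apply/funext => w.
  by ring.
- by move=> k N; under eq_fun do rewrite L2norm_i; exact: zV.
- by move=> k N; under eq_fun do rewrite L2norm_i; exact: yV.
Qed.

End hermitian.

Section extension.
Context {R : realType}.
Local Notation mu := (@lebesgue_measure R).
Local Notation halfline := (`]0%R, +oo[%classic : set (measurableTypeR R)).

Let patchE0 (f : R -> R) : (forall l, l <= 0 -> f l = 0) -> f \_ halfline = f.
Proof.
move=> f0; apply/funext => l; rewrite patchE mem_setE in_itv/= andbT.
by case: ltP => // /f0 ->.
Qed.

Lemma integrable_halfline (f : R -> R) : (forall l, l <= 0 -> f l = 0) ->
  mu.-integrable halfline (EFin \o f) -> mu.-integrable setT (EFin \o f).
Proof.
move=> f0 fi; rewrite -(patchE0 f0) -restrict_EFin.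
by apply/(integrable_mkcond _ _).1.
Qed.

Lemma Rintegral_halfline (f : R -> R) : (forall l, l <= 0 -> f l = 0) ->
  \int[mu]_(l in halfline) f l = \int[mu]_l f l.
Proof. by move=> f0; rewrite Rintegral_mkcond patchE0. Qed.

End extension.

Section eta_entries.
Context {R : realType}.
Local Notation mu := (@lebesgue_measure R).
Variables (u : 'I_2 -> R3 R -> R[i]).
Hypothesis Eu : forall j, calE (u j).

Let V j := dtrace (u j).
Let iV j := fun k (l : R) (w : R3 R) => 'i%C * V j k l w.

Lemma smooth_dtrace j : smooth_trace (u j) (V j).
Proof.
have [_ [W HW]] := Eu j.
exact: (xgetPex (fun _ _ _ => 0) (ex_intro _ W HW)).
Qed.

Let SV j : smooth_family surface (V j).
Proof. by have [i1 _ d1 z1 y1] := smooth_dtrace j; split. Qed.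
Let SiV j : smooth_family surface (iV j). Proof. exact: smooth_family_i. Qed.

(** The two parts of [eta], in a form to which the calculus of [ext_dot] applies. *)
Definition eta_re (j k : 'I_2) : R -> R := ext_dot surface (V j) (V k) 0 0.
Definition eta_im (j k : 'I_2) : R -> R := ext_dot surface (V j) (iV k) 0 0.

Lemma etaE j k l : Defs.eta (u j) (u k) l = eta_re j k l +i* eta_im j k l.
Proof.
rewrite /Defs.eta /eta_re /eta_im /ext_dot; case: ifP => // _.
by rewrite L2dotE.
Qed.

Lemma Schwartz_eta_re j k : Schwartz (eta_re j k). Proof. exact: Schwartz_ext_dot. Qed.
Lemma Schwartz_eta_im j k : Schwartz (eta_im j k). Proof. exact: Schwartz_ext_dot. Qed.

Lemma eta_reC j k : eta_re j k = eta_re k j.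
Proof. by apply/funext => l; rewrite /eta_re /ext_dot sdotC. Qed.

Lemma eta_imC j k : eta_im j k = fun l => -1 * eta_im k j l.
Proof.
apply/funext => l; have [l0|l0] := boolP (0 <= l); last first.
  rewrite /eta_im !ext_dot_le0 ?mulr0//; rewrite -ltNge in l0; exact: ltW.
rewrite /eta_im /ext_dot l0.
rewrite mulN1r; apply: sdot_i_anti.
  by have [h _ _ _] := SV j; exact: h.
by have [h _ _ _] := SV k; exact: h.
Qed.

Lemma gammaE j k l : gamma (Defs.eta (u j) (u k)) l = pv (eta_re j k) l +i* pv (eta_im j k) l.
Proof.
rewrite -(principal_value_pv l (Schwartz_eta_re j k 1)).
rewrite -(principal_value_pv l (Schwartz_eta_im j k 1)).
have hr : (fun x => complex.Re (Defs.eta (u j) (u k) x)) = eta_re j k.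
  by apply/funext => x; rewrite etaE.
have hi : (fun x => complex.Im (Defs.eta (u j) (u k) x)) = eta_im j k.
  by apply/funext => x; rewrite etaE.
by rewrite /gamma hr hi.
Qed.

Lemma pv_eta_imC j k l : pv (eta_im j k) l = - pv (eta_im k j) l.
Proof. by rewrite eta_imC pvN//; exact: Schwartz_eta_im. Qed.

(** The parts of [eta] being Schwartz, [gamma] may be computed by [pv]. *)
Lemma BmxE a l j k : Bmx u a l j k =
  ((j == k)%:R + a * (pv (eta_re k j) l - pi * eta_im k j l)) +i*
  (a * (pv (eta_im k j) l + pi * eta_re k j l)).
Proof.
rewrite /Bmx mxE [Cmx _ _ _ _ _]mxE [X in _ + X]mxE [Dmx _ _ _ _ _]mxE gammaE etaE.
move: (pv (eta_re k j) l) (pv (eta_im k j) l) (eta_re k j l) (eta_im k j l) pi.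
move=> x y p r c; case: (j == k); apply/eqP; rewrite eq_complex/=;
  by apply/andP; split; apply/eqP; ring.
Qed.

End eta_entries.

Section two_by_two.
Context {R : realType}.
Variables (M : 'M[R[i]]_2) (a c : R) (x y p q : 'I_2 -> 'I_2 -> R).
Hypotheses (xC : forall j k, x j k = x k j) (yC : forall j k, y j k = - y k j).
Hypotheses (pC : forall j k, p j k = p k j) (qC : forall j k, q j k = - q k j).
Hypothesis ME : forall j k, M j k =
  ((j == k)%:R + a * (x k j - c * q k j)) +i* (a * (y k j + c * p k j)).

Let y0 j : y j j = 0. Proof. have := yC j j; lra. Qed.
Let q0 j : q j j = 0. Proof. have := qC j j; lra. Qed.

(** M = C + i D where C = 1 + a (x + i y) and D = a c (p + i q), both transposed, are
    Hermitian; the mixed terms of the product of the off-diagonal entries add up to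
    an imaginary number. *)
Lemma Re_det_dissipative : complex.Re (\det M) = 1 + a * (x 0 0 + x 1 1)
  + a ^+ 2 * (x 0 0 * x 1 1 - (x 0 1 ^+ 2 + y 0 1 ^+ 2)
              - c ^+ 2 * (p 0 0 * p 1 1 - (p 0 1 ^+ 2 + q 0 1 ^+ 2))).
Proof.
rewrite det_mx2 !ME !y0 !q0 (yC 1 0) (qC 1 0) (xC 1 0) (pC 1 0) /=.
ring.
Qed.

(** Comparing the two off-diagonal entries separates the Hermitian part from the
    anti-Hermitian one; that [a] is nonzero follows from the diagonal. *)
Lemma dissipative_eq0 : c != 0 -> M = 0 ->
  [/\ 1 + a * x 0 0 = 0, 1 + a * x 1 1 = 0, x 0 1 = 0 & y 0 1 = 0] /\
  [/\ p 0 0 = 0, p 1 1 = 0, p 0 1 = 0 & q 0 1 = 0].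
Proof.
move=> c0 M0.
have E00 := ME 0 0; have E11 := ME 1 1; have E01 := ME 0 1; have E10 := ME 1 0.
move: E00 E11 E01 E10; rewrite M0 !mxE !y0 !q0 (yC 1 0) (qC 1 0) (xC 1 0) (pC 1 0) /=.
move=> [h1 h2] [h3 h4] [h5 h6] [h7 h8].
have a0 : a != 0.
  by apply/eqP => a0; move: h1; rewrite a0 !mul0r addr0 => /eqP; rewrite eq_sym oner_eq0.
have ka (t : R) : 0 = a * t -> t = 0.
  by move=> /esym/eqP; rewrite mulf_eq0 (negbTE a0) => /eqP.
have kc (t : R) : c * t = 0 -> t = 0.
  by move=> /eqP; rewrite mulf_eq0 (negbTE c0) => /eqP.
have k2 := ka _ h2; have k4 := ka _ h4; have k6 := ka _ h6; have k8 := ka _ h8.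
have k5 := ka _ (etrans h5 (add0r _)); have k7 := ka _ (etrans h7 (add0r _)).
move: k2 k4 k5 k6 k7 k8; rewrite ?mulrN => k2 k4 k5 k6 k7 k8.
by split; split; [lra|lra|lra|lra|apply: kc; lra|apply: kc; lra|apply: kc; lra|apply: kc; lra].
Qed.

End two_by_two.

(** * Identification of F_1 and conclusion *)

Section traces_of_u.
Context {R : realType}.
Local Notation mu := (@lebesgue_measure R).
Local Notation T1 := (measurableTypeR R).
Local Notation halfline := (`]0%R, +oo[%classic : set (measurableTypeR R)).
Variables (u : 'I_2 -> R3 R -> R[i]).
Hypothesis Eu : forall j, calE (u j).

Let V j := dtrace (u j) 0.
Let fr := eta_re u.
Let fi := eta_im u.

Let inV j l : 0 < l -> inL2 surface (V j l).
Proof. by move=> l0; have [h _ _ _ _] := smooth_dtrace Eu j; apply: h; exact: ltW. Qed.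

Let xsym l j k : pv (fr j k) l = pv (fr k j) l. Proof. by rewrite /fr eta_reC. Qed.
Let ysym l j k : pv (fi j k) l = - pv (fi k j) l. Proof. exact: pv_eta_imC. Qed.
Let psym l j k : fr j k l = fr k j l. Proof. by rewrite /fr eta_reC. Qed.
Let qsym l j k : fi j k l = - fi k j l.
Proof. by rewrite -mulN1r; exact: (congr1 (@^~ l) (eta_imC Eu j k)). Qed.

Lemma F1E : F1 u = (fun q : R * R => 1 + q.1 * lin_coef (fr 0 0) (fr 1 1) q.2
  + q.1 ^+ 2 * quad_coef (fr 0 0) (fr 1 1) (fr 0 1) (fi 0 1) q.2).
Proof.
apply/funext => -[a l].
exact: (Re_det_dissipative (xsym l) (ysym l) (psym l) (qsym l) (BmxE Eu a l)).
Qed.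

Lemma eta_le0 j k l : l <= 0 -> fr j k l = 0 /\ fi j k l = 0.
Proof.
move=> l0; have SV i : smooth_family surface (dtrace (u i)).
  by have [i1 _ d1 z1 y1] := smooth_dtrace Eu i; split.
have SiV i := smooth_family_i (SV i).
by rewrite /fr /fi /eta_re /eta_im !ext_dot_le0.
Qed.

Lemma eta_gt0 j k l : 0 < l -> fr j k l = sdot surface (V j l) (V k l) /\
  fi j k l = sdot surface (V j l) (fun w => 'i%C * V k l w).
Proof. by move=> /ltW l0; rewrite /fr /fi /eta_re /eta_im /ext_dot l0. Qed.

Lemma eta_diag_ge0 j l : 0 <= fr j j l.
Proof.
have [l0|l0] := leP l 0; first by rewrite (eta_le0 j j l0).1.
by rewrite (eta_gt0 j j l0).1 sdotff ?sqr_ge0//; exact: inV.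
Qed.

Lemma eta_form_ge0 s t l :
  0 <= fr 1 1 l - 2 * (s * fr 0 1 l + t * fi 0 1 l) + (s ^+ 2 + t ^+ 2) * fr 0 0 l.
Proof.
have [l0|l0] := leP l 0.
  rewrite (eta_le0 1 1 l0).1 (eta_le0 0 0 l0).1 (eta_le0 0 1 l0).1 (eta_le0 0 1 l0).2.
  by rewrite !(mulr0, addr0, subr0).
rewrite (eta_gt0 1 1 l0).1 (eta_gt0 0 0 l0).1 (eta_gt0 0 1 l0).1 (eta_gt0 0 1 l0).2.
rewrite !sdotff//; try exact: inV.
by apply: hermitian_square_ge0; exact: inV.
Qed.

Lemma measurable_eta j k : measurable_fun setT (fr j k : T1 -> T1) /\
  measurable_fun setT (fi j k : T1 -> T1).
Proof.
split; apply: continuous_measurable_fun.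
  exact: (Sch_continuous (Schwartz_eta_re Eu j k 0)).
exact: (Sch_continuous (Schwartz_eta_im Eu j k 0)).
Qed.

(** With the weight c = 1 this concerns u_1 and u_2, with c(l) = 1/(l - lambda0) it
    concerns phi_1 and phi_2. *)
Lemma weighted_dot x y (X Y : R -> R3 R -> R[i]) (a : R) (c : R -> R) j k :
  is_trace x X -> is_trace y Y -> measurable_fun setT (c : T1 -> T1) ->
  (forall l, 0 < l -> l != a -> X l = fun w => (c l)%:C * V j l w) ->
  (forall l, 0 < l -> l != a -> Y l = fun w => (c l)%:C * V k l w) ->
  [/\ mu.-integrable setT (fun l => (fr j j l * c l ^+ 2)%:E),
      L2norm leb3 x ^+ 2 = \int[mu]_l (fr j j l * c l ^+ 2),
      sdot leb3 x y = \int[mu]_l (fr j k l * c l ^+ 2) &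
      sdot leb3 x (fun z => 'i%C * y z) = \int[mu]_l (fi j k l * c l ^+ 2)].
Proof.
move=> tx ty mc XE YE.
have mf (f : R -> R) : measurable_fun setT (f : T1 -> T1) ->
    measurable_fun setT (fun l : T1 => f l * c l ^+ 2 : T1).
  by move=> mf; apply: measurable_funM => //; exact: measurable_funX.
have [mjj _] := measurable_eta j j; have [mkk _] := measurable_eta k k.
have [mr mi] := measurable_eta j k.
have zz (f : R -> R) : (forall l, l <= 0 -> f l = 0) ->
    forall l, l <= 0 -> f l * c l ^+ 2 = 0.
  by move=> f0 l /f0 ->; rewrite mul0r.
have z0 i i' l : l <= 0 -> fr i i' l = 0 by move=> /(eta_le0 i i')[].
have z1 i i' l : l <= 0 -> fi i i' l = 0 by move=> /(eta_le0 i i')[].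
have NX l : 0 < l -> l != a -> inL2 surface (X l) /\
    L2norm surface (X l) ^+ 2 = fr j j l * c l ^+ 2.
  move=> l0 la; rewrite XE//; split; first by apply: inL2Z; exact: inV.
  rewrite (eta_gt0 j j l0).1 sdotff; last exact: inV.
  by rewrite L2norm_sqrZ; [rewrite /abs2/= expr0n addr0 mulrC|exact: inV].
have NY l : 0 < l -> l != a -> inL2 surface (Y l) /\
    L2norm surface (Y l) ^+ 2 = fr k k l * c l ^+ 2.
  move=> l0 la; rewrite YE//; split; first by apply: inL2Z; exact: inV.
  rewrite (eta_gt0 k k l0).1 sdotff; last exact: inV.
  by rewrite L2norm_sqrZ; [rewrite /abs2/= expr0n addr0 mulrC|exact: inV].
have NiY l : 0 < l -> l != a -> inL2 surface (fun w => 'i%C * Y l w) /\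
    L2norm surface (fun w => 'i%C * Y l w) ^+ 2 = fr k k l * c l ^+ 2.
  by move=> l0 la; have [Yi <-] := NY l l0 la; rewrite L2norm_i; split => //; exact: inL2Z.
have Sr l : 0 < l -> l != a -> sdot surface (X l) (Y l) = fr j k l * c l ^+ 2.
  move=> l0 la; rewrite XE// YE// (eta_gt0 j k l0).1.
  rewrite sdotZl; [|exact: inV|by apply: inL2Z; exact: inV].
  by rewrite sdotC sdotZl; [rewrite sdotC; ring|exact: inV|exact: inV].
have Si l : 0 < l -> l != a ->
    sdot surface (X l) (fun w => 'i%C * Y l w) = fi j k l * c l ^+ 2.
  move=> l0 la; rewrite XE// YE// (eta_gt0 j k l0).2.
  have -> : (fun w : R3 R => 'i%C * ((c l)%:C * V k l w)) =
      (fun w => (c l)%:C * ('i%C * V k l w)) by apply/funext => w; rewrite mulrCA.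
  have iVi : inL2 surface (fun w => 'i%C * V k l w) by apply: inL2Z; exact: inV.
  rewrite sdotZl; [|exact: inV|exact: inL2Z].
  by rewrite sdotC sdotZl; [rewrite sdotC; ring|exact: iVi|exact: inV].
have [iN EN] := trace_norm tx (mf _ mjj) NX.
have [_ E1] := trace_sdot tx ty (mf _ mjj) (mf _ mkk) (mf _ mr) NX NY Sr.
have [_ E2] := trace_sdot tx (is_trace_i ty) (mf _ mjj) (mf _ mkk) (mf _ mi) NX NiY Si.
split.
- exact: (integrable_halfline (zz _ (z0 j j)) iN).
- exact: (etrans EN (Rintegral_halfline (zz _ (z0 j j)))).
- exact: (etrans E1 (Rintegral_halfline (zz _ (z0 j k)))).
- exact: (etrans E2 (Rintegral_halfline (zz _ (z1 j k)))).
Qed.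

Lemma Bmx_eq0 a l : Bmx u a l = 0 ->
  [/\ 1 + a * pv (fr 0 0) l = 0, 1 + a * pv (fr 1 1) l = 0,
      pv (fr 0 1) l = 0 & pv (fi 0 1) l = 0] /\
  [/\ fr 0 0 l = 0, fr 1 1 l = 0, fr 0 1 l = 0 & fi 0 1 l = 0].
Proof.
move=> B0; have pi0 : pi != 0 :> R by rewrite gt_eqF ?pi_gt0.
exact: (dissipative_eq0 (xsym l) (ysym l) (psym l) (qsym l) (BmxE Eu a l) pi0 B0).
Qed.

End traces_of_u.

Theorem lemma4p5 (R : realType) (u phi : 'I_2 -> R3 R -> R[i])
    (alpha0 lambda0 : R)
    (Eu : forall j, calE (u j))
    (u_orth : L2dot leb3 (u 0) (u 1) = 0)
    (lambda0_ge0 : 0 <= lambda0)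
    (phiE : forall j, is_Phi (u j) lambda0 (phi j))
    (B0 : Bmx u alpha0 lambda0 = 0)
    (hess_lt0 : \det (hessian (F1 u) (alpha0, lambda0)) < 0) :
  let d := Num.sqrt (- \det (hessian (F1 u) (alpha0, lambda0))) in
  exists (I J : set R) (lambda : 'I_2 -> R -> R),
    [/\ [/\ open I, is_interval I & I alpha0],
        [/\ open J, is_interval J & J lambda0],
        0 < lambda0 -> J `<=` `]0, +oo[,
        exists2 alpha, I alpha & lambda 0 alpha != lambda 1 alpha &
        forall j : 'I_2,
          [/\ smooth_on I (lambda j),
              forall alpha, I alpha -> J (lambda j alpha),
              lambda j alpha0 = lambda0,
              forall alpha, I alpha -> F1 u (alpha, lambda j alpha) = 0 &
              derive1 (lambda j) alpha0 =
                (L2norm leb3 (phi 0) ^+ 2 + L2norm leb3 (phi 1) ^+ 2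
                 + (-1) ^+ j * d)
                / (2 * alpha0 ^+ 2
                   * (L2norm leb3 (phi 0) ^+ 2 * L2norm leb3 (phi 1) ^+ 2
                      - ComplexField.Normc.normc
                          (L2dot leb3 (phi 0) (phi 1)) ^+ 2))]].

Proof.
pose fr := eta_re u; pose fi := eta_im u.
have [[c0 c1 cp cr] [e0z e1z pz rz]] := Bmx_eq0 Eu B0.
have tu j := let: And5 _ t _ _ _ := smooth_dtrace Eu j in t.
have mone : measurable_fun setT (fun _ : measurableTypeR R => 1 : R) by [].
have uE j l : 0 < l -> l != -1 ->
    dtrace (u j) 0 l = fun w => (1 : R)%:C * dtrace (u j) 0 l w.
  by move=> _ _; apply/funext => w; rewrite rmorph1 mul1r.
have [iu _ du1 du2] := weighted_dot Eu (tu 0) (tu 1) mone (uE 0) (uE 1).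
have oneE (f : R -> R) : \int[lebesgue_measure]_l (f l * 1 ^+ 2) = \int[lebesgue_measure]_l f l.
  by apply: eq_Rintegral => l _; rewrite expr1n mulr1.
have [Ip Ir] : \int[lebesgue_measure]_l fr 0 1 l = 0 /\
    \int[lebesgue_measure]_l fi 0 1 l = 0.
  move: u_orth; rewrite L2dotE => -[h1 h2]; split.
    exact: (etrans (esym (etrans du1 (oneE _))) h1).
  exact: (etrans (esym (etrans du2 (oneE _))) h2).
have ie0 : lebesgue_measure.-integrable setT (EFin \o fr 0 0).
  by apply: eq_integrable iu => // l _; rewrite expr1n mulr1.
have mw : measurable_fun setT (fun l : measurableTypeR R => (l - lambda0)^-1 : R).
  apply: (measurableT_comp (measurable_inv measurableT)).
  exact: measurable_funB.
have tphi j := (phiE j).2.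
have pE j l : 0 < l -> l != lambda0 ->
    (fun w => if l == lambda0 then dtrace (u j) 1 lambda0 w
              else ((l - lambda0)^-1)%:C * trace (u j) l w)
    = fun w => ((l - lambda0)^-1)%:C * dtrace (u j) 0 l w.
  by move=> _ /negbTE ->.
have [_ n0 d1 d2] := weighted_dot Eu (tphi 0) (tphi 1) mw (pE 0) (pE 1).
have [_ n1 _ _] := weighted_dot Eu (tphi 1) (tphi 1) mw (pE 1) (pE 1).
have wE (f : R -> R) : \int[lebesgue_measure]_l (f l * (l - lambda0)^-1 ^+ 2) =
    \int[lebesgue_measure]_l (f l / (l - lambda0) ^+ 2).
  by apply: eq_Rintegral => l _; rewrite exprVn.
have S j k := Schwartz_eta_re Eu j k; have Si j k := Schwartz_eta_im Eu j k.
have nE : ComplexField.Normc.normc (L2dot leb3 (phi 0) (phi 1)) ^+ 2 =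
    sdot leb3 (phi 0) (phi 1) ^+ 2 + sdot leb3 (phi 0) (fun z => 'i%C * phi 1 z) ^+ 2.
  by rewrite -abs2_normc L2dotE.
have main := real_branches (S 0 0) (S 1 1) (S 0 1) (Si 0 1) (eta_diag_ge0 Eu 0)
  (eta_form_ge0 Eu) ie0 Ip Ir e0z e1z pz rz c0 c1 cp cr.
cbv zeta in main; rewrite -(F1E Eu) in main.
cbv zeta; rewrite (etrans n0 (wE _)) (etrans n1 (wE _)) nE.
rewrite (etrans d1 (wE _)) (etrans d2 (wE _)).
have [I0 [J0 [lam [h1 h2 h3 h4 hlam]]]] := main hess_lt0.
exists I0, J0, lam; split => // j; have [p1 p2 p3 p4 p5] := hlam j; split => //.
by move=> a Ia; rewrite (F1E Eu); exact: p4.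
Qed.
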